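(* Let $(X,d,f)$ be a topological dynamical system ($(X,d)$ compact metric, $f:X\to X$ continuous) with the pseudo-orbit tracing property, and let $\mu$ be an ergodic $f$-invariant Borel probability measure. Then: (1) If $U\subset\mathscr M_{\rm inv}({\rm supp}(\mu),f)$ is a nonempty open subset of $\mathscr M_{\rm inv}(X,f)$, then $h^B_{\rm top}(\Delta_{sub}(U),f)=h^B_{\rm top}(\Delta_{cap}(U),f)=\sup_{\nu\in U}h_\nu(f)$. (2) If $K\subset\mathscr M_{\rm inv}({\rm supp}(\mu),f)$ is a convex subset whose interior in $\mathscr M_{\rm inv}(X,f)$ is nonempty, then $h^B_{\rm top}(\Delta_{sub}(K),f)=h^B_{\rm top}(\Delta_{cap}(K),f)=\sup_{\nu\in K}h_\nu(f)$.
   Context: $\mathscr M_{\rm inv}(X,f)$ is the set of $f$-invariant Borel probability measures on $X$ with the weak* topology; for $Z\subset X$, $\mathscr M_{\rm inv}(Z,f)=\{\nu\in\mathscr M_{\rm inv}(X,f):\nu(Z)=1\}$; ${\rm supp}(\mu)$ is the support of $\mu$; $h_\nu(f)$ is measure-theoretic entropy. For $x\in X$, $\mathscr E_n(x)=\frac1n\sum_{i=0}^{n-1}\delta_{f^ix}$ and $V(x)$ is the set of weak* limit points of $(\mathscr E_n(x))_n$; for $I\subset\mathscr M_{\rm inv}(X,f)$, $\Delta_{sub}(I)=\{x:V(x)\subset I\}$ and $\Delta_{cap}(I)=\{x:V(x)\cap I\ne\emptyset\}$. Pseudo-orbit tracing property: for every $\epsilon>0$ there is $\delta>0$ such that every sequence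 $(x_i)_{i\ge0}$ with $d(f(x_i),x_{i+1})\le\delta$ for all $i$ admits $x$ with $d(f^ix,x_i)<\epsilon$ for all $i\ge0$. Bowen topological entropy $h^B_{\rm top}(Z,f)$: with $d_n(x,y)=\max_{0\le i<n}d(f^ix,f^iy)$, $B_n(x,\epsilon)$ the open $d_n$-ball, $\Gamma_N(Z,\epsilon)$ the finite or countable covers of $Z$ by $B_n(x,\epsilon)$ with $n\ge N$, $m(Z,s,N,\epsilon)=\inf_{\mathcal C\in\Gamma_N(Z,\epsilon)}\sum_{B_n(x,\epsilon)\in\mathcal C}e^{-ns}$, $m(Z,s,\epsilon)=\lim_N m(Z,s,N,\epsilon)$, $h_{\rm top}(Z,\epsilon)=\inf\{s:m(Z,s,\epsilon)=0\}$, $h^B_{\rm top}(Z,f)=\lim_{\epsilon\to0}h_{\rm top}(Z,\epsilon)$. *)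

(* Defs.v *)
From HB Require Import structures.
From mathcomp Require Import all_boot all_order all_algebra.
From mathcomp Require Import all_classical all_reals all_analysis.
Import Order.TTheory GRing.Theory Num.Theory.
Import numFieldNormedType.Exports.

Set Implicit Arguments.
Unset Strict Implicit.
Unset Printing Implicit Defensive.

Local Open Scope classical_set_scope.
Local Open Scope ring_scope.

Section Dynamics.
Context {R : realType} {d : measure_display} {X : measurableType d}.
Variable dist : X -> X -> R.
Variable f : X -> X.

Definition is_metric : Prop :=
  (forall x y, dist x y = 0 <-> x = y) /\
  (forall x y, dist x y = dist y x) /\
  (forall x y z, dist x z <= dist x y + dist y z).

Definition dball (x : X) (r : R) : set X := [set y | dist x y < r].

Definition dopen (A : set X) : Prop :=
  forall x, A x -> exists2 r : R, 0 < r & dball x r `<=` A.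

Definition borel_for_dist : Prop :=
  forall A : set X, measurable A <-> <<s dopen >> A.

Definition dcompact : Prop :=
  forall u : nat -> X, exists (x : X) (phi : nat -> nat),
    (forall n, (phi n < phi n.+1)%N) /\
    (forall eps : R, 0 < eps -> exists N, forall n, (N <= n)%N ->
       dist (u (phi n)) x < eps).

Definition dcontinuous_map (g : X -> X) : Prop :=
  forall x (eps : R), 0 < eps -> exists2 del : R, 0 < del &
    forall y, dist x y < del -> dist (g x) (g y) < eps.

Definition dcontinuous_fun (g : X -> R) : Prop :=
  forall x (eps : R), 0 < eps -> exists2 del : R, 0 < del &
    forall y, dist x y < del -> `|g x - g y| < eps.

Definition POTP : Prop :=
  forall eps : R, 0 < eps -> exists2 del : R, 0 < del &
    forall xs : nat -> X, (forall i, dist (f (xs i)) (xs i.+1) <= del) ->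
      exists x, forall i, dist (iter i f x) (xs i) < eps.

Definition invariant (P : probability X R) : Prop :=
  forall A, measurable A -> P (f @^-1` A) = P A.

Definition Minv_on (Z : set X) : set (probability X R) :=
  [set P | invariant P /\ P Z = 1%E].

Definition ergodic (P : probability X R) : Prop :=
  invariant P /\
  forall A, measurable A -> f @^-1` A = A -> P A = 0%E \/ P A = 1%E.

Definition supp (P : probability X R) : set X :=
  [set x | forall r : R, 0 < r -> (0 < P (dball x r))%E].

Definition Pint (P : probability X R) (g : X -> R) : R :=
  fine (\int[P]_x (g x)%:E).

Definition wnbhd (k : nat) (gs : 'I_k -> X -> R) (eps : R)
    (nu nu' : probability X R) : Prop :=
  forall i, `|Pint nu' (gs i) - Pint nu (gs i)| < eps.

Definition basic_data (k : nat) (gs : 'I_k -> X -> R) (eps : R) : Prop :=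
  (forall i, dcontinuous_fun (gs i)) /\ 0 < eps.

Definition wopen_in_Minv (U : set (probability X R)) : Prop :=
  forall nu, U nu -> exists k (gs : 'I_k -> X -> R) eps,
    basic_data gs eps /\
    forall nu', invariant nu' -> wnbhd gs eps nu nu' -> U nu'.

Definition winterior_in_Minv (K : set (probability X R)) : set (probability X R) :=
  [set nu | invariant nu /\ exists k (gs : 'I_k -> X -> R) eps,
    basic_data gs eps /\
    forall nu', invariant nu' -> wnbhd gs eps nu nu' -> K nu'].

Definition convex_set_meas (K : set (probability X R)) : Prop :=
  forall (nu1 nu2 nu : probability X R) (t : R), K nu1 -> K nu2 ->
    0 <= t <= 1 ->
    (forall A, measurable A -> nu A = (t%:E * nu1 A + (1 - t)%:E * nu2 A)%E) ->
    K nu.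

(* integral of g against E_n(x) = (1/n) sum_{i<n} delta_{f^i x} *)
Definition emp_int (x : X) (n : nat) (g : X -> R) : R :=
  n%:R^-1 * \sum_(i < n) g (iter i f x).

(* V(x): weak* limit points of (E_n(x))_n *)
Definition Vlim (x : X) : set (probability X R) :=
  [set nu | forall k (gs : 'I_k -> X -> R) eps, basic_data gs eps ->
     forall N, exists2 n, (N <= n)%N &
       forall i, `|emp_int x n (gs i) - Pint nu (gs i)| < eps].

Definition Delta_sub (I : set (probability X R)) : set X :=
  [set x | Vlim x `<=` I].

Definition Delta_cap (I : set (probability X R)) : set X :=
  [set x | Vlim x `&` I !=set0].

Definition phi_ent (t : R) : R := - (t * ln t).

Definition fpartition (P : seq (set X)) : Prop :=
  (forall i, (i < size P)%N -> measurable (nth set0 P i)) /\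
  (forall i j, (i < size P)%N -> (j < size P)%N -> i <> j ->
      nth set0 P i `&` nth set0 P j = set0) /\
  (forall x, exists2 i, (i < size P)%N & nth set0 P i x).

Definition join_cell (P : seq (set X)) (n : nat) (w : 'I_n -> nat) : set X :=
  [set x | forall i : 'I_n, nth set0 P (w i) (iter i f x)].

Definition H_join (nu : probability X R) (P : seq (set X)) (n : nat) : R :=
  \sum_(w : {ffun 'I_n -> 'I_(size P)})
     phi_ent (fine (nu (join_cell P (fun i => val (w i))))).

Definition h_part (nu : probability X R) (P : seq (set X)) : R :=
  limn (fun n => H_join nu P n / n%:R).

Definition ks_entropy (nu : probability X R) : \bar R :=
  ereal_sup [set (h_part nu P)%:E | P in fpartition].

Definition dn (n : nat) (x y : X) : R :=
  \big[Num.max/0]_(i < n) dist (iter i f x) (iter i f y).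

Definition bowen_ball (n : nat) (x : X) (eps : R) : set X :=
  [set y | dn n x y < eps].

(* a finite or countable family (c j)_{j in J} of Bowen balls B_{n_j}(x_j,eps),
   n_j >= N, covering Z *)
Definition bcover (Z : set X) (N : nat) (eps : R) (J : set nat)
    (c : nat -> X * nat) : Prop :=
  (forall j, J j -> (N <= (c j).2)%N) /\
  Z `<=` \bigcup_(j in J) bowen_ball (c j).2 (c j).1 eps.

Definition mB (Z : set X) (s : R) (N : nat) (eps : R) : \bar R :=
  ereal_inf [set e | exists J c, bcover Z N eps J c /\
     e = (\esum_(j in J) (expR (- ((c j).2%:R * s)))%:E)%E].

Definition mB_lim (Z : set X) (s : R) (eps : R) : \bar R :=
  limn (fun N => mB Z s N eps).

Definition htop_eps (Z : set X) (eps : R) : \bar R :=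
  ereal_inf [set s%:E | s in [set s : R | mB_lim Z s eps = 0%E]].

Definition hBowen (Z : set X) : \bar R :=
  lim (htop_eps Z @ 0^'+).

End Dynamics.

(* Main.v *)
(* Upper bound (Bowen): if some limit measure of x has entropy at most t, then
   along a subsequence the name of the orbit of x by long words costs about
   nt in a code adapted to that measure; by Kraft's inequality there are few
   such names, and countably many codes suffice.

   Lower bound: let Y be the support of mu. Ergodicity links any two points of Y
   by pseudo-orbits of bounded length. If invariant measures near nu0 all live
   on Y, then a finite pseudo-orbit between points of Y is traced by a point of
   Y itself: close it up with a long loop having the statistics of nu0 and look
   at the limit measures of a point tracing the resulting periodic
   pseudo-orbit. For nu on Y and s below its entropy, typical words separated in
   Hamming distance give, at each scale, e^(ls) separated loops of length l with
   averages close to nu. Concatenating them freely, while refining the scale and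
   re-tracing the past at each change of scale, gives a tree of orbits whose
   empirical measures all converge to nu, and Kraft's inequality on this tree
   bounds the Bowen entropy of its end points from below by s. These points
   have nu as only limit measure, so they lie in Delta_sub as soon as nu is in
   the given set. *)
Require Import Defs.
From HB Require Import structures.
From mathcomp Require Import all_boot all_order all_algebra.
From mathcomp Require Import all_classical all_reals all_analysis.
From mathcomp Require Import measurable_realfun.
From mathcomp Require Import ring lra zify.
Import Order.TTheory GRing.Theory Num.Theory.
Import numFieldNormedType.Exports.

Set Implicit Arguments.
Unset Strict Implicit.
Unset Printing Implicit Defensive.

Local Open Scope classical_set_scope.
Local Open Scope ring_scope.

(** * Compact metric spaces *)

(** The balls of a Bowen cover have different lengths, so counting orbits at one length cannot bound
    this entropy from below; weights of words can. Separation is needed at one fixed scale, because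
    the entropy is tested at one radius, whereas the tracing precision must tend to 0 for the
    averages to converge to nu itself and not just to enter a neighbourhood of it. This forces the
    stages: a pseudo-orbit for one jump size is not one for a smaller size, while the true orbit of
    a tracing point is one for every size. That orbit can be prolonged only if its end can be linked
    again, hence the need for tracing points in Y itself. In both bounds, entropy comes from
    measurable partitions but weak* convergence sees only continuous functions. Atoms are therefore
    shrunk to closed cores, a positive distance apart, and the small mass outside the cores is
    carried along as an error: wrong symbols in a Hamming estimate for the lower bound, frequencies
    too low by a little for the upper one. Limit measures are built by hand, from limits along an
    ultrafilter and a Riesz-type regularization. *)

Lemma extraction_ge (phi : nat -> nat) :
  (forall n, (phi n < phi n.+1)%N) -> forall n, (n <= phi n)%N.
Proof. by move=> hphi; elim=> // n IH; exact: leq_ltn_trans IH (hphi n). Qed.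

Lemma exists_small {R : realType} (e : R) : 0 < e ->
  exists N, forall n, (N <= n)%N -> n.+1%:R^-1 < e.
Proof.
move=> e0; exists (Num.truncn e^-1) => n Nn.
rewrite invf_plt ?posrE ?ltr0n//.
apply: (lt_le_trans (truncnS_gt _)); by rewrite ler_nat ltnS.
Qed.

Section Metric.
Context {R : realType} {d : measure_display} {X : measurableType d}.
Context (dist : X -> X -> R) (Hm : is_metric dist).

Lemma distxx x : dist x x = 0.
Proof. by case: Hm => h _; apply/h. Qed.

Lemma distC x y : dist x y = dist y x.
Proof. by case: Hm => _ [h _]. Qed.

Lemma dist_triangle y x z : dist x z <= dist x y + dist y z.
Proof. by case: Hm => _ [_ h]. Qed.

Lemma dist_ge0 x y : 0 <= dist x y.
Proof.
have := dist_triangle y x x; rewrite distxx (distC y x) -mulr2n.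
by rewrite pmulrn_lge0.
Qed.

Lemma dopen_ball x (r : R) : dopen dist (dball dist x r).
Proof.
move=> y; rewrite /dball/= => yr; exists (r - dist x y); first by rewrite subr_gt0.
move=> z; rewrite /dball/= ltrBrDl => h.
exact: le_lt_trans (dist_triangle y _ _) h.
Qed.

Lemma dopen_setI A B : dopen dist A -> dopen dist B -> dopen dist (A `&` B).
Proof.
move=> oA oB x [/oA[r r0 hr] /oB[s s0 hs]].
exists (Num.min r s); first by rewrite lt_min r0.
by move=> y /=; rewrite /dball/= lt_min => /andP[yr ys]; split; [exact: hr|exact: hs].
Qed.

Lemma dopen_bigcup (I : Type) (D : set I) (F : I -> set X) :
  (forall i, dopen dist (F i)) -> dopen dist (\bigcup_(i in D) F i).
Proof.
move=> oF x [i Di /oF[r r0 h]]; exists r => // y /h Fy; by exists i.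
Qed.

Definition dclosed (A : set X) := dopen dist (~` A).

Lemma dclosedP A : dclosed A <->
  forall x, (forall e : R, 0 < e -> exists2 a, A a & dist a x < e) -> A x.
Proof.
split=> [cA x h|h x Ax].
  apply: contrapT => /cA[r r0 hr]; have [a Aa ax] := h r r0.
  by apply: (hr a _ Aa); rewrite /dball/= distC.
apply: contrapT => hn; apply: Ax; apply: h => e e0.
apply: contrapT => hn2; apply: hn; exists e => // y /=; rewrite /dball/= => xy Ay.
by apply: hn2; exists y => //; rewrite distC.
Qed.

Lemma dclosed_setI A B : dclosed A -> dclosed B -> dclosed (A `&` B).
Proof.
move=> /dclosedP cA /dclosedP cB; apply/dclosedP => x h; split.
  by apply: cA => e /h[a [Aa _] ax]; exists a.
by apply: cB => e /h[a [_ Ba] ax]; exists a.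
Qed.

Lemma dclosed_setU A B : dclosed A -> dclosed B -> dclosed (A `|` B).
Proof. by move=> cA cB; rewrite /dclosed setCU; exact: dopen_setI. Qed.

Lemma dopen_setT : dopen dist setT.
Proof. by move=> x _; exists 1. Qed.

Lemma dopen_set0 : dopen dist set0.
Proof. by move=> x []. Qed.

Lemma dclosed_set0 : dclosed set0.
Proof. by rewrite /dclosed setC0; exact: dopen_setT. Qed.

Lemma dclosed_setT : dclosed setT.
Proof. by rewrite /dclosed setCT; exact: dopen_set0. Qed.

Lemma dclosed_setC A : dopen dist A -> dclosed (~` A).
Proof. by rewrite /dclosed setCK. Qed.

Lemma dclosed_bigsetU n (F : nat -> set X) : (forall i, dclosed (F i)) ->
  dclosed (\big[setU/set0]_(i < n) F i).
Proof.
move=> cF; elim/big_ind : _ => //; [exact: dclosed_set0|exact: dclosed_setU].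
Qed.

Definition dset (A : set X) (x : X) : R := inf [set dist a x | a in A].

Lemma has_inf_dset (A : set X) x : A !=set0 -> has_inf [set dist a x | a in A].
Proof.
move=> [a Aa]; split; first by exists (dist a x), a.
by exists 0 => _ [b _ <-]; exact: dist_ge0.
Qed.

Lemma dset_le (A : set X) a x : A a -> dset A x <= dist a x.
Proof.
move=> Aa; apply: ge_inf; last by exists a.
by exists 0 => _ [b _ <-]; exact: dist_ge0.
Qed.

Lemma dset_lt (A : set X) x r : A !=set0 -> dset A x < r ->
  exists2 a, A a & dist a x < r.
Proof.
move=> A0 h; have r0 : 0 < r - dset A x by rewrite subr_gt0.
have [_ [a Aa <-]] := inf_adherent r0 (has_inf_dset x A0).
rewrite /dset addrC subrK => h2; by exists a.
Qed.

Lemma dset_lip (A : set X) x y : A !=set0 -> dset A y <= dset A x + dist x y.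
Proof.
move=> A0; apply/ler_addgt0Pr => e e0.
have [|a Aa h] := @dset_lt A x (dset A x + e) A0; first by rewrite ltrDl.
apply: (le_trans (dset_le y Aa)); apply: (le_trans (dist_triangle x _ _)).
by rewrite addrAC lerD2r ltW.
Qed.

Lemma urysohn (A : set X) (r : R) : 0 < r -> exists g : X -> R,
  [/\ dcontinuous_fun dist g, forall x, 0 <= g x <= 1,
      forall x, A x -> g x = 1 &
      forall x, 0 < g x -> exists2 a, A a & dist a x < r].
Proof.
(* The infimum of the empty set is 0 by convention, so the formula below would give the constant 1
   for empty [A]. *)
move=> r0; have [->|/set0P A0] := eqVneq A set0.
  exists (fun=> 0); split => //; last 1 first.
  - by move=> x; rewrite ltxx.
  - by move=> x e e0; exists 1 => // y _; rewrite subrr normr0.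
  - by move=> x; rewrite lexx ler01.
pose D x := dset A x.
have D0 x : 0 <= D x.
  by apply: lb_le_inf; [case: A0 => a Aa; exists (dist a x), a|
    move=> _ [b _ <-]; exact: dist_ge0].
exists (fun x => Num.max 0 (1 - D x / r)); split.
- move=> x e e0; exists (e * r); first by rewrite mulr_gt0.
  move=> y xy.
  have h1 := dset_lip x y A0; have h2 := dset_lip y x A0; rewrite (distC y x) in h2.
  rewrite -/(D x) -/(D y) in h1 h2.
  have h3 : `|(1 - D x / r) - (1 - D y / r)| < e.
    rewrite opprD opprK addrACA subrr add0r addrC -mulrBl normrM.
    rewrite (gtr0_norm (_ : 0 < r^-1)) ?invr_gt0// ltr_pdivrMr//.
    apply: le_lt_trans xy; rewrite ler_norml; apply/andP; split; lra.
  move: h3; set u := 1 - _; set v := 1 - _; rewrite !ltr_norml => /andP[h3 h4].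
  rewrite /Num.max; case: ifPn; case: ifPn; rewrite -?leNgt => h5 h6;
   apply/andP; split; lra.
- move=> x; rewrite le_max lexx/= ge_max ler01/= gerBl divr_ge0//; exact: ltW.
- move=> x Ax; have -> : D x = 0.
    by apply/eqP; rewrite eq_le D0 andbT -(distxx x); exact: dset_le.
  by rewrite mul0r subr0 max_r.
- move=> x; rewrite lt_max ltxx/= subr_gt0 ltr_pdivrMr// mul1r.
  exact: dset_lt.
Qed.

Context (Hc : dcompact dist).

(** Otherwise points at mutual distance at least [r] could be picked one after the other, and no
    subsequence of them would converge. *)
Lemma finite_net (r : R) : 0 < r -> exists s : seq X,
  forall x, exists2 e, e \in s & dist e x < r.
Proof.
move=> r0; apply: contrapT => hn.
have /choice[g hg] : forall s : seq X, exists x, forall e, e \in s -> r <= dist e x.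
  move=> s; apply: contrapT => hs; apply: hn; exists s => x.
  apply: contrapT => hx; apply: hs; exists x => e es.
  by rewrite leNgt; apply/negP => ex; apply: hx; exists e.
pose l := fix l n := if n is m.+1 then g (l m) :: l m else [::].
pose u n := g (l n).
have lu m n : (m < n)%N -> u m \in l n.
  elim: n => // n IH; rewrite ltnS leq_eqVlt => /predU1P[->|/IH h];
  by rewrite inE ?eqxx// h orbT.
have [x [phi [hphi cv]]] := Hc u.
have [N hN] := cv (r / 2) ltac:(lra).
have : r <= dist (u (phi N)) (u (phi N.+1)) := hg _ _ (lu _ _ (hphi N)).
have := dist_triangle x (u (phi N)) (u (phi N.+1)); rewrite (distC x).
have := hN N (leqnn _); have := hN N.+1 (leqnSn _); move=> *; lra.
Qed.

(** The target carries any symmetric [e] with the triangle inequality, so that one proof serves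
    self-maps of [X] and real functions. *)
Lemma uniform_continuity (T : Type) (h : X -> T) (e : T -> T -> R) :
  (forall x y, e x y = e y x) -> (forall x y z, e x z <= e x y + e y z) ->
  (forall x (eps : R), 0 < eps -> exists2 del : R, 0 < del &
     forall y, dist x y < del -> e (h x) (h y) < eps) ->
  forall eps : R, 0 < eps -> exists2 del : R, 0 < del &
     forall x y, dist x y < del -> e (h x) (h y) < eps.
Proof.
move=> eC eT hc eps e0; apply: contrapT => hn.
have H n : exists xy : X * X, dist xy.1 xy.2 < n.+1%:R^-1 /\
    eps <= e (h xy.1) (h xy.2).
  apply: contrapT => hn2; apply: hn; exists n.+1%:R^-1; first by rewrite invr_gt0.
  move=> x y xy; rewrite ltNge; apply/negP => h1; apply: hn2; by exists (x, y).
have {H}[u hu] := choice H.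
have [x [phi [hphi cv]]] := Hc (fun n => (u n).1).
have [del d0 hd] := hc x (eps / 2) ltac:(lra).
have [N hN] := cv (del / 2) ltac:(lra).
have [N' hN'] := @exists_small R (del / 2) ltac:(lra).
pose n := maxn N N'.
have [h1 h2] := hu (phi n).
have /= h3 := hN n (leq_maxl _ _).
have h4 := hN' (phi n) (leq_trans (leq_maxr _ _) (extraction_ge hphi n)).
have := hd (u (phi n)).1; rewrite distC => /(_ ltac:(lra)) h5.
have := hd (u (phi n)).2.
have := dist_triangle (u (phi n)).1 x (u (phi n)).2; rewrite (distC x (u _).1) => h6.
have h9 := lt_trans h1 h4.
have h8 : dist x (u (phi n)).2 < del by lra.
move=> /(_ h8) h7; have := eT (h (u (phi n)).1) (h x) (h (u (phi n)).2).
rewrite (eC _ (h x)); move=> *; lra.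
Qed.

Lemma uniform_continuity_map (h : X -> X) : dcontinuous_map dist h ->
  forall eps : R, 0 < eps -> exists2 del : R, 0 < del &
     forall x y, dist x y < del -> dist (h x) (h y) < eps.
Proof.
move=> hc; apply: uniform_continuity => //; first exact: distC.
by move=> x y z; exact: dist_triangle.
Qed.

Lemma uniform_continuity_fun (g : X -> R) : dcontinuous_fun dist g ->
  forall eps : R, 0 < eps -> exists2 del : R, 0 < del &
     forall x y, dist x y < del -> `|g x - g y| < eps.
Proof.
move=> hc; apply: (uniform_continuity (e := fun a b => `|a - b|)) => //.
- by move=> x y; rewrite distrC.
- by move=> x y z; rewrite -{1}(subrK y x) -addrA; exact: ler_normD.
Qed.

Lemma continuous_bounded (g : X -> R) : dcontinuous_fun dist g ->
  exists2 B : R, 0 < B & forall x, `|g x| <= B.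
Proof.
move=> /uniform_continuity_fun /(_ 1 ltr01) [del d0 h].
have [s hs] := finite_net d0.
exists (\sum_(e <- s) `|g e| + 1).
  by rewrite ltr_wpDl// sumr_ge0.
move=> x; have [e es ex] := hs x; have := h _ _ ex.
have : `|g e| <= \sum_(e <- s) `|g e|.
  by rewrite (big_rem e)//= lerDl sumr_ge0.
have := ler_normD (g x - g e) (g e); rewrite subrK distrC; move=> *; lra.
Qed.

Lemma dcontinuous_iter (h : X -> X) n : dcontinuous_map dist h ->
  dcontinuous_map dist (iter n h).
Proof.
move=> hc; elim: n => [|n IH] x eps e0 /=; first by exists eps.
have [del d0 hd] := hc (iter n h x) eps e0.
have [del' d0' hd'] := IH x del d0.
by exists del' => // y /hd'/hd.
Qed.

Lemma uniform_iter (h : X -> X) n : dcontinuous_map dist h ->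
  forall eps : R, 0 < eps -> exists2 del : R, 0 < del & forall x y, dist x y < del ->
    forall i, (i <= n)%N -> dist (iter i h x) (iter i h y) < eps.
Proof.
move=> hc eps e0; elim: n => [|n [del d0 hd]].
  by exists eps => // x y xy i; rewrite leqn0 => /eqP ->.
have [del' d0' hd'] := uniform_continuity_map (dcontinuous_iter n.+1 hc) e0.
exists (Num.min del del'); first by rewrite lt_min d0.
move=> x y; rewrite lt_min => /andP[h1 h2] i; rewrite leq_eqVlt => /predU1P[->|].
  exact: hd'.
by rewrite ltnS => /hd; apply.
Qed.

Lemma dclosed_separated (A B : set X) : dclosed A -> dclosed B ->
  A `&` B = set0 ->
  exists2 r : R, 0 < r & forall a b, A a -> B b -> r <= dist a b.
Proof.
move=> /dclosedP cA /dclosedP cB AB0; apply: contrapT => hn.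
have H n : exists xy : X * X, [/\ A xy.1, B xy.2 & dist xy.1 xy.2 < n.+1%:R^-1].
  apply: contrapT => hn2; apply: hn; exists n.+1%:R^-1; first by rewrite invr_gt0.
  move=> a b Aa Bb; rewrite leNgt; apply/negP => h1; apply: hn2; by exists (a, b).
have {H}[u hu] := choice H.
have [x [phi [hphi cv]]] := Hc (fun n => (u n).1).
have : (A `&` B) x.
  split.
    apply: cA => e e0; have [N hN] := cv e e0; exists (u (phi N)).1 => //.
      by have [] := hu (phi N).
    exact: hN.
  apply: cB => e e0; have [N hN] := cv (e / 2) ltac:(lra).
  have [N' hN'] := @exists_small R (e / 2) ltac:(lra).
  pose n := maxn N N'; exists (u (phi n)).2; first by have [] := hu (phi n).
  have [_ _ h1] := hu (phi n).
  have /= h3 := hN n (leq_maxl _ _).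
  have h4 := hN' (phi n) (leq_trans (leq_maxr _ _) (extraction_ge hphi n)).
  have h9 := lt_trans h1 h4.
  have := dist_triangle (u (phi n)).1 (u (phi n)).2 x; rewrite (distC _ (u _).1); move=> *; lra.
by rewrite AB0.
Qed.

Lemma dclosed_finite_subcover (F : set X) (G : nat -> set X) : dclosed F ->
  (forall i, dopen dist (G i)) -> F `<=` \bigcup_i G i ->
  exists n, F `<=` \bigcup_(i in [set i | (i < n)%N]) G i.
Proof.
move=> /dclosedP cF oG FG; apply: contrapT => hn.
have H n : exists x, F x /\ forall i, (i < n)%N -> ~ G i x.
  apply: contrapT => hn2; apply: hn; exists n => x Fx.
  apply: contrapT => hx; apply: hn2; exists x; split => // i ilt Gix.
  by apply: hx; exists i.
have {H}[u hu] := choice H.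
have [x [phi [hphi cv]]] := Hc u.
have Fx : F x.
  apply: cF => e e0; have [N hN] := cv e e0; exists (u (phi N)); last exact: hN.
  by have [] := hu (phi N).
have [i _ Gix] := FG _ Fx.
have [r r0 hr] := oG i _ Gix; have [N hN] := cv r r0.
pose n := maxn N i.+1.
have [_ h1] := hu (phi n); apply: (h1 i).
  exact: leq_trans (leq_maxr _ _) (extraction_ge hphi n).
by apply: hr; rewrite /dball/= distC; apply: hN; exact: leq_maxl.
Qed.

End Metric.

(** * Borel probabilities on a compact metric space *)

Section RealProbability.
Context {R : realType} {d : measure_display} {X : measurableType d}.
Implicit Types (P : probability X R) (A B : set X) (g : X -> R).

Definition pr P A : R := fine (P A).

Lemma prE P A : measurable A -> P A = (pr P A)%:E.
Proof. by move=> mA; rewrite /pr fineK// fin_num_measure. Qed.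

Lemma pr_ge0 P A : 0 <= pr P A.
Proof. exact/fine_ge0/measure_ge0. Qed.

Lemma pr_setT P : pr P setT = 1.
Proof. by rewrite /pr probability_setT. Qed.

Lemma pr_set0 P : pr P set0 = 0.
Proof. by rewrite /pr measure0. Qed.

Lemma le_pr P A B : measurable A -> measurable B -> A `<=` B -> pr P A <= pr P B.
Proof.
by move=> mA mB AB; rewrite -lee_fin -!prE// le_measure// inE.
Qed.

Lemma pr_le1 P A : measurable A -> pr P A <= 1.
Proof. by move=> mA; rewrite -(pr_setT P); apply: le_pr. Qed.

Lemma prU P A B : measurable A -> measurable B -> A `&` B = set0 ->
  pr P (A `|` B) = pr P A + pr P B.
Proof.
move=> mA mB AB; apply/EFin_inj; rewrite EFinD -!prE//; last exact: measurableU.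
by rewrite measureU.
Qed.

Lemma prC P A : measurable A -> pr P (~` A) = 1 - pr P A.
Proof.
move=> mA; apply/eqP; rewrite eq_sym subr_eq addrC -prU ?setICr ?setUv ?pr_setT//.
exact: measurableC.
Qed.

Lemma prD P A B : measurable A -> measurable B -> B `<=` A ->
  pr P (A `\` B) = pr P A - pr P B.
Proof.
move=> mA mB BA; apply/eqP; rewrite eq_sym subr_eq addrC -prU//.
- by rewrite setDUK.
- exact: measurableD.
- by rewrite setIC setDKI.
Qed.

Lemma le_prU P A B : measurable A -> measurable B ->
  pr P (A `|` B) <= pr P A + pr P B.
Proof.
move=> mA mB; rewrite -(setDUK (@subsetUl _ A B)) prU ?setDUl ?setDv ?set0U.
- by rewrite lerD2l; apply: le_pr => //; exact: measurableD.
- by [].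
- exact: measurableD.
- by rewrite setIC setDKI.
Qed.

Lemma le_pr_bigU (I : Type) (r : seq I) P (F : I -> set X) :
  (forall i, measurable (F i)) ->
  pr P (\big[setU/set0]_(i <- r) F i) <= \sum_(i <- r) pr P (F i).
Proof.
move=> mF; elim: r => [|i r IH]; first by rewrite !big_nil pr_set0.
rewrite !big_cons (le_trans (le_prU _ _ _))// ?lerD2l//.
exact: bigsetU_measurable.
Qed.

Lemma pr_bigcup (I : finType) P (F : I -> set X) : (forall i, measurable (F i)) ->
  (forall i j, i != j -> F i `&` F j = set0) ->
  pr P (\bigcup_i F i) = \sum_i pr P (F i).
Proof.
move=> mF dF.
have -> : \bigcup_i F i = \big[setU/set0]_(i <- enum I) F i.
  rewrite -bigcup_seq; apply: eq_bigcupl; split => i //= _.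
  by rewrite mem_enum.
rewrite -[RHS]big_enum; have := enum_uniq I.
elim: (enum I) => [|i r IH] /=; first by rewrite !big_nil pr_set0.
move=> /andP[ir ur]; rewrite !big_cons prU//; last 2 first.
- exact: bigsetU_measurable.
- rewrite big_distrr/= big_seq big1// => j jr; apply: dF.
  by apply: contraNneq ir => ->.
by rewrite IH.
Qed.

Lemma pr_nondecreasing P (F : nat -> set X) (e : R) : (forall i, measurable (F i)) ->
  nondecreasing_seq F -> 0 < e ->
  exists n, pr P (\bigcup_i F i) - e < pr P (F n).
Proof.
move=> mF ndF e0.
have mU : measurable (\bigcup_i F i) by exact: bigcupT_measurable.
have : (P \o F @ \oo --> P (\bigcup_n F n))%classic by exact: nondecreasing_cvg_mu.
rewrite (prE P mU) => /fine_cvgP[_] /cvgrPdist_lt /(_ e e0)[N _ /(_ N (leqnn _))].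
by rewrite /= -/(pr P _) => h; exists N; move: h; rewrite ltr_distl => /andP[]; lra.
Qed.

Definition bmeas g := measurable_fun setT g /\ exists B : R, forall x, `|g x| <= B.

Lemma bmeas_integrable P g : bmeas g -> P.-integrable setT (EFin \o g).
Proof.
move=> [mg [B hB]]; apply: measurable_bounded_integrable => //.
  exact: (le_lt_trans (probability_le1 P measurableT) (ltry _)).
exists B; split; first exact: num_real.
by move=> M BM x _; exact: le_trans (hB x) (ltW BM).
Qed.

Lemma bmeasD g h : bmeas g -> bmeas h -> bmeas (fun x => g x + h x).
Proof.
move=> [mg [B hB]] [mh [C hC]]; split; first exact: measurable_funD.
by exists (B + C) => x; apply: le_trans (ler_normD _ _) _; exact: lerD.
Qed.

Lemma bmeasZ (a : R) g : bmeas g -> bmeas (fun x => a * g x).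
Proof.
move=> [mg [B hB]]; split; first exact: measurable_funM.
by exists (`|a| * B) => x; rewrite normrM ler_wpM2l.
Qed.

Lemma bmeas_cst (a : R) : bmeas (fun=> a).
Proof. by split; [exact: measurable_cst|exists `|a|]. Qed.

Lemma bmeas_indic A : measurable A -> bmeas (\1_A : X -> R).
Proof.
move=> mA; split; first exact: measurable_indic.
by exists 1 => x; rewrite indicE; case: (_ \in _); rewrite ?normr1 ?normr0.
Qed.

Lemma Pint_le P g h : bmeas g -> bmeas h -> (forall x, g x <= h x) ->
  Pint P g <= Pint P h.
Proof.
move=> bg bh gh; apply: (@le_Rintegral _ _ _ P setT g h) => //;
exact: bmeas_integrable.
Qed.

Lemma PintD P g h : bmeas g -> bmeas h ->
  Pint P (fun x => g x + h x) = Pint P g + Pint P h.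
Proof.
by move=> bg bh; apply: (@RintegralD _ _ _ P setT g h) => //; exact: bmeas_integrable.
Qed.

Lemma PintZ P (a : R) g : bmeas g -> Pint P (fun x => a * g x) = a * Pint P g.
Proof.
by move=> bg; apply: (@RintegralZl _ _ _ P setT g a) => //; exact: bmeas_integrable.
Qed.

Lemma Pint_cst P (a : R) : Pint P (fun=> a) = a.
Proof.
transitivity (a * pr P setT); last by rewrite pr_setT mulr1.
exact: (@Rintegral_cst _ _ _ P setT measurableT a).
Qed.

Lemma Pint_indic P A : measurable A -> Pint P (\1_A) = pr P A.
Proof. by move=> mA; rewrite /Pint integral_indic// setIT. Qed.

Lemma bmeas_sum (I : Type) (r : seq I) (F : I -> X -> R) :
  (forall i, bmeas (F i)) -> bmeas (fun x => \sum_(i <- r) F i x).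
Proof.
move=> bF; elim: r => [|i r IH].
  by under eq_fun do rewrite big_nil; exact: bmeas_cst.
by under eq_fun do rewrite big_cons; exact: bmeasD.
Qed.

Lemma Pint_sum P (I : Type) (r : seq I) (F : I -> X -> R) :
  (forall i, bmeas (F i)) ->
  Pint P (fun x => \sum_(i <- r) F i x) = \sum_(i <- r) Pint P (F i).
Proof.
move=> bF; elim: r => [|i r IH].
  by under eq_fun do rewrite big_nil; rewrite big_nil Pint_cst.
under eq_fun do rewrite big_cons; rewrite big_cons PintD ?IH//.
exact: bmeas_sum.
Qed.

Lemma Pint_norm_le P g (B : R) : bmeas g -> (forall x, `|g x| <= B) -> `|Pint P g| <= B.
Proof.
move=> bg hB; rewrite ler_norml -(Pint_cst P (- B)) -{2}(Pint_cst P B).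
by apply/andP; split; apply: Pint_le => //; try exact: bmeas_cst;
  move=> x; have := hB x; rewrite ler_norml => /andP[].
Qed.

End RealProbability.

Section Borel.
Context {R : realType} {d : measure_display} {X : measurableType d}.
Context (dist : X -> X -> R) (Hm : is_metric dist) (Hb : borel_for_dist dist).
Implicit Types (P : probability X R) (A B F G : set X).

Lemma measurable_dopen G : dopen dist G -> measurable G.
Proof. by move=> oG; apply/Hb; exact: sub_sigma_algebra. Qed.

Lemma measurable_dclosed F : dclosed dist F -> measurable F.
Proof. by move=> /measurable_dopen /measurableC; rewrite setCK. Qed.

Lemma measurable_dcontinuous_map (h : X -> X) : dcontinuous_map dist h ->
  measurable_fun setT h.
Proof.
move=> hc; have E : (measurable : set (set X)) = <<s dopen dist >>.
  by apply/seteqP; split => A /Hb.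
apply: (measurability _ E) => _ [G oG <-]; rewrite setTI.
apply: measurable_dopen => x /= /oG[r r0 hr].
have [del d0 hd] := hc x r r0; exists del => // y xy; apply: hr; exact: hd.
Qed.

Lemma bmeas_dcontinuous (Hc : dcompact dist) (g : X -> R) :
  dcontinuous_fun dist g -> bmeas g.
Proof.
move=> gc; split; last first.
  by have [B _ hB] := continuous_bounded Hm Hc gc; exists B.
apply: (measurability _ (RGenOInfty.measurableE R)) => _ [_ [a ->] <-].
rewrite setTI; apply: measurable_dopen => x /=; rewrite in_itv/= andbT => ax.
have [del d0 hd] := gc x (g x - a) ltac:(by rewrite subr_gt0).
exists del => // y /hd; rewrite /= in_itv/= andbT ltr_norml => /andP[]; lra.
Qed.

Lemma dclosed_approx G : dopen dist G -> exists F : nat -> set X,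
  [/\ forall n, dclosed dist (F n), nondecreasing_seq F & \bigcup_n F n = G].
Proof.
move=> oG; exists (fun n => [set x | dball dist x n.+1%:R^-1 `<=` G]); split.
- move=> n; apply/(dclosedP Hm) => x h y /= xy.
  have [a /= ha ax] := h (n.+1%:R^-1 - dist x y) ltac:(by rewrite subr_gt0).
  apply: ha; rewrite /dball/=; apply: le_lt_trans (dist_triangle Hm x _ _) _.
  by rewrite -ltrBrDr.
- move=> m n mn; apply/subsetPset => x /= h y xy; apply: h.
  rewrite /dball/=; apply: (lt_le_trans xy); rewrite lef_pV2 ?posrE ?ltr0n//.
  by rewrite ler_nat.
- apply/seteqP; split=> [x [n _ /=]|x Gx].
    by apply; rewrite /dball/= (distxx Hm) invr_gt0.
  have [r r0 hr] := oG x Gx; have [N hN] := exists_small r0.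
  exists N => //= y xy; apply: hr; rewrite /dball/=.
  exact: lt_trans xy (hN _ (leqnn _)).
Qed.

(** The sets with this property form a sigma-algebra containing the open sets. For a countable
    union, the closed side is cut at a finite stage, since an infinite union of closed sets need not
    be closed. *)
Lemma probability_regular P A : measurable A -> forall e : R, 0 < e ->
  exists F G, [/\ dclosed dist F, dopen dist G, F `<=` A, A `<=` G &
    pr P (G `\` F) < e].
Proof.
move=> /Hb.
suff : <<s dopen dist >> `<=` [set A | forall e : R, 0 < e ->
  exists F G, [/\ dclosed dist F, dopen dist G, F `<=` A, A `<=` G &
    pr P (G `\` F) < e]] by apply.
apply: smallest_sub; last first.
  move=> G oG e e0; have [F [cF ndF FG]] := dclosed_approx oG.
  have mF n : measurable (F n) by exact/measurable_dclosed.
  have [n hn] := pr_nondecreasing P mF ndF e0; rewrite FG in hn.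
  have FnG : F n `<=` G by rewrite -FG; exact: bigcup_sup.
  exists (F n), G; split => //; rewrite prD//; last exact: measurable_dopen.
  lra.
split.
- move=> e e0; exists set0, set0; split => //.
  + exact: dclosed_set0.
  + by rewrite setDv pr_set0.
- move=> {}A hA e e0; have [F [G [cF oG FA AG h]]] := hA e e0.
  exists (~` G), (~` F); split => //.
  + exact: dclosed_setC.
  + by rewrite setTD; exact: subsetC.
  + by rewrite setTD; exact: subsetC.
  + by rewrite setDE setCK setIC -setDE.
- move=> {}A hA e e0.
  have e4 n : 0 < (e / 2) / (2 ^ n.+1)%:R.
    by rewrite !divr_gt0// ltr0n expn_gt0.
  have /choice[F' hF'] : forall n, exists FG : set X * set X,
      [/\ dclosed dist FG.1, dopen dist FG.2, FG.1 `<=` A n, A n `<=` FG.2 &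
       pr P (FG.2 `\` FG.1) < (e / 2) / (2 ^ n.+1)%:R].
    by move=> n; have [F [G h]] := hA n _ (e4 n); exists (F, G).
  pose F n := (F' n).1; pose G n := (F' n).2.
  have cF n : dclosed dist (F n) by case: (hF' n).
  have oG n : dopen dist (G n) by case: (hF' n).
  have mF n : measurable (F n) by exact/measurable_dclosed.
  have mG n : measurable (G n) by exact/measurable_dopen.
  have mGU : measurable (\bigcup_n G n) by exact: bigcupT_measurable.
  have mFU : measurable (\bigcup_n F n) by exact: bigcupT_measurable.
  pose H n := \big[setU/set0]_(i < n.+1) F i.
  have cH n : dclosed dist (H n) by apply: dclosed_bigsetU.
  have mH n : measurable (H n) by apply/measurable_dclosed.
  have UH : \bigcup_n H n = \bigcup_n F n by rewrite bigcup_bigsetU_bigcup.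
  have [n hn] := @pr_nondecreasing _ _ _ P H (e / 2) mH
    (fun m n mn => ltac:(apply/subsetPset; exact: subset_bigsetU)) ltac:(lra).
  rewrite UH in hn.
  have HF : H n `<=` \bigcup_n F n by rewrite -UH; exact: bigcup_sup.
  have FG : \bigcup_n F n `<=` \bigcup_n G n.
    apply: subset_bigcup => i _ x Fx; have [_ _ h1 h2 _] := hF' i.
    exact/h2/h1.
  have HG : H n `<=` \bigcup_n G n by exact: subset_trans HF FG.
  exists (H n), (\bigcup_n G n); split => //.
  + exact: dopen_bigcup.
  + apply: (subset_trans HF); apply: subset_bigcup => i _.
    by have [_ _ h1 _ _] := hF' i.
  + by apply: subset_bigcup => i _; have [_ _ _ h1 _] := hF' i.
  + have : pr P (\bigcup_n G n `\` \bigcup_n F n) <= e / 2.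
      rewrite -lee_fin -prE; last exact: measurableD.
      apply: (@le_trans _ _ (\sum_(i <oo) P (G i `\` F i))%E).
        apply: measure_sigma_subadditive => //.
        * by move=> i; exact: measurableD.
        * exact: measurableD.
        * by move=> x [[i _ Gx] nF]; exists i => //; split=> // Fx; apply: nF; exists i.
      apply: le_trans (epsilon_trick0 xpredT (_ : 0 <= e / 2)); last lra.
      apply: lee_nneseries => i _; first by [].
      rewrite prE ?lee_fin; last exact: measurableD.
      by apply: ltW; have [_ _ _ _] := hF' i.
    rewrite !prD//; lra.
Qed.

(** Inner regularity extends the inequality to all measurable sets, and passing to complements
    reverses it. *)
Lemma le_pr_dclosed P Q : (forall F, dclosed dist F -> pr P F <= pr Q F) ->
  forall A, measurable A -> pr P A = pr Q A.
Proof.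
have H P' Q' : (forall F, dclosed dist F -> pr P' F <= pr Q' F) ->
    forall A, measurable A -> pr P' A <= pr Q' A.
  move=> h A mA; apply/ler_addgt0Pr => e e0.
  have [F [G [cF oG FA AG h1]]] := probability_regular P' mA e0.
  have mF := measurable_dclosed cF; have mG := measurable_dopen oG.
  have FG := subset_trans FA AG.
  rewrite prD// in h1; have := h F cF.
  have := le_pr P' mA mG AG; have := le_pr Q' mF mA FA; lra.
move=> h A mA; apply/eqP; rewrite eq_le H//=.
have := H _ _ h _ (measurableC mA); rewrite !prC//; lra.
Qed.

(** A Urysohn function fits between the indicator of a closed [F] and that of an open [G'] which
    exceeds [F] by little for [Q]. *)
Lemma eq_pr_Pint P Q : (forall g, dcontinuous_fun dist g -> Pint P g = Pint Q g) ->
  dcompact dist -> forall A, measurable A -> pr P A = pr Q A.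
Proof.
move=> h Hc; apply: le_pr_dclosed => F cF; apply/ler_addgt0Pr => e e0.
have mF := measurable_dclosed cF.
have [F'' [G' [cF'' oG' F''F FG' hG']]] := probability_regular Q mF e0.
have mG' := measurable_dopen oG'.
have [r r0 hr] : exists2 r : R, 0 < r & forall a b, F a -> ~ G' b -> r <= dist a b.
  apply: (dclosed_separated Hm Hc) => //; first exact: dclosed_setC.
  by rewrite -subset0 => x [Fx nGx]; exact/nGx/FG'.
have [g [gc g01 gF gr]] := urysohn Hm F r0.
have bg := bmeas_dcontinuous Hc gc.
have h1 : pr P F <= Pint P g.
  rewrite -Pint_indic//; apply: Pint_le => //; first exact: bmeas_indic.
  move=> x; rewrite indicE; case: (boolP (x \in F)); rewrite ?inE/=.
    by move=> /gF ->.
  by have /andP[] := g01 x.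
have h2 : Pint Q g <= pr Q G'.
  rewrite -Pint_indic//; apply: Pint_le => //; first exact: bmeas_indic.
  move=> x; rewrite indicE; case: (boolP (x \in G')); rewrite ?inE/=.
    by have /andP[] := g01 x.
  move=> nG; rewrite leNgt; apply/negP => /gr[a Fa].
  have nG' : ~ G' x by move=> h3; move: nG; rewrite mem_set.
  by rewrite ltNge hr.
have mF'' := measurable_dclosed cF''.
have := le_pr Q mF'' mF F''F.
rewrite prD ?(h g gc)// in hG' *; last by exact: subset_trans FG'.
rewrite (h g gc) in h1; lra.
Qed.

End Borel.

(** * Measures from finitely additive set functions *)

Section FinitelyAdditive.
Context {R : realType} {d : measure_display} {X : measurableType d}.
Context (dist : X -> X -> R) (Hm : is_metric dist) (Hb : borel_for_dist dist).
Context (Hc : dcompact dist).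

Lemma dopen_lt (g : X -> R) a : dcontinuous_fun dist g -> dopen dist [set x | g x < a].
Proof.
move=> gc x /= gx; have [del d0 hd] := gc x (a - g x) ltac:(by rewrite subr_gt0).
exists del => // y /hd /=; rewrite ltr_norml => /andP[]; lra.
Qed.

Lemma dopen_gt (g : X -> R) a : dcontinuous_fun dist g -> dopen dist [set x | a < g x].
Proof.
move=> gc x /= gx; have [del d0 hd] := gc x (g x - a) ltac:(by rewrite subr_gt0).
exists del => // y /hd /=; rewrite ltr_norml => /andP[]; lra.
Qed.

Lemma dclosed_ge (g : X -> R) a : dcontinuous_fun dist g ->
  dclosed dist [set x | a <= g x].
Proof.
move=> gc; rewrite /dclosed; have -> : ~` [set x | a <= g x] = [set x | g x < a].
  by apply/seteqP; split => x /=; rewrite ltNge => /negP.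
exact: dopen_lt.
Qed.

Lemma dclosed_le (g : X -> R) a : dcontinuous_fun dist g ->
  dclosed dist [set x | g x <= a].
Proof.
move=> gc; rewrite /dclosed; have -> : ~` [set x | g x <= a] = [set x | a < g x].
  by apply/seteqP; split => x /=; rewrite ltNge => /negP.
exact: dopen_gt.
Qed.

(** The parts of [F] outside [V] and outside [U] are disjoint closed sets; the level 1/2 of a
    Urysohn function cuts [F] between them. *)
Lemma dclosed_split (F U V : set X) : dclosed dist F -> dopen dist U ->
  dopen dist V -> F `<=` U `|` V -> exists F1 F2,
  [/\ dclosed dist F1, dclosed dist F2, F1 `<=` U, F2 `<=` V & F = F1 `|` F2].
Proof.
move=> cF oU oV FUV.
have cA : dclosed dist (F `\` V) by apply: (dclosed_setI Hm) => //; exact: dclosed_setC.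
have cB : dclosed dist (F `\` U) by apply: (dclosed_setI Hm) => //; exact: dclosed_setC.
have [r r0 hr] : exists2 r : R, 0 < r &
    forall a b, (F `\` V) a -> (F `\` U) b -> r <= dist a b.
  apply: (dclosed_separated Hm Hc) => //.
  by rewrite -subset0 => x [[Fx nV] [_ nU]]; have [] := FUV x Fx.
have [g [gc g01 gA gr]] := urysohn Hm (F `\` V) r0.
exists (F `&` [set x | 2^-1 <= g x]), (F `&` [set x | g x <= 2^-1]); split.
- by apply: (dclosed_setI Hm) => //; exact: dclosed_ge.
- by apply: (dclosed_setI Hm) => //; exact: dclosed_le.
- move=> x [Fx /= gx]; apply: contrapT => nU.
  have [|a Aa] := gr x; first by apply: lt_le_trans gx; rewrite invr_gt0.
  by rewrite ltNge hr.
- move=> x [Fx /= gx]; apply: contrapT => nV; move: gx; rewrite gA//.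
  by rewrite leNgt invf_lt1// ltr1n.
- by rewrite -setIUr setIidl// => x _ /=; case: (lerP 2^-1 (g x)) => [|/ltW]; [left|right].
Qed.

Context (la : set X -> R) (la_ge0 : forall A, 0 <= la A) (la_T : la setT = 1).
Context (laU : forall A B, A `&` B = set0 -> la (A `|` B) = la A + la B).

Let la0 : la set0 = 0.
Proof. by have := @laU set0 set0 (setI0 _); rewrite setU0 => h; lra. Qed.

Let le_la A B : A `<=` B -> la A <= la B.
Proof.
move=> AB; rewrite -(setDUK AB) laU ?lerDl//.
by rewrite setIC setDKI.
Qed.

Let le_laU A B : la (A `|` B) <= la A + la B.
Proof.
rewrite -(setDUK (@subsetUl _ A B)) laU; last by rewrite setIC setDKI.
by rewrite lerD2l setDUl setDv set0U; apply: le_la.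
Qed.

(* The Riesz construction: inner regularize [la] on open sets, then outer
   regularize. *)
Let tau (G : set X) : \bar R :=
  ereal_sup [set (la F)%:E | F in [set F | dclosed dist F /\ F `<=` G]].

Let outer (A : set X) : \bar R :=
  ereal_inf [set tau G | G in [set G | dopen dist G /\ A `<=` G]].

Let la_le_tau F G : dclosed dist F -> F `<=` G -> ((la F)%:E <= tau G)%E.
Proof. by move=> cF FG; apply: ereal_sup_ubound; exists F. Qed.

Let tau_ge0 G : (0 <= tau G)%E.
Proof. by rewrite -[0%E]/(0%:E) -la0; apply: la_le_tau => //; exact: dclosed_set0. Qed.

Let outer_le_tau A G : dopen dist G -> A `<=` G -> (outer A <= tau G)%E.
Proof. by move=> oG AG; apply: ereal_inf_lbound; exists G. Qed.

Let tau_le1 G : (tau G <= 1)%E.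
Proof. by apply: ge_ereal_sup => _ [F [cF FG] <-]; rewrite lee_fin -la_T le_la. Qed.

(** Compactness leaves finitely many [G i], among which [dclosed_split] distributes the closed
    set. *)
Let tau_sigma (G : nat -> set X) : (forall i, dopen dist (G i)) ->
  (tau (\bigcup_i G i) <= \sum_(i <oo) tau (G i))%E.
Proof.
move=> oG; apply: ge_ereal_sup => _ [F [cF FG] <-].
have [n hn] := dclosed_finite_subcover Hm Hc cF oG FG.
apply: (@le_trans _ _ (\sum_(0 <= i < n) tau (G i))%E); last first.
  by apply: nneseries_lim_ge => i _ _; exact: tau_ge0.
elim: n F cF {FG} hn => [|n IH] F cF hn.
  have -> : F = set0 by rewrite -subset0 => x /hn[].
  by rewrite la0 big_geq.
have [F1 [F2 [cF1 cF2 F1U F2G ->]]] :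
    exists F1 F2, [/\ dclosed dist F1, dclosed dist F2,
      F1 `<=` \bigcup_(i in [set i | (i < n)%N]) G i, F2 `<=` G n & F = F1 `|` F2].
  apply: dclosed_split => //; first exact: dopen_bigcup.
  move=> x /hn[i /=]; rewrite ltnS leq_eqVlt => /predU1P[->|il] Gx; first by right.
  by left; exists i.
rewrite big_nat_recr//= (@le_trans _ _ (la F1 + la F2)%:E) ?lee_fin ?le_laU//.
by rewrite EFinD leeD// ?IH// la_le_tau.
Qed.

Let outer0 : outer set0 = 0%E.
Proof.
apply/eqP; rewrite eq_le; apply/andP; split; last first.
  by apply: le_ereal_inf_tmp => _ [G _ <-]; exact: tau_ge0.
apply: (le_trans (outer_le_tau (dopen_set0 dist) (@subset_refl _ _))).
apply: ge_ereal_sup => _ [F [cF FG] <-].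
by rewrite (_ : F = set0) ?la0// -subset0.
Qed.

Let outer_ge0 A : (0 <= outer A)%E.
Proof. by apply: le_ereal_inf_tmp => _ [G _ <-]; exact: tau_ge0. Qed.

Let le_outer : {homo outer : A B / A `<=` B >-> (A <= B)%E}.
Proof.
move=> A B AB; apply: le_ereal_inf_tmp => _ [G [oG BG] <-].
by apply: outer_le_tau => //; exact: subset_trans BG.
Qed.

Let outer_fin A : (outer A \is a fin_num)%E.
Proof.
rewrite ge0_fin_numE//; apply: (@le_lt_trans _ _ 1%E); last exact: ltry.
exact: (le_trans (outer_le_tau (dopen_setT dist) (@subsetT _ A))) (tau_le1 _).
Qed.

Let outer_approx A (e : R) : 0 < e -> exists G,
  [/\ dopen dist G, A `<=` G & (tau G <= outer A + e%:E)%E].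
Proof.
move=> e0; have [_ [G [oG AG] <-] h] := lb_ereal_inf_adherent e0 (outer_fin A).
by exists G; split => //; exact: ltW.
Qed.

Let outer_sigma : sigma_subadditive outer.
Proof.
move=> A; apply/lee_addgt0Pr => e e0.
have e4 n : 0 < e / (2 ^ n.+1)%:R by rewrite divr_gt0// ltr0n expn_gt0.
have /choice[G hG] := fun n => outer_approx (A n) (e4 n).
have oG n : dopen dist (G n) by case: (hG n).
apply: (le_trans (outer_le_tau (@dopen_bigcup _ _ _ dist _ setT G oG) _)).
  by apply: subset_bigcup => i _; have [] := hG i.
apply: (le_trans (tau_sigma oG)).
apply: le_trans (epsilon_trick _ _ (ltW e0)); last by move=> n; exact: outer_ge0.
by apply: lee_nneseries => // i _; have [] := hG i.
Qed.

Let muo : {outer_measure set X -> \bar R} :=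
  HB.pack outer (isOuterMeasure.Build R X outer outer0 outer_ge0 le_outer outer_sigma).

Let tau_approx G (e : R) : 0 < e -> exists F,
  [/\ dclosed dist F, F `<=` G & (tau G <= (la F + e)%:E)%E].
Proof.
move=> e0.
have fG : tau G \is a fin_num.
  by rewrite ge0_fin_numE//; apply: le_lt_trans (tau_le1 _) (ltry _).
have [_ [F [cF FG] <-] h] := ub_ereal_sup_adherent e0 fG.
by exists F; split => //; rewrite EFinD -leeBlDr// ltW.
Qed.

Let caratheodory_dopen G : dopen dist G -> muo.-caratheodory G.
Proof.
move=> oG; apply: le_caratheodory_measurable => A /=.
apply/lee_addgt0Pr => e e0; have e4 : 0 < e / 3 by lra.
have [H [oH AH hH]] := outer_approx A e4.
have [F1 [cF1 F1H h1]] := @tau_approx (H `&` G) _ e4.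
(* [H] minus [F1] is open, contains the part of [A] outside [G], and keeps [F2] disjoint from [F1];
   [H] minus [G] need not be open. *)
have [F2 [cF2 F2H h2]] := @tau_approx (H `\` F1) _ e4.
have le1 : (outer (A `&` G) <= (la F1 + e / 3)%:E)%E.
  apply: le_trans h1; apply: outer_le_tau; first exact: dopen_setI.
  exact: setSI.
have le2 : (outer (A `&` ~` G) <= (la F2 + e / 3)%:E)%E.
  apply: le_trans h2; apply: outer_le_tau; first exact: dopen_setI.
  by move=> x [Ax nG]; split; [exact: AH|move=> /F1H[]].
have le3 : ((la F1 + la F2)%:E <= tau H)%E.
  rewrite -laU; last by rewrite -subset0 => x [Fx /F2H[]].
  apply: la_le_tau; first exact: (dclosed_setU).
  by move=> x [/F1H[]|/F2H[]].
apply: (le_trans (leeD le1 le2)).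
apply: (@le_trans _ _ ((la F1 + la F2)%:E + (e / 3 + e / 3)%:E)%E).
  by rewrite -!EFinD lee_fin; lra.
apply: (le_trans (leeD (le_trans le3 hH) (lexx _))).
rewrite -addeA -EFinD leeD2l// lee_fin; lra.
Qed.

Let caratheodory_measurable A : measurable A -> muo.-caratheodory A.
Proof.
move=> /Hb; apply: (@smallest_sub _ (sigma_algebra setT) (dopen dist)); last first.
  by move=> G; exact: caratheodory_dopen.
split.
- exact: caratheodory_measurable_set0.
- by move=> B mB; rewrite setTD; exact: caratheodory_measurable_setC.
- exact: caratheodory_measurable_bigcup.
Qed.

Let outer_sigma_additive : semi_sigma_additive (outer : set X -> \bar R).
Proof.
move=> F mF tF mU.
by apply: (@caratheodory_measure_sigma_additive _ _ muo) => //;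
  [move=> i; exact: caratheodory_measurable|exact: caratheodory_measurable].
Qed.

Let outer_mu : {measure set X -> \bar R} :=
  HB.pack outer (isMeasure.Build d X R outer outer0 outer_ge0 outer_sigma_additive).

Let outer_setT : outer_mu setT = 1%E.
Proof.
apply/eqP; rewrite eq_le; apply/andP; split.
  by apply: (le_trans (outer_le_tau (dopen_setT dist) (@subset_refl _ _))).
apply: le_ereal_inf_tmp => _ [G [_ TG] <-]; rewrite -[1%E]/(1%:E) -la_T.
by apply: la_le_tau => //; exact: dclosed_setT.
Qed.

(** Mass that [la] places outside a closed set may accumulate on it, so equality can fail. The
    one-sided bound is still enough to identify the integrals of continuous functions. *)
Lemma probability_of_finitely_additive :
  exists P : probability X R, forall F, dclosed dist F -> la F <= pr P F.
Proof.
pose P : probability X R :=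
  HB.pack (outer : set X -> \bar R) outer_mu
    (Measure_isProbability.Build d X R outer_mu outer_setT).
exists P => F cF; rewrite -lee_fin -prE; last exact: (measurable_dclosed Hb).
by apply: le_ereal_inf_tmp => _ [G [_ FG] <-]; exact: la_le_tau.
Qed.

End FinitelyAdditive.

(** * Limits of empirical measures *)

Section UltraLimit.
Context {R : realType}.

(** The limit is the supremum of the levels that [u] reaches on a set of the ultrafilter. *)
Lemma ultra_limit (G : set_system nat) (u : nat -> R) (B : R) : UltraFilter G ->
  (forall n, `|u n| <= B) ->
  exists l : R, forall e : R, 0 < e -> G [set n | `|u n - l| < e].
Proof.
move=> GU hB; pose S : set R := [set r : R | G [set n | r <= u n]].
have SB : ubound S B.
  move=> r /= Gr; have [n /= rn] := filter_ex Gr.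
  by apply: (le_trans rn); have := hB n; rewrite ler_norml => /andP[].
have hS : has_sup S.
  split; last by exists B.
  exists (- B); apply: filterS (@filterT _ G _) => n _ /=.
  by have := hB n; rewrite ler_norml => /andP[].
exists (sup S) => e e0.
have [r Sr hr] := sup_adherent e0 hS.
have [Se|] := in_ultra_setVsetC [set n | sup S + e / 2 <= u n] GU.
  have : sup S + e / 2 <= sup S by apply: ub_le_sup => //; exists B.
  lra.
move=> h; apply: filterS (filterI Sr h) => n [/= h1 /negP h2].
by rewrite -ltNge in h2; rewrite ltr_norml; apply/andP; split; lra.
Qed.

Lemma ultra_limit_unique (G : set_system nat) (u : nat -> R) (l l' : R) :
  UltraFilter G -> (forall e : R, 0 < e -> G [set n | `|u n - l| < e]) ->
  (forall e : R, 0 < e -> G [set n | `|u n - l'| < e]) -> l = l'.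
Proof.
move=> GU h h'; apply/eqP; rewrite -subr_eq0 -normr_le0; apply/ler_addgt0Pr => e e0.
have e2 : 0 < e / 2 by lra.
have [n [/= h1 h2]] := filter_ex (filterI (h _ e2) (h' _ e2)).
move: h1 h2; rewrite add0r ler_norml !ltr_norml => /andP[? ?] /andP[? ?].
by apply/andP; split; lra.
Qed.

End UltraLimit.

Section Empirical.
Context {R : realType} {d : measure_display} {X : measurableType d} (f : X -> X).
Implicit Types (g h : X -> R).

Lemma emp_intD x n g h :
  emp_int f x n (fun y => g y + h y) = emp_int f x n g + emp_int f x n h.
Proof. by rewrite /emp_int big_split mulrDr. Qed.

Lemma emp_intZ x n a g : emp_int f x n (fun y => a * g y) = a * emp_int f x n g.
Proof. by rewrite /emp_int -mulr_sumr mulrCA. Qed.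

Lemma emp_int_cst x n (a : R) : (0 < n)%N -> emp_int f x n (fun=> a) = a.
Proof.
move=> n0; rewrite /emp_int sumr_const card_ord -[X in _ * X]mulr_natl mulKf//.
by rewrite pnatr_eq0 -lt0n.
Qed.

Lemma emp_int_le x n g h : (forall y, g y <= h y) -> emp_int f x n g <= emp_int f x n h.
Proof. by move=> gh; rewrite ler_wpM2l ?invr_ge0// ler_sum. Qed.

Lemma emp_int_sum x n (I : Type) (r : seq I) (F : I -> X -> R) :
  emp_int f x n (fun y => \sum_(i <- r) F i y) = \sum_(i <- r) emp_int f x n (F i).
Proof. by rewrite /emp_int exchange_big mulr_sumr. Qed.

Lemma emp_int_norm_le x n g (B : R) : (forall y, `|g y| <= B) ->
  `|emp_int f x n g| <= B.
Proof.
move=> hB; have B0 : 0 <= B by exact: le_trans (hB x).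
case: n => [|n]; first by rewrite /emp_int invr0 mul0r normr0.
rewrite ler_norml -(emp_int_cst x (- B) (ltn0Sn n)) -{2}(emp_int_cst x B (ltn0Sn n)).
by apply/andP; split; apply: emp_int_le => y; have := hB y; rewrite ler_norml => /andP[].
Qed.

Lemma emp_int_shift x n g (B : R) : (forall y, `|g y| <= B) ->
  `|emp_int f x n (g \o f) - emp_int f x n g| <= 2 * B * n%:R^-1.
Proof.
move=> hB; have E : \sum_(i < n) (g \o f) (iter i f x) - \sum_(i < n) g (iter i f x) =
    g (iter n f x) - g x.
  elim: n => [|n IH]; first by rewrite !big_ord0 !subrr.
  by rewrite !big_ord_recr/= opprD addrACA IH addrC subrKA.
have n0 : 0 <= n%:R^-1 :> R by rewrite invr_ge0.
rewrite /emp_int -mulrBr E normrM (ger0_norm n0) mulrC ler_wpM2r//.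
by apply: (le_trans (ler_normB _ _)); have := hB x; have := hB (iter n f x); lra.
Qed.

End Empirical.

(** Reduces a function to its superlevel sets, which are closed for continuous [h]: only on closed
    sets is [la] compared with the measure built from it. *)
Lemma layer_cake {R : realType} {X : Type} (h : X -> R) K : (0 < K)%N ->
  (forall x, 0 <= h x <= 1) -> forall x,
  let s := \sum_(i < K) K%:R^-1 * \1_[set y | i.+1%:R / K%:R <= h y] x in
  s <= h x <= s + K%:R^-1.
Proof.
move=> K0 h01 x; rewrite -mulr_sumr /=.
have Kr : (0 : R) < K%:R by rewrite ltr0n.
have /andP[hx0 hx1] := h01 x.
have Kh0 : 0 <= h x * K%:R by rewrite mulr_ge0.
have /andP[m1 m2] := truncn_itv Kh0; set m := Num.truncn _ in m1 m2.
have mK : (m <= K)%N.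
  rewrite -(ler_nat R); apply: (le_trans m1); by rewrite ler_piMl// ltW.
have -> : \sum_(i < K) (\1_[set y | i.+1%:R / K%:R <= h y] x : R) = m%:R.
  rewrite (eq_bigr (fun i : 'I_K => ((i < m)%N)%:R)); last first.
    move=> i _; rewrite indicE; congr (_%:R); congr nat_of_bool.
    rewrite [LHS](_ : _ = (i.+1%:R / K%:R <= h x)); last by apply/idP/idP; rewrite inE.
    rewrite ler_pdivrMr//; apply/idP/idP => [h1|im].
      by rewrite -ltnS -(ltr_nat R); exact: le_lt_trans h1 m2.
    by apply: le_trans m1; rewrite ler_nat.
  rewrite -natr_sum; congr (_%:R).
  have H n : (\sum_(i < n) (i < m : nat) = minn n m)%N.
    by elim: n => [|n IH]; rewrite ?big_ord0 ?min0n// big_ord_recr/= IH; lia.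
  by rewrite H; apply/minn_idPr.
rewrite mulrC ler_pdivrMr// m1/= -[X in _ + X]mul1r -mulrDl ler_pdivlMr// natr1.
exact: ltW.
Qed.

Section Vlimit.
Context {R : realType} {d : measure_display} {X : measurableType d}.
Context (dist : X -> X -> R) (Hm : is_metric dist) (Hb : borel_for_dist dist).
Context (Hc : dcompact dist) (f : X -> X) (Hf : dcontinuous_map dist f).

(* The limit of the empirical measures of all sets along a free ultrafilter is
   finitely additive. *)
Lemma Vlim_nonempty x : Vlim dist f x !=set0.
Proof.
have [G [GU oG]] := ultraFilterLemma (F := \oo) _.
have emp1 A n : `|emp_int f x n (\1_A : X -> R)| <= 1.
  by apply: emp_int_norm_le => y; rewrite indicE; case: (_ \in _); rewrite ?normr1 ?normr0.
have /choice[la hla] := fun A => ultra_limit GU (emp1 A).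
have la_ge0 A : 0 <= la A.
  apply/ler_addgt0Pr => e e0; have [n /= h] := filter_ex (hla A e e0).
  have : 0 <= emp_int f x n (\1_A : X -> R) by rewrite mulr_ge0 ?invr_ge0// sumr_ge0.
  move: h; rewrite ltr_norml => /andP[]; lra.
have G1 : G [set n | (0 < n)%N] by apply: oG; exists 1%N.
have la_T : la setT = 1.
  apply: (ultra_limit_unique GU (hla setT)) => e e0; apply: filterS G1 => n /= n0.
  by rewrite indicT emp_int_cst// subrr normr0.
have laU A B : A `&` B = set0 -> la (A `|` B) = la A + la B.
  move=> AB; apply: (ultra_limit_unique GU (hla _)) => e e0.
  have e2 : 0 < e / 2 by lra.
  apply: filterS (filterI (hla A _ e2) (hla B _ e2)) => n [/= h1 h2].
  have -> : (\1_(A `|` B) : X -> R) = fun y => \1_A y + \1_B y.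
    apply/funext => y; rewrite !indicE in_setU.
    case: (boolP (y \in A)) => yA; case: (boolP (y \in B)) => yB;
      rewrite ?addr0 ?add0r//=.
    have : (A `&` B) y by split; exact: set_mem.
    by rewrite AB.
  rewrite emp_intD opprD addrACA.
  by apply: (le_lt_trans (ler_normD _ _)); lra.
have [P hP] := probability_of_finitely_additive Hm Hb Hc la_ge0 la_T laU.
have /choice[L hL] : forall g : X -> R, exists l : R, dcontinuous_fun dist g ->
    forall e : R, 0 < e -> G [set n | `|emp_int f x n g - l| < e].
  move=> g; have [gc|ngc] := pselect (dcontinuous_fun dist g); last by exists 0.
  have [B _ hB] := continuous_bounded Hm Hc gc.
  have [l hl] := ultra_limit GU (fun n => emp_int_norm_le f x n hB).
  by exists l.
have key h : dcontinuous_fun dist h -> (forall x, 0 <= h x <= 1) -> L h <= Pint P h.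
  move=> hc h01; apply/ler_addgt0Pr => e e0.
  have [K' /(_ _ (leqnn _)) hK'] := @exists_small R (e / 3) ltac:(lra).
  set K := K'.+1 in hK'.
  pose A i := [set y | i.+1%:R / K%:R <= h y].
  have cA i : dclosed dist (A i) by exact: dclosed_ge.
  have mA i : measurable (A i) by exact: (measurable_dclosed Hb).
  have lc := layer_cake (ltn0Sn K') h01.
  have GA : G [set n | forall i : 'I_K, `|emp_int f x n (\1_(A i) : X -> R) - la (A i)| < e / 3].
    apply: (@filter_forall _ _ (fun (i : 'I_K) =>
      [set n | `|emp_int f x n (\1_(A i) : X -> R) - la (A i)| < e / 3]) G) => i.
    by apply: hla; lra.
  have e3 : 0 < e / 3 by lra.
  have [n [[/= h1 n0] h2]] := filter_ex (filterI (filterI (hL h hc _ e3) G1) GA).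
  have h3 : emp_int f x n h <= \sum_(i < K) K%:R^-1 * emp_int f x n (\1_(A i) : X -> R) + K%:R^-1.
    under eq_bigr do rewrite -emp_intZ.
    rewrite -emp_int_sum -[X in _ <= _ + X](emp_int_cst f x _ n0) -emp_intD.
    by apply: emp_int_le => y; have /andP[] := lc y.
  have h4 : \sum_(i < K) K%:R^-1 * pr P (A i) <= Pint P h.
    have bi (i : 'I_K) : bmeas (fun y => K%:R^-1 * \1_(A i) y : R).
      exact/bmeasZ/bmeas_indic.
    rewrite (eq_bigr (fun i : 'I_K => Pint P (fun y => K%:R^-1 * \1_(A i) y))); last first.
      by move=> i _; rewrite PintZ ?Pint_indic//; exact: bmeas_indic.
    rewrite -Pint_sum//; apply: Pint_le.
    - exact: bmeas_sum.
    - exact: (bmeas_dcontinuous Hm Hb Hc hc).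
    - by move=> y; have /andP[] := lc y.
  have h5 : \sum_(i < K) K%:R^-1 * emp_int f x n (\1_(A i) : X -> R) <=
      \sum_(i < K) K%:R^-1 * pr P (A i) + e / 3.
    have -> : e / 3 = \sum_(i < K) K%:R^-1 * (e / 3).
      by rewrite sumr_const card_ord -[RHS]mulr_natl mulVKf// pnatr_eq0.
    rewrite -big_split/=; apply: ler_sum => i _; rewrite -mulrDr.
    rewrite ler_wpM2l ?invr_ge0//; have := h2 i; have := hP _ (cA i).
    rewrite ltr_norml => ? /andP[]; lra.
  move: h1; rewrite ltr_norml => /andP[]; lra.
have eqL g : dcontinuous_fun dist g -> L g = Pint P g.
  move=> gc; have [B B0 hB] := continuous_bounded Hm Hc gc.
  (* For [a] of absolute value [(2 * B)^-1] this function has values in [0, 1]; using both signs of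
     [a] turns the one-sided bound [key] into an equality. *)
  pose h a y := 2^-1 + a * g y.
  have hc a : dcontinuous_fun dist (h a).
    move=> y e e0; have [] := gc y (e / (`|a| + 1)).
      by rewrite divr_gt0// ltr_wpDl.
    move=> del d0 hd; exists del => // z /hd hz.
    rewrite /h opprD addrACA subrr add0r -mulrBr normrM.
    rewrite ltr_pdivlMr ?ltr_wpDl// in hz; apply: le_lt_trans hz.
    by rewrite mulrC ler_wpM2l// lerDl.
  have bg := bmeas_dcontinuous Hm Hb Hc gc.
  have half a : `|a| = (2 * B)^-1 -> a * L g <= a * Pint P g.
    move=> ha; have h01 y : 0 <= h a y <= 1.
      have : `|a * g y| <= 2^-1.
        rewrite normrM ha; apply: (le_trans (ler_wpM2l _ (hB y))).
          by rewrite invr_ge0; lra.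
        by rewrite invfM mulfVK ?gt_eqF.
      by rewrite ler_norml /h => /andP[? ?]; apply/andP; split; lra.
    have := key _ (hc a) h01.
    have -> : Pint P (h a) = 2^-1 + a * Pint P g.
      rewrite /h PintD ?PintZ ?Pint_cst//; first exact: bmeas_cst.
      exact: bmeasZ.
    suff -> : L (h a) = 2^-1 + a * L g by lra.
    apply: (ultra_limit_unique GU (hL _ (hc a))) => e e0.
    have e1 : 0 < e / (`|a| + 1) by rewrite divr_gt0// ltr_wpDl.
    apply: filterS (filterI G1 (hL g gc _ e1)) => n [/= n0 hn].
    rewrite /h emp_intD emp_int_cst// emp_intZ opprD addrACA subrr add0r -mulrBr normrM.
    rewrite ltr_pdivlMr ?ltr_wpDl// in hn; apply: le_lt_trans hn.
    by rewrite mulrC ler_wpM2l// lerDl.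
  have i0 : 0 < (2 * B)^-1 by rewrite invr_gt0; lra.
  have := half (2 * B)^-1 (gtr0_norm i0).
  have := half (- (2 * B)^-1); rewrite normrN (gtr0_norm i0) => /(_ erefl).
  rewrite !mulNr lerN2 !ler_pM2l// => ? ?; apply/eqP; rewrite eq_le; exact/andP.
exists P => k gs eps [gc e0] N.
have GA : G [set n | forall i : 'I_k, `|emp_int f x n (gs i) - Pint P (gs i)| < eps].
  apply: (@filter_forall _ _ (fun (i : 'I_k) =>
    [set n | `|emp_int f x n (gs i) - Pint P (gs i)| < eps]) G) => i.
  by rewrite -eqL//; exact: hL.
have GN : G [set n | (N <= n)%N] by apply: oG; exists N.
by have [n [/= h1 h2]] := filter_ex (filterI GN GA); exists n.
Qed.

Lemma dcontinuous_comp (g : X -> R) : dcontinuous_fun dist g ->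
  dcontinuous_fun dist (g \o f).
Proof.
move=> gc x e e0; have [del d0 hd] := gc (f x) e e0.
by have [del' d0' hd'] := Hf x d0; exists del' => // y /hd'/hd.
Qed.

Let mf := measurable_dcontinuous_map Hb Hf.

Let fm : {mfun X >-> X} := HB.pack f (isMeasurableFun.Build d d X X f mf).

Lemma bmeas_comp (g : X -> R) : bmeas g -> bmeas (g \o f).
Proof.
by move=> [mg [B hB]]; split; [exact: measurableT_comp|exists B => x; exact: hB].
Qed.

Lemma Pint_comp (P Q : probability X R) (g : X -> R) :
  (forall A, measurable A -> Q A = P (f @^-1` A)) -> bmeas g ->
  Pint Q g = Pint P (g \o f).
Proof.
move=> hQ bg.
rewrite /Pint; congr fine.
transitivity (\int[distribution P fm]_x (g x)%:E)%E.
  by apply: eq_measure_integral => A mA _; exact: hQ.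
apply: (integral_distribution (f := EFin \o g)).
  by apply/measurable_EFinP; case: bg.
exact: (bmeas_integrable P (bmeas_comp bg)).
Qed.

(** The averages of [g] and [g \o f] along an orbit differ only by boundary terms of order 1/n. *)
Lemma Vlim_invariant x P : Vlim dist f x P -> Defs.invariant f P.
Proof.
move=> VP.
pose Q : probability X R := distribution P fm.
have h A : measurable A -> pr P A = pr Q A.
  apply: (eq_pr_Pint Hm Hb) => // g gc.
  have bg := bmeas_dcontinuous Hm Hb Hc gc.
  rewrite (@Pint_comp P Q)//.
  have gfc := dcontinuous_comp gc.
  have [B B0 hB] := continuous_bounded Hm Hc gc.
  apply/eqP; rewrite -subr_eq0 -normr_le0; apply/ler_addgt0Pr => e e0.
  have [N hN] := @exists_small R (e / (6 * B)) ltac:(rewrite divr_gt0//; lra).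
  have bd : basic_data dist (fun i : 'I_2 => if i == ord0 then g else g \o f) (e / 3).
    by split; [move=> i; case: ifP|lra].
  have [[//|n] Nn hn] := VP _ _ _ bd N.+1.
  have /= h1 := hn ord0; have /= h2 := hn (lift ord0 ord0).
  have h3 := emp_int_shift f x n.+1 hB.
  have h4 : 2 * B * n.+1%:R^-1 <= e / 3.
    have := hN n Nn; rewrite ltr_pdivlMr; last by lra.
    by set q := n.+1%:R^-1 => hq; lra.
  move: h1 h2 (le_trans h3 h4); rewrite !ltr_norml !ler_norml => /andP[? ?] /andP[? ?] /andP[? ?].
  by apply/andP; split; lra.
move=> A mA.
have : P A = Q A by rewrite !prE// h.
exact: esym.
Qed.

End Vlimit.

(** * Entropy of finite-valued codes *)

Section Gibbs.
Context {R : realType}.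

Lemma phi_ent0 : phi_ent (0 : R) = 0.
Proof. by rewrite /phi_ent mul0r oppr0. Qed.

Lemma phi_ent_ge0 (t : R) : 0 <= t <= 1 -> 0 <= phi_ent t.
Proof.
move=> /andP[t0 t1]; rewrite /phi_ent oppr_ge0.
exact: mulr_ge0_le0 (ln_le0 t1).
Qed.

Lemma ln_le_sub1 (x : R) : 0 < x -> ln x <= x - 1.
Proof.
move=> x0; have h : -1 < x - 1 by lra.
by have := le_ln1Dx h; rewrite addrCA subrr addr0.
Qed.

Lemma gibbs (W : finType) (p q : W -> R) : (forall w, 0 <= p w) ->
  (forall w, 0 <= q w) -> (forall w, 0 < p w -> 0 < q w) ->
  \sum_w q w <= \sum_w p w ->
  \sum_w phi_ent (p w) <= - \sum_w p w * ln (q w).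
Proof.
move=> p0 q0 pq qp; rewrite -subr_ge0 -opprD oppr_ge0 -big_split/=.
apply: (@le_trans _ _ (\sum_w (q w - p w))); last first.
  by rewrite sumrB subr_le0.
apply: ler_sum => w _; rewrite /phi_ent.
have := p0 w; rewrite le_eqVlt => /predU1P[<-|pw].
  by rewrite !mul0r; have := q0 w; lra.
have qw := pq w pw.
rewrite -mulrBr -ln_div ?posrE//.
apply: (@le_trans _ _ (p w * (q w / p w - 1))).
  by rewrite ler_pM2l// ln_le_sub1// divr_gt0.
by rewrite mulrBr mulr1 mulrCA mulfV ?mulr1// gt_eqF.
Qed.

End Gibbs.

Section Fekete.
Context {R : realType}.

Lemma fekete (a : nat -> R) : (forall n, 0 <= a n) ->
  (forall n m, a (n + m)%N <= a n + a m) ->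
  exists L, [/\ (fun n => a n / n%:R) @ \oo --> L,
    forall n, (0 < n)%N -> L <= a n / n%:R &
    forall e : R, 0 < e -> exists2 n, (0 < n)%N & a n / n%:R < L + e].
Proof.
move=> a0 aD; pose S : set R := [set a n / n%:R | n in [set n | (0 < n)%N]].
have hS : has_inf S.
  split; first by exists (a 1%N / 1%:R), 1%N.
  by exists 0 => _ [n n0 <-]; rewrite divr_ge0.
have Lle n : (0 < n)%N -> inf S <= a n / n%:R.
  by move=> n0; apply: ge_inf; [case: hS|exists n].
have Ladh (e : R) : 0 < e -> exists2 n, (0 < n)%N & a n / n%:R < inf S + e.
  by move=> e0; have [_ [n n0 <-] h] := inf_adherent e0 hS; exists n.
exists (inf S); split => //.
apply/cvgrPdist_le => e e0; have [k k0 hk] := Ladh (e / 2) ltac:(lra).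
pose C := \sum_(r < k) a r.
have C0 : 0 <= C by rewrite sumr_ge0.
have [N hN] := @exists_small R (e / (2 * (C + 1))) ltac:(rewrite divr_gt0//; lra).
exists N.+1 => // -[//|n] /= Nn.
have n0 : (0 : R) < n.+1%:R by rewrite ltr0n.
have kr : (0 : R) < k%:R by rewrite ltr0n.
have amul q r : a (q * k + r)%N <= q%:R * a k + a r.
  elim: q => [|q IH]; first by rewrite mul0n add0n mul0r add0r.
  rewrite mulSn -addnA -natr1 mulrDl mul1r.
  by have := aD k (q * k + r)%N; lra.
have h1 := amul (n.+1 %/ k)%N (n.+1 %% k)%N; rewrite -divn_eq in h1.
have h2 : a (n.+1 %% k)%N <= C.
  rewrite /C (bigD1 (Ordinal (ltn_pmod n.+1 k0)))//= lerDl.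
  by rewrite sumr_ge0.
have h3 : (n.+1 %/ k)%:R * a k <= n.+1%:R * (a k / k%:R).
  rewrite -{1}[a k](divfK (lt0r_neq0 kr)) mulrCA mulrC ler_wpM2r ?divr_ge0//.
  by rewrite -natrM ler_nat leq_divM.
have h4 : a n.+1 / n.+1%:R <= a k / k%:R + e / 2.
  rewrite ler_pdivrMr// mulrDl.
  have := hN n Nn; rewrite ltr_pdivlMr; last by lra.
  rewrite ltr_pdivrMl// => h5; rewrite [X in _ <= X + _]mulrC.
  by move: h1 h2 h3 h5; set u := _ * a k; set v := n.+1%:R * _ => *; lra.
have h5 := Lle n.+1 (ltn0Sn n).
rewrite distrC ler_norml; move: h4 h5 hk.
set u := a n.+1 / _; set v := a k / _ => *; apply/andP; split; lra.
Qed.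

End Fekete.

Section Code.
Context {R : realType} {d : measure_display} {X : measurableType d}.
Context (P : probability X R).

(** Measurability of a finite-valued map, expressed by its fibers so that [W] needs no
    sigma-algebra. *)
Definition mfib (W : finType) (c : X -> W) :=
  forall w, measurable (c @^-1` [set w]).

Definition law (W : finType) (c : X -> W) (w : W) : R := pr P (c @^-1` [set w]).

Definition Hcode (W : finType) (c : X -> W) : R := \sum_w phi_ent (law c w).

Lemma law_ge0 (W : finType) (c : X -> W) w : 0 <= law c w.
Proof. exact: pr_ge0. Qed.

Lemma pr_code (W : finType) (c : X -> W) (S : pred W) : mfib c ->
  pr P [set x | S (c x)] = \sum_(w | S w) law c w.
Proof.
move=> mc; pose F w := if S w then c @^-1` [set w] else set0.
have -> : [set x | S (c x)] = \bigcup_w F w.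
  apply/seteqP; split=> [x /= Sx|x [w _]].
    by exists (c x) => //; rewrite /F Sx.
  by rewrite /F; case: ifP => // Sw /= ->.
rewrite pr_bigcup.
- rewrite [RHS]big_mkcond/=; apply: eq_bigr => w _; rewrite /F.
  by case: ifP; rewrite ?pr_set0.
- by move=> w; rewrite /F; case: ifP.
- move=> w w' ww'; rewrite /F -subset0 => x [].
  case: ifP => // _ /= E1; case: ifP => // _ /= E2.
  by rewrite -E1 -E2 eqxx in ww'.
Qed.

Lemma law_sum (W : finType) (c : X -> W) : mfib c -> \sum_w law c w = 1.
Proof.
move=> mc; rewrite -(pr_code xpredT mc) -(pr_setT P); congr pr.
by apply/seteqP; split.
Qed.

Lemma law_le1 (W : finType) (c : X -> W) w : mfib c -> law c w <= 1.
Proof. by move=> mc; exact: pr_le1. Qed.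

Lemma law_comp (W V : finType) (c : X -> W) (psi : W -> V) v : mfib c ->
  law (psi \o c) v = \sum_(w | psi w == v) law c w.
Proof.
move=> mc; rewrite -(pr_code _ mc); congr pr.
by apply/seteqP; split=> x /= /eqP.
Qed.

Lemma sum_law_comp (W V : finType) (c : X -> W) (psi : W -> V) (F : V -> R) :
  mfib c -> \sum_v law (psi \o c) v * F v = \sum_w law c w * F (psi w).
Proof.
move=> mc; rewrite [RHS](partition_big psi xpredT)//=; apply: eq_bigr => v _.
rewrite law_comp// mulr_suml; apply: eq_bigr => w /eqP ->//.
Qed.

Lemma mfib_ffun (I W : finType) (c : I -> X -> W) : (forall i, mfib (c i)) ->
  mfib (fun x => [ffun i => c i x]).
Proof.
move=> mc w; have -> : (fun x => [ffun i => c i x]) @^-1` [set w] =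
    \bigcap_(i in [set: I]) (c i @^-1` [set w i]).
  apply/seteqP; split=> x /= => [<- i _ /=|h]; first by rewrite ffunE.
  by apply/ffunP => i; rewrite ffunE; exact: h.
by apply: fin_bigcap_measurable => // i _; exact: mc.
Qed.

Lemma mfib_pair (W V : finType) (c : X -> W) (e : X -> V) : mfib c -> mfib e ->
  mfib (fun x => (c x, e x)).
Proof.
move=> mc me [w v]; have -> : (fun x => (c x, e x)) @^-1` [set (w, v)] =
    (c @^-1` [set w]) `&` (e @^-1` [set v]).
  by apply/seteqP; split=> x /= => [[]|[-> ->]].
exact: measurableI.
Qed.

Lemma Hcode_inj (W V : finType) (c : X -> W) (psi : W -> V) : mfib c ->
  bijective psi -> Hcode (psi \o c) = Hcode c.
Proof.
move=> mc bpsi; rewrite /Hcode (reindex psi) /=; last exact: onW_bij.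
apply: eq_bigr => w _; congr phi_ent; rewrite law_comp//.
under eq_bigl do rewrite (bij_eq bpsi).
by rewrite big_pred1_eq.
Qed.

Lemma Hcode_ge0 (W : finType) (c : X -> W) : mfib c -> 0 <= Hcode c.
Proof. by move=> mc; apply: sumr_ge0 => w _; rewrite phi_ent_ge0// law_ge0 law_le1. Qed.

(** Gibbs' inequality for the joint law against the product of its marginals. *)
Lemma Hcode_pair (W V : finType) (c : X -> W) (e : X -> V) : mfib c -> mfib e ->
  Hcode (fun x => (c x, e x)) <= Hcode c + Hcode e.
Proof.
move=> mc me; have mce := mfib_pair mc me; set ce := fun x => _ in mce *.
pose q (wv : W * V) := law c wv.1 * law e wv.2.
have le1 wv : law ce wv <= law c wv.1.
  rewrite -[c]/(fst \o ce) law_comp// (bigD1 wv)//= lerDl.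
  by apply: sumr_ge0 => *; exact: law_ge0.
have le2 wv : law ce wv <= law e wv.2.
  rewrite -[e]/(snd \o ce) law_comp// (bigD1 wv)//= lerDl.
  by apply: sumr_ge0 => *; exact: law_ge0.
apply: (le_trans (@gibbs _ _ (law ce) q _ _ _ _)).
- by move=> wv; exact: law_ge0.
- by move=> wv; rewrite mulr_ge0// law_ge0.
- by move=> wv pw; rewrite mulr_gt0// (lt_le_trans pw).
- rewrite law_sum// -(pair_bigA _ (fun w v => law c w * law e v))/=.
  under eq_bigr do rewrite -mulr_sumr (law_sum me) mulr1.
  by rewrite law_sum.
have E wv : law ce wv * ln (q wv) =
    law ce wv * ln (law c wv.1) + law ce wv * ln (law e wv.2).
  have := law_ge0 ce wv; rewrite le_eqVlt => /predU1P[<-|pw].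
    by rewrite !mul0r addr0.
  by rewrite -mulrDr lnM// posrE (lt_le_trans pw).
under eq_bigr do rewrite E.
rewrite big_split/= opprD.
rewrite -(sum_law_comp fst (fun w => ln (law c w)) mce).
rewrite -(sum_law_comp snd (fun w => ln (law e w)) mce).
by rewrite /Hcode /phi_ent !sumrN.
Qed.

End Code.

Section Cylinder.
Context {R : realType} {d : measure_display} {X : measurableType d}.
Context (f : X -> X) (mf : measurable_fun setT f).
Context (P : probability X R) (Pf : Defs.invariant f P).

Definition cyl (W : finType) (c : X -> W) n (x : X) : {ffun 'I_n -> W} :=
  [ffun i : 'I_n => c (iter i f x)].

Lemma measurable_fun_iter n : measurable_fun setT (iter n f).
Proof. by elim: n => [|n IH]; [exact: measurable_id|exact: (measurableT_comp mf IH)]. Qed.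

Lemma measurable_preimage_iter n A : measurable A -> measurable (iter n f @^-1` A).
Proof.
by move=> mA; have := measurable_fun_iter n measurableT mA; rewrite setTI.
Qed.

Lemma pr_iter n A : measurable A -> pr P (iter n f @^-1` A) = pr P A.
Proof.
elim: n A => [//|n IH] A mA.
rewrite -[iter n.+1 f @^-1` A]/(iter n f @^-1` (f @^-1` A)) IH.
  by rewrite /pr Pf.
exact: (measurable_preimage_iter 1 mA).
Qed.

Context (W : finType) (c : X -> W) (mc : mfib c).

Lemma mfib_iter n : mfib (c \o iter n f).
Proof. by move=> w; exact: (measurable_preimage_iter n (mc w)). Qed.

Lemma law_iter n w : law P (c \o iter n f) w = law P c w.
Proof. exact: (pr_iter n (mc w)). Qed.

Lemma mfib_cyl n : mfib (cyl c n).
Proof. by apply: mfib_ffun => i; exact: mfib_iter. Qed.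

Lemma sum_law_cyl n (F : W -> R) :
  \sum_w law P (cyl c n) w * (\sum_(i < n) F (w i)) = n%:R * \sum_a law P c a * F a.
Proof.
under eq_bigr do rewrite mulr_sumr.
rewrite exchange_big/= -[X in _ = X%:R * _](card_ord n) mulr_natl -sumr_const.
apply: eq_bigr => i _.
rewrite -(sum_law_comp P (fun w : {ffun 'I_n -> W} => w i) F (@mfib_cyl n)).
apply: eq_bigr => a _; congr (_ * _); rewrite -(law_iter i).
by congr law; apply/funext => x /=; rewrite ffunE.
Qed.

Let glue n m (uv : {ffun 'I_n -> W} * {ffun 'I_m -> W}) : {ffun 'I_(n + m) -> W} :=
  [ffun i : 'I_(n + m) => match fintype.split i with inl j => uv.1 j | inr j => uv.2 j end].

Let glue_bij n m : bijective (@glue n m).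
Proof.
exists (fun w : {ffun 'I_(n + m) -> W} =>
  ([ffun j => w (lshift m j)], [ffun j => w (rshift n j)])).
  move=> [u v]; congr pair; apply/ffunP => j; rewrite !ffunE.
    by rewrite (unsplitK (inl j)).
  by rewrite (unsplitK (inr j)).
move=> w; apply/ffunP => i; rewrite !ffunE.
by case: splitP => j E /=; rewrite ffunE; congr (w _); apply/val_inj.
Qed.

(** The itinerary of length [n + m] is that of length [n] paired with a shifted one, whose law is
    unshifted by invariance. *)
Lemma Hcode_cylD n m :
  Hcode P (cyl c (n + m)) <= Hcode P (cyl c n) + Hcode P (cyl c m).
Proof.
have mm : mfib (cyl c m \o iter n f).
  by move=> w; exact: (measurable_preimage_iter n (mfib_cyl w)).
have -> : Hcode P (cyl c m) = Hcode P (cyl c m \o iter n f).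
  apply: eq_bigr => w _; congr phi_ent.
  exact/esym/(pr_iter n (mfib_cyl w)).
have -> : cyl c (n + m) = @glue n m \o (fun x => (cyl c n x, (cyl c m \o iter n f) x)).
  apply/funext => x; apply/ffunP => i; rewrite !ffunE.
  by case: splitP => j -> /=; rewrite ffunE// addnC iterD.
rewrite Hcode_inj; [|by apply: mfib_pair => //; exact: mfib_cyl|exact: glue_bij].
by apply: Hcode_pair => //; exact: mfib_cyl.
Qed.

Lemma Hcode_cyl_fekete : exists L,
  [/\ (fun n => Hcode P (cyl c n) / n%:R) @ \oo --> L,
    forall n, (0 < n)%N -> L <= Hcode P (cyl c n) / n%:R &
    forall e : R, 0 < e ->
      exists2 n, (0 < n)%N & Hcode P (cyl c n) / n%:R < L + e].
Proof.
apply: fekete => [n|n m]; last exact: Hcode_cylD.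
by apply: Hcode_ge0; exact: mfib_cyl.
Qed.

End Cylinder.

Section Partition.
Context {R : realType} {d : measure_display} {X : measurableType d}.
Context (f : X -> X) (mf : measurable_fun setT f).
Context (P : probability X R) (Pf : Defs.invariant f P).

Lemma fpartition_code (Q : seq (set X)) : fpartition Q ->
  exists c : X -> 'I_(size Q), mfib c /\
    (forall x (i : 'I_(size Q)), nth set0 Q i x <-> c x = i).
Proof.
move=> [mQ [dQ cQ]].
have /choice[c hc] : forall x, exists i : 'I_(size Q), nth set0 Q i x.
  by move=> x; have [i iQ Qi] := cQ x; exists (Ordinal iQ).
have cE x (i : 'I_(size Q)) : nth set0 Q i x <-> c x = i.
  split=> [Qix|<-//]; apply/val_inj/eqP/negPn/negP => /eqP h.
  by have := dQ _ _ (ltn_ord (c x)) (ltn_ord i) h; rewrite -subset0 => /(_ x); apply.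
exists c; split => // i; have -> : c @^-1` [set i] = nth set0 Q i.
  by apply/seteqP; split=> x /= /cE.
exact: mQ.
Qed.

Lemma H_join_code (Q : seq (set X)) (c : X -> 'I_(size Q)) n :
  (forall x (i : 'I_(size Q)), nth set0 Q i x <-> c x = i) ->
  H_join f P Q n = Hcode P (cyl f c n).
Proof.
move=> cE; apply: eq_bigr => w _; congr (phi_ent (fine (P _))).
apply/seteqP; split=> x /=.
  by move=> h; apply/ffunP => i; rewrite ffunE; apply/cE; exact: h.
by move=> <- i; rewrite ffunE; exact/cE.
Qed.

(** By subadditivity the limit in [h_part] exists and is an infimum. The lower bound uses that it
    lies below every quotient, the upper bound that some quotient comes close to it. *)
Lemma h_part_code (Q : seq (set X)) : fpartition Q ->
  exists c : X -> 'I_(size Q), [/\ mfib c,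
    (forall x (i : 'I_(size Q)), nth set0 Q i x <-> c x = i),
    (forall n, (0 < n)%N -> h_part f P Q <= Hcode P (cyl f c n) / n%:R) &
    forall e : R, 0 < e ->
      exists2 n, (0 < n)%N & Hcode P (cyl f c n) / n%:R < h_part f P Q + e].
Proof.
move=> /fpartition_code[c [mc cE]]; exists c; split => //.
all: have [L [cL Lle Ladh]] := Hcode_cyl_fekete mf Pf mc.
all: suff -> : h_part f P Q = L by [].
all: rewrite /h_part; apply: cvg_lim => //; apply: cvg_trans cL.
all: by under eq_fun do rewrite (H_join_code _ cE).
Qed.

Lemma h_part_ge0 (Q : seq (set X)) : fpartition Q -> 0 <= h_part f P Q.
Proof.
move=> /h_part_code[c [mc _ _ h]]; apply/ler_addgt0Pr => e /h[n n0].
move=> /ltW; apply: le_trans; rewrite divr_ge0//.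
by apply: Hcode_ge0; exact: mfib_cyl.
Qed.

End Partition.

(** * Counting *)

Section LargeNumbers.
Context {R : realType} (A : finType) (p : A -> R).
Context (p0 : forall a, 0 <= p a) (p1 : \sum_a p a = 1).

Definition pword L (w : {ffun 'I_L -> A}) : R := \prod_i p (w i).

Lemma pword_ge0 L w : 0 <= @pword L w.
Proof. exact: prodr_ge0. Qed.

Lemma pword_sum L : \sum_w @pword L w = 1.
Proof.
rewrite /pword -(bigA_distr_bigA (fun=> p))/=.
by under eq_bigr do rewrite p1; rewrite big1.
Qed.

Lemma pword_second_moment L (Z : A -> R) : \sum_a p a * Z a = 0 ->
  \sum_w @pword L w * (\sum_i Z (w i)) ^+ 2 = L%:R * \sum_a p a * Z a ^+ 2.
Proof.
move=> Z0.
(* Attaches the factors of [Z (w i) * Z (w j)] to their coordinates, so that the sum over words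
   becomes a product over coordinates. *)
pose F (i j k : 'I_L) a := p a * (if k == i then Z a else 1) * (if k == j then Z a else 1).
have E i j : \sum_w @pword L w * (Z (w i) * Z (w j)) =
    if i == j then \sum_a p a * Z a ^+ 2 else 0.
  transitivity (\sum_(w : {ffun 'I_L -> A}) \prod_k F i j k (w k)).
    apply: eq_bigr => w _; rewrite /F !big_split/= -mulrA; congr (_ * (_ * _)).
      by rewrite -big_mkcond big_pred1_eq.
    by rewrite -big_mkcond big_pred1_eq.
  rewrite -(bigA_distr_bigA (F i j))/= (bigD1 i)//= {1}/F eqxx.
  case: eqVneq => [<-|ij].
    rewrite [X in _ * X]big1 ?mulr1.
      by apply: eq_bigr => a _; rewrite -mulrA.
    move=> k ki; rewrite -[RHS]p1; apply: eq_bigr => a _.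
    by rewrite /F (negbTE ki) !mulr1.
  by under eq_bigr do rewrite mulr1; rewrite Z0 mul0r.
transitivity (\sum_i \sum_j \sum_w @pword L w * (Z (w i) * Z (w j))).
  under [RHS]eq_bigr do rewrite exchange_big/=.
  rewrite exchange_big/=; apply: eq_bigr => w _.
  rewrite expr2 mulr_suml mulr_sumr; apply: eq_bigr => i _.
  by rewrite !mulr_sumr.
rewrite -[L in RHS]card_ord mulr_natl -sumr_const; apply: eq_bigr => i _.
under eq_bigr do rewrite E.
by rewrite -big_mkcond/= (big_pred1 i)// => j; rewrite eq_sym.
Qed.

(** Chebyshev's inequality for all the observables at once: a failure for any [j] makes the sum over
    [j] of the squared deviations large, and [V] is the sum of the variances. *)
Lemma weak_law (J : finType) (Y : J -> A -> R) (eta : R) : 0 < eta ->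
  exists L0, forall L, (L0 <= L)%N ->
  2^-1 <= \sum_(w : {ffun 'I_L -> A} | [forall j,
     `|\sum_i Y j (w i) - L%:R * \sum_a p a * Y j a| <= eta * L%:R]) pword w.
Proof.
move=> e0; pose E j := \sum_a p a * Y j a; pose Z j a := Y j a - E j.
have Z0 j : \sum_a p a * Z j a = 0.
  under eq_bigr do rewrite /Z mulrBr.
  by rewrite sumrB -mulr_suml p1 mul1r subrr.
pose V := \sum_j \sum_a p a * Z j a ^+ 2.
have V0 : 0 <= V.
  by do 2![apply: sumr_ge0 => ? _]; rewrite mulr_ge0// sqr_ge0.
exists (Num.truncn (2 * V / eta ^+ 2)).+1 => L hL.
have L0 : (0 : R) < L%:R by rewrite ltr0n (leq_trans _ hL).
have hV : 2 * V <= eta ^+ 2 * L%:R.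
  rewrite [leRHS]mulrC -ler_pdivrMr ?exprn_gt0//.
  apply: (le_trans (ltW (truncnS_gt _))); by rewrite ler_nat.
pose S (w : {ffun 'I_L -> A}) := [forall j,
  `|\sum_i Y j (w i) - L%:R * \sum_a p a * Y j a| <= eta * L%:R].
rewrite -[leRHS]/(\sum_(w | S w) pword w).
suff : \sum_(w | ~~ S w) pword w <= 2^-1.
  by have := pword_sum L; rewrite (bigID S)/= => *; lra.
have bad w : ~~ S w -> eta ^+ 2 * L%:R ^+ 2 <= \sum_j (\sum_i Z j (w i)) ^+ 2.
  rewrite negb_forall => /existsP[j]; rewrite -ltNge => h.
  rewrite (bigD1 j)//= ler_wpDr//; first by apply: sumr_ge0 => *; exact: sqr_ge0.
  rewrite -exprMn -[leRHS]real_normK ?num_real// lerXn2r ?nnegrE//.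
    by rewrite mulr_ge0 ?ltW.
  apply: le_trans (ltW h) _; rewrite sumrB sumr_const card_ord.
  by rewrite mulr_natl.
have h : eta ^+ 2 * L%:R ^+ 2 * \sum_(w | ~~ S w) pword w <= L%:R * V.
  rewrite mulr_sumr.
  apply: (@le_trans _ _ (\sum_w pword w * \sum_j (\sum_i Z j (w i)) ^+ 2)).
    rewrite [leRHS](bigID S)/= ler_wpDl//.
      apply: sumr_ge0 => w _; rewrite mulr_ge0 ?pword_ge0//.
      by apply: sumr_ge0 => *; exact: sqr_ge0.
    by apply: ler_sum => w /bad hw; rewrite mulrC ler_wpM2l// pword_ge0.
  under eq_bigr do rewrite mulr_sumr.
  rewrite exchange_big/= /V mulr_sumr; apply: ler_sum => j _.
  by rewrite pword_second_moment.
have eL : 0 < eta ^+ 2 * L%:R ^+ 2 by rewrite mulr_gt0 ?exprn_gt0.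
rewrite -(ler_pM2l eL); apply: (le_trans h).
have := ler_wpM2r (ltW L0) hV.
by set l := L%:R; set e := eta ^+ 2; rewrite (expr2 l) => ?; lra.
Qed.

End LargeNumbers.

Section Hamming.
Context {R : realType} (S : finType).

Definition hdist (I : finType) (u v : {ffun I -> S}) := #|[set i | u i != v i]%SET|.

(** Give a word the factor [th] for each mismatch with [u]: words of the ball weigh at least
    [th ^+ K], and the total weight factors over the coordinates. *)
Lemma hamming_ball (I : finType) (u : {ffun I -> S}) K (th : R) : 0 < th <= 1 ->
  #|[set v | (hdist u v <= K)%N]%SET|%:R * th ^+ K <= (1 + #|S|%:R * th) ^+ #|I|.
Proof.
move=> /andP[t0 t1].
pose F (i : I) s := if u i == s then 1 else th.
have F0 i s : 0 <= F i s by rewrite /F; case: ifP => // _; exact: ltW.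
have E : \sum_(v : {ffun I -> S}) \prod_i F i (v i) <= (1 + #|S|%:R * th) ^+ #|I|.
  rewrite -(bigA_distr_bigA F)/= -prodr_const; apply: ler_prod => i _.
  rewrite sumr_ge0//= (bigD1 (u i))//= {1}/F eqxx lerD2l.
  rewrite mulr_natl -sumr_const [leRHS](bigID (fun s => s != u i))/= ler_wpDr//.
    by apply: sumr_ge0 => *; exact: ltW.
  by apply: ler_sum => s; rewrite eq_sym /F => /negbTE ->.
apply: le_trans E; rewrite mulr_natl -sumr_const.
rewrite [leRHS](bigID (fun v => v \in [set v | (hdist u v <= K)%N]%SET))/=.
rewrite ler_wpDr//; first by apply: sumr_ge0 => v _; exact: prodr_ge0.
apply: ler_sum => v; rewrite inE => hv.
have -> : \prod_i F i (v i) = th ^+ hdist u v.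
  rewrite /hdist -prodr_const [RHS]big_mkcond/=.
  by apply: eq_bigr => i _; rewrite inE /F; case: eqP.
by apply: ler_wiXn2l => //; exact: ltW.
Qed.

(** The radius fraction [ka] depends on [rho] and the alphabet only. The choice of [th] bounds the
    total weight by half of the exponent, that of [ka] bounds [th ^- K] by the other half. *)
Lemma hamming_ball_expR (rho : R) : 0 < rho -> exists2 ka : R, 0 < ka &
  forall (I : finType) (u : {ffun I -> S}) K, K%:R <= ka * #|I|%:R ->
  #|[set v | (hdist u v <= K)%N]%SET|%:R <= expR (rho * #|I|%:R).
Proof.
move=> r0; pose th := Num.min 1 (rho / (2 * (#|S|%:R + 1))).
have S0 : 0 < 2 * (#|S|%:R + 1) :> R by rewrite mulr_gt0// ltr_wpDl.
have t0 : 0 < th by rewrite lt_min ltr01/= divr_gt0.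
have t1 : th <= 1 by rewrite ge_min lexx.
have t2 : #|S|%:R * th <= rho / 2.
  have : th <= rho / (2 * (#|S|%:R + 1)) by rewrite ge_min lexx orbT.
  rewrite ler_pdivlMr// => h.
  have : 0 <= th by exact: ltW.
  by move: h; set m := #|S|%:R; lra.
have lt0 : 0 <= - ln th by rewrite oppr_ge0 ln_le0.
have q0 : 0 < 2 * (1 - ln th) by lra.
exists (rho / (2 * (1 - ln th))); first by rewrite divr_gt0.
move=> I u K hK.
have := hamming_ball u K (_ : 0 < th <= 1); rewrite t0 t1 => /(_ erefl) h.
have K1 : K%:R * (- ln th) <= rho / 2 * #|I|%:R.
  rewrite mulrAC ler_pdivlMr// in hK.
  have K0 : (0 : R) <= K%:R by [].
  move: hK; set k := K%:R in K0 *; set n := #|I|%:R; set l := ln th in lt0 *.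
  nra.
have th_exp : th ^+ K = expR (- (K%:R * (- ln th))).
  by rewrite mulrN opprK mulrC expRM_natr lnK// posrE.
rewrite th_exp expRN ler_pdivrMr ?expR_gt0// in h.
apply: (le_trans h).
have -> : rho * #|I|%:R = (rho / 2) * #|I|%:R + rho / 2 * #|I|%:R by lra.
rewrite expRD; apply: ler_pM => //.
- by rewrite exprn_ge0// addr_ge0// mulr_ge0// ltW.
- rewrite expRM_natr; apply: lerXn2r.
  + by rewrite nnegrE addr_ge0// mulr_ge0// ltW.
  + by rewrite nnegrE expR_ge0.
  + by apply: (le_trans (expR_ge1Dx _)); rewrite ler_expR.
- by rewrite ler_expR.
Qed.

End Hamming.

Lemma maximal_separated (T : finType) (A : {set T}) (r : rel T) : symmetric r ->
  exists D : {set T}, [/\ D \subset A,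
    (forall x y, x \in D -> y \in D -> x != y -> ~~ r x y) &
    forall x, x \in A -> exists2 y, y \in D & (x == y) || r y x].
Proof.
move=> sr; pose P (D : {set T}) := (D \subset A) &&
  [forall x in D, forall y in D, (x != y) ==> ~~ r x y].
have P0 : P finset.set0.
  by rewrite /P finset.sub0set; apply/forall_inP => x; rewrite inE.
case: (@arg_maxnP _ finset.set0 P (fun D : {set T} => #|D|) P0) => D /andP[DA /forall_inP hD] Dmax.
exists D; split => //.
  by move=> x y xD yD xy; have /forall_inP/(_ y yD)/implyP := hD x xD; apply.
move=> x xA; have [xD|xD] := boolP (x \in D); first by exists x; rewrite ?eqxx.
apply: contrapT => hn.
have hr y : y \in D -> ~~ r y x.
  by move=> yD; apply/negP => yx; apply: hn; exists y => //; rewrite yx orbT.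
have : P (x |: D)%SET.
  rewrite /P finset.subUset finset.sub1set xA DA; apply/forall_inP => y; rewrite !inE => yD.
  apply/forall_inP => z; rewrite !inE => zD; apply/implyP => yz.
  case/predU1P: yD => [yx|yD]; case/predU1P: zD => [zx|zD].
  - by rewrite yx zx eqxx in yz.
  - by rewrite yx sr hr.
  - by rewrite zx hr.
  - by have /forall_inP/(_ z zD)/implyP := hD y yD; apply.
by move=> /Dmax; rewrite /= cardsU1 xD add1n ltnn.
Qed.

Lemma pigeonhole_class (T C : finType) (cls : T -> C) (D : {set T}) : D != finset.set0 ->
  exists c, (#|D| <= #|C| * #|[set x in D | cls x == c]%SET|)%N.
Proof.
move=> /set0Pn[x0 x0D].
case: (@arg_maxnP _ (cls x0) xpredT (fun c => #|[set x in D | cls x == c]%SET|) erefl) => c _ cmax.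
exists c; rewrite -sum1_card (partition_big cls xpredT)//=.
rewrite -sum_nat_const; apply: leq_sum => c' _.
apply: leq_trans (cmax c' erefl); rewrite -sum1_card; apply: eq_leq.
by apply: eq_bigl => x; rewrite inE.
Qed.

Section Kraft.
Context {R : realType} (N : nat -> nat) (N0 : forall i, (0 < N i)%N).

(** If the total weight were below 1, digits could be chosen one by one so that the words compatible
    with them always weigh less than the current cylinder. A word covering the resulting sequence
    contradicts this at its own length. No compactness is involved, so infinitely many words are
    allowed. *)
Lemma kraft_cover (J : set nat) (len : nat -> nat) (a : nat -> nat -> nat) :
  (forall om : nat -> nat, (forall i, (om i < N i)%N) ->
    exists2 j, J j & forall i, (i < len j)%N -> om i = a j i) ->
  (1 <= \esum_(j in J) (\prod_(i < len j) (N i)%:R^-1 : R)%:E)%E.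
Proof.
move=> cov; rewrite leNgt; apply/negP => lt1.
pose c m : R := \prod_(i < m) (N i)%:R^-1.
have c0 m : 0 < c m by apply: prodr_gt0 => i _; rewrite invr_gt0 ltr0n.
have cN m : c m.+1 *+ N m = c m.
  by rewrite /c big_ord_recr/= -[LHS]mulr_natr divfK// pnatr_eq0 -lt0n.
pose g m (u : nat -> nat) j : R :=
  if `[< forall i, (i < m)%N -> (i < len j)%N -> u i = a j i >]
  then c (maxn m (len j)) else 0.
have g0 m u j : 0 <= g m u j by rewrite /g; case: ifP => // _; exact: ltW.
pose W m u : \bar R := (\esum_(j in J) (g m u j)%:E)%E.
pose upd (u : nat -> nat) m b i := if i == m then b else u i.
have gstep m u j : \sum_(b < N m) g m.+1 (upd u m b) j <= g m u j.
  rewrite [leRHS]/g; case: asboolP => [h|h]; last first.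
    rewrite big1// => b _; rewrite /g; case: asboolP => // h'; exfalso; apply: h.
    move=> i im il; have := h' i (ltnW im) il.
    by rewrite /upd ltn_eqF.
  have [lm|ml] := leqP (len j) m.
    apply: (@le_trans _ _ (\sum_(b < N m) c m.+1)).
      apply: ler_sum => b _; rewrite /g; case: ifP => _; last exact: ltW.
      by rewrite (maxn_idPl (leqW lm)).
    by rewrite sumr_const card_ord cN.
  have [aN|aN] := ltnP (a j m) (N m); last first.
    rewrite big1; first exact: ltW.
    move=> b _; rewrite /g; case: asboolP => // h'; exfalso.
    have := h' m (ltnSn m) ml; rewrite /upd eqxx => bE.
    by have := ltn_ord b; rewrite bE ltnNge aN.
  rewrite (bigD1 (Ordinal aN))//= [X in _ + X]big1 ?addr0.
    by rewrite /g; case: ifP => _; [rewrite (maxn_idPr ml)|exact: ltW].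
  move=> b bm; rewrite /g; case: asboolP => // h'; exfalso.
  have := h' m (ltnSn m) ml; rewrite /upd eqxx => bE.
  by move/eqP: bm; apply; exact/val_inj.
have step m u : (W m u < (c m)%:E)%E ->
    exists b, (b < N m)%N /\ (W m.+1 (upd u m b) < (c m.+1)%:E)%E.
  move=> h; apply: contrapT => hn; move: h; apply/negP; rewrite -leNgt.
  apply: (@le_trans _ _ (\sum_(b < N m) W m.+1 (upd u m b))%E).
    apply: (@le_trans _ _ (\sum_(b < N m) (c m.+1)%:E)%E).
      by rewrite sumEFin lee_fin sumr_const card_ord cN.
    apply: lee_sum => b _; rewrite leNgt; apply/negP => hb; apply: hn.
    by exists b.
  rewrite /W -esum_sum; last by move=> *; rewrite lee_fin.
  by apply: le_esum => j _; rewrite sumEFin lee_fin; exact: gstep.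
have /choice[b hb] : forall mu : nat * (nat -> nat), exists b, (b < N mu.1)%N /\
    ((W mu.1 mu.2 < (c mu.1)%:E)%E -> (W mu.1.+1 (upd mu.2 mu.1 b) < (c mu.1.+1)%:E)%E).
  move=> [m u]; have [h|h] := pselect (W m u < (c m)%:E)%E.
    by have [b [bN hb]] := step m u h; exists b.
  by exists 0%N; split => // /h.
pose st := fix st m := if m is m'.+1 then upd (st m') m' (b (m', st m')) else (fun=> 0%N).
have Wst m : (W m (st m) < (c m)%:E)%E.
  elim: m => [|m IH] /=; last by have [_] := hb (m, st m); apply.
  rewrite /c big_ord0; apply: le_lt_trans lt1.
  apply: le_esum => j _; rewrite lee_fin /g; case: ifP => _; first by rewrite max0n.
  by apply: prodr_ge0.
pose om i := b (i, st i).
have stE m i : (i < m)%N -> st m i = om i.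
  elim: m => // m IH; rewrite ltnS leq_eqVlt => /predU1P[->|im] /=.
    by rewrite /upd eqxx.
  by rewrite /upd ltn_eqF// IH.
have [j Jj hj] := cov om (fun i => (hb (i, st i)).1).
have := Wst (len j); apply/negP; rewrite -leNgt /W (esumID [set j]); last first.
  by move=> *; rewrite lee_fin.
have -> : J `&` [set j] = [set j] by apply/setIidPr => _ ->.
rewrite esum_set1 ?lee_fin//.
have -> : g (len j) (st (len j)) j = c (len j).
  rewrite /g; case: asboolP => [_|]; first by rewrite maxnn.
  by case=> i il _; rewrite stE// hj.
by apply: leeDl; apply: esum_ge0 => *; rewrite lee_fin.
Qed.

End Kraft.

(** * Separated loops with prescribed statistics *)

Section Loop.
Context (X : Type) (e : rel X) (z : X).

(** The final return to [z] is not stored, so that concatenating loops gives loops. *)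
Definition loop (s : seq X) := exists s', s = z :: s' /\ path e z (rcons s' z).

Lemma loop_cat s1 s2 : loop s1 -> loop s2 -> loop (s1 ++ s2).
Proof.
move=> [s1' [-> p1]] [s2' [-> p2]]; exists (s1' ++ z :: s2'); split => //.
by rewrite rcons_cat /= -cat_rcons cat_path p1 last_rcons.
Qed.

Lemma loop_flatten (I : Type) (F : I -> seq X) (r : seq I) : (0 < size r)%N ->
  (forall i, loop (F i)) -> loop (flatten [seq F i | i <- r]).
Proof.
move=> r0 lF; case: r r0 => // i r _ /=; elim: r i => [|j r IH] i /=.
  by rewrite cats0.
by apply: loop_cat => //; exact: IH.
Qed.

Context (sp : rel X).

Definition sepseq (s1 s2 : seq X) := exists t,
  [/\ (t < size s1)%N, (t < size s2)%N & sp (nth z s1 t) (nth z s2 t)].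

Lemma sepseq_catl s1 s2 u1 u2 : sepseq s1 s2 -> sepseq (s1 ++ u1) (s2 ++ u2).
Proof.
move=> [t [t1 t2 st]]; exists t.
by rewrite !size_cat !nth_cat t1 t2 !ltn_addr.
Qed.

Lemma sepseq_catr s1 s2 u1 u2 : size s1 = size s2 -> sepseq u1 u2 ->
  sepseq (s1 ++ u1) (s2 ++ u2).
Proof.
move=> s12 [t [t1 t2 st]]; exists (size s1 + t)%N.
rewrite !size_cat !nth_cat s12 !ltn_add2l t1 t2 !ltnNge !leq_addr /=.
by rewrite addKn.
Qed.

Lemma sepseq_flatten (I : eqType) (F G : I -> seq X) (r : seq I) i : i \in r ->
  (forall i, size (F i) = size (G i)) -> sepseq (F i) (G i) ->
  sepseq (flatten [seq F i | i <- r]) (flatten [seq G i | i <- r]).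
Proof.
move=> ir FG st; elim: r ir => // j r IH; rewrite inE => /predU1P[<-|ir] /=.
  exact: sepseq_catl.
by apply: sepseq_catr => //; exact: IH.
Qed.

End Loop.

Lemma count_traject (X : Type) (f : X -> X) (x : X) n (a : pred X) :
  count a (traject f x n) = (\sum_(i < n) a (iter i f x))%N.
Proof.
elim: n => [|n IH]; first by rewrite big_ord0.
by rewrite trajectSr -cats1 count_cat IH big_ord_recr/= addn0.
Qed.

Lemma nth_traject_default (X : Type) (f : X -> X) (x z : X) n i : (i < n)%N ->
  nth z (traject f x n) i = iter i f x.
Proof. by move=> h; rewrite (set_nth_default x) ?size_traject// nth_traject. Qed.

Lemma leq_card_bigcup (T I : finType) (D : {set I}) (F : I -> {set T}) :
  (#|(\bigcup_(i in D) F i)%SET| <= \sum_(i in D) #|F i|)%N.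
Proof.
elim/big_rec2 : _ => [|i n A _ h]; first by rewrite cards0.
by apply: (leq_trans (leq_card_setU _ _)); rewrite leq_add2l.
Qed.

Lemma hdistxx (S I : finType) (u : {ffun I -> S}) : hdist u u = 0%N.
Proof. by apply/eqP; rewrite cards_eq0; apply/eqP/setP => i; rewrite !inE eqxx. Qed.

Section Superblock.
Context {R : realType} {d : measure_display} {X : measurableType d}.
Context (dist : X -> X -> R) (f : X -> X) (mf : measurable_fun setT f).

Definition pstep (del : R) : rel X := fun u v => dist (f u) v <= del.

Lemma traject_path del (x : X) n : (forall y, dist y y <= del) ->
  path (pstep del) x (traject f (f x) n).
Proof. by move=> h; elim: n x => //= n IH x; rewrite /pstep h/=. Qed.

Context (P : probability X R) (Pf : Defs.invariant f P).
Context (Y : set X) (mY : measurable Y) (PY : P Y = 1%E).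
Context (fY : forall x, Y x -> Y (f x)) (z : X) (Yz : Y z).
Context (del : R) (hdel : forall y, dist y y <= del) (M : nat).
Context (hlink : forall u v, Y u -> Y v ->
  exists l : seq X, (size l <= M)%N /\ path (pstep del) u (rcons l v)).

Lemma iterY n x : Y x -> Y (iter n f x).
Proof. by elim: n => //= n IH /IH /fY. Qed.

Lemma fiber_in_support (W : finType) (c : X -> W) w : mfib c -> 0 < law P c w ->
  exists x, Y x /\ c x = w.
Proof.
move=> mc pw; apply: contrapT => hn.
have : pr P (c @^-1` [set w]) <= pr P (~` Y).
  apply: le_pr => //; first exact: measurableC.
  by move=> x /= cx Yx; apply: hn; exists x.
rewrite prC// {2}/pr PY /= subrr => h.
by move: pw; rewrite ltNge h.
Qed.

Context (S T : finType) (cS : X -> S) (cT : X -> T) (cG : X -> bool).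
Context (mS : mfib cS) (mT : mfib cT) (mG : mfib cG).

Let W n := {ffun 'I_n -> S * T * bool}.
Let cc x := (cS x, cT x, cG x).
Let mcc : mfib cc.
Proof. by apply: mfib_pair => //; exact: mfib_pair. Qed.
Let p n (w : W n) := law P (cyl f cc n) w.

Let rep n : exists (x : W n -> X) (l1 l2 : W n -> seq X), forall w, (0 < n)%N ->
  0 < p w -> [/\ Y (x w), cyl f cc n (x w) = w,
   (size (l1 w) <= M)%N /\ (size (l2 w) <= M)%N,
   path (pstep del) z (rcons (l1 w) (x w)) &
   path (pstep del) (iter n.-1 f (x w)) (rcons (l2 w) z)].
Proof.
have H (w : W n) : exists xll : X * seq X * seq X, (0 < n)%N -> 0 < p w ->
  [/\ Y xll.1.1, cyl f cc n xll.1.1 = w,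
   (size xll.1.2 <= M)%N /\ (size xll.2 <= M)%N,
   path (pstep del) z (rcons xll.1.2 xll.1.1) &
   path (pstep del) (iter n.-1 f xll.1.1) (rcons xll.2 z)].
  have [pw|pw] := ltP 0 (p w); last by exists (z, [::], [::]) => _.
  have mcyl : mfib (cyl f cc n) by exact: mfib_cyl.
  have [x [Yx cx]] := fiber_in_support mcyl pw.
  have [l1 [s1 h1]] := hlink Yz Yx.
  have [l2 [s2 h2]] := hlink (iterY n.-1 Yx) Yz.
  by exists (x, l1, l2).
have [g hg] := choice H.
by exists (fun w => (g w).1.1), (fun w => (g w).1.2), (fun w => (g w).2).
Qed.

(* The [S]-name of a concatenation of [L] words of length [n]. *)
Let Pw n L (w : {ffun 'I_L -> W n}) : {ffun 'I_L * 'I_n -> S} :=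
  [ffun ji => (w ji.1 ji.2).1.1].

Context (rho ka : R) (r0 : 0 < rho) (ka0 : 0 < ka).
Context (hka : forall (I : finType) (u : {ffun I -> S}) K, K%:R <= ka * #|I|%:R ->
  #|[set v | (hdist u v <= K)%N]%SET|%:R <= expR (rho * #|I|%:R)).

(* Words chosen among [L] independent copies of the law of [n]-cylinders: the
   weak law of large numbers makes a set of probability 1/2 typical, and a
   maximal Hamming-separated family inside it is large. *)
Let typical_words n : (0 < n)%N -> exists L (D : {set {ffun 'I_L -> W n}}),
  [/\ (0 < L)%N, forall w j, w \in D -> 0 < p (w j),
   forall w, w \in D ->
     (\sum_j \sum_i (~~ (w j i).2 : nat))%:R <= L%:R * (n%:R * law P cG false + 1) :> R,
   forall w t, w \in D ->
     `|(\sum_j \sum_i ((w j i).1.2 == t : nat))%:R - L%:R * (n%:R * law P cT t)| <= L%:R :> R &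
   (forall w w', w \in D -> w' \in D -> w != w' ->
     ka * (L%:R * n%:R) < (hdist (Pw w) (Pw w'))%:R) /\
   expR (L%:R * (Hcode P (cyl f cS n) - 1)) <=
     2 * #|D|%:R * expR (rho * (L%:R * n%:R))].
Proof.
move=> n0.
have mcyl : mfib (cyl f cc n) by exact: mfib_cyl.
have mcylS : mfib (cyl f cS n) by exact: mfib_cyl.
pose piS (w : W n) : {ffun 'I_n -> S} := [ffun i => (w i).1.1].
have cylS : cyl f cS n = piS \o cyl f cc n.
  by apply/funext => x; apply/ffunP => i; rewrite !ffunE.
pose q v := law P (cyl f cS n) v.
have qE v : q v = \sum_(w | piS w == v) p w by rewrite /q cylS law_comp.
have p0 (w : W n) : 0 <= p w by exact: law_ge0.
have p1 : \sum_(w : W n) p w = 1 by exact: law_sum.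
(* The observables: the information of the [S]-name, whose mean is the entropy, the number of bad
   symbols, and the occurrences of each [T]-symbol. *)
pose Yf (j : option (option T)) (w : W n) : R := match j with
  | None => - ln (q (piS w))
  | Some None => \sum_(i < n) (~~ (w i).2)%:R
  | Some (Some t) => \sum_(i < n) ((w i).1.2 == t)%:R end.
have E1 : \sum_w p w * Yf None w = Hcode P (cyl f cS n).
  rewrite /Yf -(sum_law_comp P piS (fun v => - ln (q v)) mcyl) -cylS.
  by apply: eq_bigr => v _; rewrite mulrN.
have E2 : \sum_w p w * Yf (Some None) w = n%:R * law P cG false.
  rewrite /Yf (sum_law_cyl mf Pf mcc n (fun a => (~~ a.2)%:R)).
  rewrite -(sum_law_comp P snd (fun b : bool => (~~ b)%:R) mcc).
  by rewrite big_bool/= mulr0 add0r mulr1.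
have E3 t : \sum_w p w * Yf (Some (Some t)) w = n%:R * law P cT t.
  rewrite /Yf (sum_law_cyl mf Pf mcc n (fun a => (a.1.2 == t)%:R)).
  rewrite -(sum_law_comp P (fun a : S * T * bool => a.1.2) (fun t' => (t' == t)%:R) mcc).
  rewrite (bigD1 t)//= eqxx mulr1 big1 ?addr0// => t' /negbTE ->.
  by rewrite mulr0.
have [L0 hL0] := weak_law p0 p1 Yf ltr01.
pose L := maxn L0 1.
have L1 : (0 < L)%N by rewrite leq_max orbT.
pose ty (w : {ffun 'I_L -> W n}) := [forall j,
  `|\sum_i Yf j (w i) - L%:R * \sum_a p a * Yf j a| <= 1 * L%:R].
have hty : 2^-1 <= \sum_(w | ty w) pword (@p n) w := hL0 L (leq_maxl _ _).
pose G : {set {ffun 'I_L -> W n}} := [set w | ty w && (0 < pword (@p n) w)]%SET.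
have massG : 2^-1 <= \sum_(w in G) pword (@p n) w.
  apply: (le_trans hty).
  rewrite (bigID (fun w => 0 < pword (@p n) w))/= [X in _ + X]big1 ?addr0.
    by rewrite le_eqVlt; apply/orP; left; apply/eqP; apply: eq_bigl => w; rewrite inE.
  move=> w /andP[_]; rewrite -leNgt => h.
  by apply/eqP; rewrite eq_le h pword_ge0.
have Gty w j : w \in G -> `|\sum_i Yf j (w i) - L%:R * \sum_a p a * Yf j a| <= L%:R.
  by rewrite inE => /andP[/forallP/(_ j)]; rewrite mul1r.
have Gpos w j : w \in G -> 0 < p (w j).
  rewrite inE => /andP[_ h]; rewrite lt_neqAle p0 andbT eq_sym.
  apply/negP => /eqP h0; move: h; rewrite /pword (bigD1 j)//= h0 mul0r ltxx.
  by [].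
pose Q (w : {ffun 'I_L -> W n}) : {ffun 'I_L -> {ffun 'I_n -> S}} := [ffun j => piS (w j)].
have qpos w j : w \in G -> 0 < q (piS (w j)).
  move=> wG; have h := Gpos w j wG; rewrite qE (bigD1 (w j))//=.
  by rewrite ltr_wpDr// sumr_ge0.
(* The names of typical words carry mass at least 1/2, while each has probability at most the
   inverse of the left-hand side. *)
have countG : expR (L%:R * (Hcode P (cyl f cS n) - 1)) <= 2 * #|Q @: G|%:R.
  have h1 : \sum_(w in G) pword (@p n) w <= \sum_(v in Q @: G) \prod_j q (v j).
    rewrite (partition_big Q (fun v => v \in Q @: G))/=; last first.
      by move=> w wG; exact: imset_f.
    apply: ler_sum => v _.
    under [leRHS]eq_bigr do rewrite qE.
    rewrite (bigA_distr_big_dep (fun j w => piS w == v j)) /=.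
    rewrite [leRHS](bigID (fun w => w \in G))/= ler_wpDr//.
      by apply: sumr_ge0 => w _; exact: prodr_ge0.
    rewrite le_eqVlt; apply/orP; left; apply/eqP; apply: eq_bigl => w; rewrite andbC; congr andb.
    apply/eqP/familyP => [<- j|h].
      by rewrite unfold_in ffunE.
    by apply/ffunP => j; rewrite ffunE; apply/eqP; have := h j; rewrite unfold_in.
  have h2 v : v \in Q @: G -> \prod_j q (v j) <= expR (- (L%:R * (Hcode P (cyl f cS n) - 1))).
    move=> /imsetP[w wG ->].
    have -> : \prod_j q ((Q w) j) = expR (- \sum_j Yf None (w j)).
      rewrite -sumrN expR_sum; apply: eq_bigr => j _.
      by rewrite ffunE /Yf opprK lnK// posrE qpos.
    rewrite ler_expR lerN2; have := Gty w None wG; rewrite E1 ler_norml => /andP[h _].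
    by rewrite mulrBr mulr1; lra.
  have := le_trans massG (le_trans h1 (ler_sum _ h2)).
  rewrite sumr_const -[X in _ <= X]mulr_natl expRN ler_pdivlMr ?expR_gt0//.
  lra.
pose K := Num.truncn (ka * (L%:R * n%:R)).
have ka1 : 0 <= ka * (L%:R * n%:R) by rewrite mulr_ge0// ?ltW// mulr_ge0.
have /andP[K1 K2] := truncn_itv ka1; rewrite -/K in K1 K2.
pose r w w' := (hdist (@Pw n L w) (Pw w') <= K)%N.
have sr : symmetric r.
  move=> w w'; rewrite /r /hdist; congr (_ <= _)%N; apply: eq_card => i.
  by rewrite !inE eq_sym.
have [D [DG Dsep Dmax]] := maximal_separated G sr.
exists L, D; split => //.
- by move=> w j /(fintype.subsetP DG); exact: Gpos.
- move=> w /(fintype.subsetP DG) wG; have := Gty w (Some None) wG; rewrite E2 /Yf.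
  have -> : (\sum_j \sum_i (~~ (w j i).2 : nat))%:R = \sum_j \sum_i (~~ (w j i).2)%:R :> R.
    by rewrite natr_sum; apply: eq_bigr => j _; rewrite natr_sum.
  by rewrite ler_norml mulrDr mulr1 => /andP[_]; lra.
- move=> w t /(fintype.subsetP DG) wG; have := Gty w (Some (Some t)) wG; rewrite E3 /Yf.
  have -> // : (\sum_j \sum_i ((w j i).1.2 == t : nat))%:R =
      \sum_j \sum_i ((w j i).1.2 == t)%:R :> R.
  by rewrite natr_sum; apply: eq_bigr => j _; rewrite natr_sum.
split.
  move=> w w' wD w'D ww'; have := Dsep w w' wD w'D ww'; rewrite /r -ltnNge => h.
  by apply: (lt_le_trans K2); rewrite ler_nat.
apply: (le_trans countG); rewrite -mulrA ler_pM2l//.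
have IJ : #|{: 'I_L * 'I_n}|%:R = L%:R * n%:R :> R by rewrite card_prod !card_ord natrM.
(* [Q] and [Pw] hold the same symbols, nested or indexed by pairs. By maximality of [D] the Hamming
   balls around its names cover all typical names. *)
have QP w w' : Pw w = Pw w' -> Q w = Q w'.
  move=> h; apply/ffunP => j; apply/ffunP => i; rewrite !ffunE.
  by have := congr1 (fun u : {ffun 'I_L * 'I_n -> S} => u (j, i)) h; rewrite !ffunE.
have cardQ : (#|Q @: G| <= #|[set Pw w | w in G]%SET|)%N.
  have /choice[g hg] : forall u : {ffun 'I_L * 'I_n -> S}, exists v, forall w,
      Pw w = u -> Q w = v.
    move=> u; have [[w0 <-]|hn] := pselect (exists w, Pw w = u).
      by exists (Q w0) => w /QP.
    by exists (Q [ffun=> [ffun=> (cS z, cT z, cG z)]]) => w h; exfalso; apply: hn; exists w.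
  have -> : Q @: G = g @: [set Pw w | w in G]%SET.
    rewrite -imset_comp; apply: eq_imset => w /=; exact: hg.
  exact: leq_imset_card.
have cardP : (#|[set Pw w | w in G]%SET| <=
    \sum_(w in D) #|[set v | (hdist (Pw w) v <= K)%N]%SET|)%N.
  apply: leq_trans (leq_card_bigcup _ _); apply/subset_leq_card/fintype.subsetP.
  move=> _ /imsetP[w wG ->]; have [w' w'D h] := Dmax w wG.
  apply/finset.bigcupP; exists w' => //; rewrite inE.
  by case/predU1P: h => [->|//]; rewrite hdistxx.
apply: (@le_trans _ _ (\sum_(w in D) #|[set v | (hdist (Pw w) v <= K)%N]%SET|)%:R).
  by rewrite ler_nat (leq_trans cardQ).
rewrite natr_sum mulr_natl -sumr_const; apply: ler_sum => w _.
by rewrite -IJ; apply: hka; rewrite IJ.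
Qed.

Definition sep_symbol : rel X := fun x y => [&& cG x, cG y & cS x != cS y].

(** A superblock consists of [L] orbit segments of length [n], joined through [z] by links. The code
    [cS] carries the entropy, [cT] the averages, and [cG] marks the points whose [S]-symbol can be
    detected by distance. Of the two [rho], one pays for the Hamming balls and one for the links and
    the counting losses. *)
Lemma superblocks (h s th : R) : s + 2 * rho <= h ->
  (forall n, (0 < n)%N -> h <= Hcode P (cyl f cS n) / n%:R) ->
  law P cG false <= ka / 4 -> 0 < th ->
  exists l N (sg : 'I_N -> seq X), [/\ (0 < l)%N, expR (l%:R * s) <= N%:R,
    forall a, size (sg a) = l /\ loop (pstep del) z (sg a),
    forall a b, a != b -> sepseq z sep_symbol (sg a) (sg b) &
    forall a t, `|(count (fun y => cT y == t) (sg a))%:R - l%:R * law P cT t|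
      <= th * l%:R].
Proof.
move=> hs hH hG th0.
pose B : R := (1 + 2 * M)%:R.
have B0 : 0 <= B by [].
have lnM0 : 0 <= ln (M.+1%:R : R) by rewrite ln_ge0// ler1n.
have ln20 : 0 <= ln (2 : R) by rewrite ln_ge0// ler1n.
pose A2 := 1 + 2 * ln (M.+1%:R) + B * `|s| + ln 2.
have A20 : 0 <= A2 by rewrite !addr_ge0// mulr_ge0.
(* [B] bounds the points that [z] and two links add to a segment, [A2] all entropy losses per
   segment. The three terms keep, in turn, bad symbols below the Hamming distance, entropy losses
   below [n * rho], and frequency errors below [th]. *)
pose n := (Num.truncn (4 / ka + A2 / rho + (1 + B) / th)).+1.
have Hn : 4 / ka + A2 / rho + (1 + B) / th <= n%:R by exact: ltW (truncnS_gt _).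
have q1 : 0 <= 4 / ka by rewrite divr_ge0// ltW.
have q2 : 0 <= A2 / rho by rewrite divr_ge0// ltW.
have q3 : 0 <= (1 + B) / th by rewrite divr_ge0 ?addr_ge0// ltW.
have n1 : 4 <= n%:R * ka by rewrite -ler_pdivrMr//; lra.
have n2 : A2 <= n%:R * rho by rewrite -ler_pdivrMr//; lra.
have n3 : 1 + B <= n%:R * th by rewrite -ler_pdivrMr//; lra.
have n0 : (0 < n)%N by [].
have nr0 : (0 : R) < n%:R by rewrite ltr0n.
have [L [D [L0 Dpos Dbad Dfreq [Dsep Dcard]]]] := typical_words n0.
have L0r : (0 : R) < L%:R by rewrite ltr0n.
have L1r : (1 : R) <= L%:R by rewrite ler1n.
have [x [l1 [l2 hrep]]] := rep n.
pose blk (w : W n) := (z :: l1 w) ++ (traject f (x w) n ++ l2 w).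
(* Keeping a single class of link lengths gives all superblocks the same length and aligns their
   orbit segments. *)
pose cls (w : {ffun 'I_L -> W n}) : {ffun 'I_L -> 'I_M.+1 * 'I_M.+1} :=
  [ffun j => (inord (size (l1 (w j))), inord (size (l2 (w j))))].
have D0 : D != finset.set0.
  apply/eqP => D0; move: Dcard; rewrite D0 cards0 mulr0 mul0r.
  by rewrite leNgt expR_gt0.
have [c hc] := pigeonhole_class cls D0.
set Dc := [set w in D | cls w == c]%SET in hc.
have DcD w : w \in Dc -> w \in D by rewrite inE => /andP[].
have sz1 w j : w \in Dc -> size (l1 (w j)) = (c j).1 /\ size (l2 (w j)) = (c j).2.
  move=> wDc; have := wDc; rewrite inE => /andP[wD /eqP <-]; rewrite ffunE /=.
  by have [_ _ [s1 s2] _ _] := hrep (w j) n0 (Dpos w j wD); rewrite !inordK.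
pose l := (\sum_(j < L) ((c j).1.+1 + (n + (c j).2)))%N.
have szblk w j : w \in Dc -> size (blk (w j)) = ((c j).1.+1 + (n + (c j).2))%N.
  by move=> /(sz1 w j)[s1 s2]; rewrite !size_cat size_traject s2 /= s1.
pose F (w : {ffun 'I_L -> W n}) := flatten [seq blk (w j) | j <- enum 'I_L].
have szF w : w \in Dc -> size (F w) = l.
  move=> wDc; rewrite size_flatten /shape -map_comp sumnE big_map big_enum.
  by apply: eq_bigr => j _; exact: szblk.
have lB : (L%:R * n%:R : R) <= l%:R <= L%:R * (n%:R + B).
  rewrite /B -natrD -!natrM !ler_nat -[X in (X * n)%N](card_ord L) -[X in (X * (n + _))%N](card_ord L).
  rewrite -!sum_nat_const; apply/andP; split; apply: leq_sum => j _.
    by rewrite addnCA leq_addr.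
  by rewrite addnCA leq_add2l addSn add1n ltnS mul2n -addnn leq_add// -ltnS.
have /andP[lB1 lB2] := lB.
have enD (a : 'I_#|Dc|) : enum_val a \in Dc by exact: enum_valP.
exists l, #|Dc|, (fun a => F (enum_val a)); split.
- by rewrite -(ltr0n R) (lt_le_trans _ lB1)// mulr_gt0.
- have hHn : n%:R * h <= Hcode P (cyl f cS n).
    by rewrite mulrC -ler_pdivlMr// hH.
  have cD : #|D|%:R <= expR (L%:R * (2 * ln (M.+1%:R))) * #|Dc|%:R :> R.
    have -> : expR (L%:R * (2 * ln (M.+1%:R))) = (M.+1 * M.+1)%:R ^+ L :> R.
      by rewrite mulrC expRM_natr mulrC mulr_natr mulr2n expRD lnK ?natrM// posrE ltr0n.
    rewrite -natrX -natrM ler_nat; apply: (leq_trans hc).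
    by rewrite card_ffun card_prod !card_ord.
  have e2 : 2 <= expR (L%:R * ln 2) :> R.
    rewrite -{1}(@lnK R 2) ?posrE// ler_expR ler_peMl//.
  have : expR (L%:R * (Hcode P (cyl f cS n) - 1)) <=
      expR (L%:R * ln 2) * (expR (L%:R * (2 * ln (M.+1%:R))) * #|Dc|%:R) *
      expR (rho * (L%:R * n%:R)).
    apply: (le_trans Dcard); rewrite ler_pM2r ?expR_gt0//.
    by apply: ler_pM.
  rewrite mulrA -expRD mulrAC -expRD -ler_pdivrMl ?expR_gt0// -expRN -expRD.
  apply: le_trans; rewrite ler_expR.
  have ls : l%:R * s <= L%:R * (n%:R * s + B * `|s|).
    rewrite mulrDr; have [s0|s0] := leP 0 s.
      rewrite ger0_norm//; apply: (le_trans (ler_wpM2r s0 lB2)).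
      by rewrite mulrDr mulrDl -!mulrA.
    have := ler_wnM2r (ltW s0) lB1; rewrite -mulrA => h1.
    by apply: (le_trans h1); rewrite lerDl !mulr_ge0// ltW.
  apply: (le_trans ls).
  have : L%:R * (n%:R * s + B * `|s| + ln 2 + 2 * ln M.+1%:R + rho * n%:R + 1) <=
      L%:R * Hcode P (cyl f cS n).
    rewrite ler_pM2l//; apply: le_trans hHn.
    have h1 : n%:R * (s + 2 * rho) <= n%:R * h by rewrite ler_pM2l.
    apply: le_trans h1; rewrite mulrDr; move: n2; rewrite /A2.
    by set N := n%:R; lra.
  by set Hc := Hcode _ _; set N := n%:R; set LL := L%:R; lra.
- move=> a; split; first exact: szF.
  apply: loop_flatten; first by rewrite size_enum_ord.
  move=> j; have [_ _ _ p1 p2] := hrep _ n0 (Dpos _ j (DcD _ (enD a))).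
  set w := (enum_val a) j in p1 p2 *.
  exists (l1 w ++ (traject f (x w) n ++ l2 w)); split => //.
  rewrite !rcons_cat /= -cat_rcons cat_path p1 last_rcons /= cat_path.
  by rewrite traject_path// last_traject.
- move=> a b ab; set w := enum_val a; set w' := enum_val b.
  have wDc : w \in Dc by exact: enD.
  have wDc' : w' \in Dc by exact: enD.
  have ww' : w != w' by apply: contra ab => /eqP/enum_val_inj ->.
  (* The names differ at more places than the two words have bad symbols together. *)
  have [j [i [d1 g1 g2]]] : exists (j : 'I_L) (i : 'I_n),
      [/\ (w j i).1.1 != (w' j i).1.1, (w j i).2 & (w' j i).2].
    apply: contrapT => hn; have := Dsep w w' (DcD _ wDc) (DcD _ wDc') ww'.
    apply/negP; rewrite -leNgt.
    apply: (@le_trans _ _ (\sum_j \sum_i (~~ (w j i).2 : nat) +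
       \sum_j \sum_i (~~ (w' j i).2 : nat))%N%:R).
      rewrite ler_nat /hdist -sum1_card big_mkcond/= !pair_big/= -big_split/=.
      apply: leq_sum => -[j i] _; rewrite inE !ffunE /=.
      case: eqP => //= /eqP hd; case g1 : (w j i).2 => //=.
      by case g2 : (w' j i).2 => //=; exfalso; apply: hn; exists j, i.
    rewrite natrD; apply: (le_trans (lerD (Dbad w (DcD _ wDc)) (Dbad w' (DcD _ wDc')))).
    rewrite -mulrDr [leRHS]mulrCA ler_pM2l//.
    have : n%:R * law P cG false <= n%:R * (ka / 4) by rewrite ler_pM2l.
    by move: n1; set N := n%:R; lra.
  apply: (@sepseq_flatten _ _ _ _ (fun j => blk (w j)) (fun j => blk (w' j)) _ j).
  + by rewrite mem_enum.
  + by move=> k; rewrite !szblk.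
  + apply: sepseq_catr; first by rewrite /= !(proj1 (sz1 _ _ _)).
    apply: sepseq_catl; exists i; rewrite !size_traject !nth_traject_default//.
    have [_ c1 _ _ _] := hrep _ n0 (Dpos _ j (DcD _ wDc)).
    have [_ c2 _ _ _] := hrep _ n0 (Dpos _ j (DcD _ wDc')).
    have := congr1 (fun u : W n => u i) c1; rewrite ffunE /cc => e1.
    have := congr1 (fun u : W n => u i) c2; rewrite ffunE /cc => e2.
    by move: d1 g1 g2; rewrite -e1 -e2 /= /sep_symbol => -> -> ->.
- move=> a t; set w := enum_val a.
  have wDc : w \in Dc by exact: enD.
  have := Dfreq w t (DcD _ wDc).
  set S1 := (\sum_j \sum_i _)%N => hS.
  have hcnt : (S1 <= count (fun y => cT y == t) (F w) <= S1 + L * (1 + 2 * M))%N.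
    have -> : count (fun y => cT y == t) (F w) = (\sum_j count (fun y => cT y == t) (blk (w j)))%N.
      by rewrite /F count_flatten sumnE big_map big_map big_enum.
    have cblk j : count (fun y => cT y == t) (blk (w j)) =
        (count (fun y => cT y == t) (z :: l1 (w j)) +
        (count (fun y => cT y == t) (traject f (x (w j)) n) +
         count (fun y => cT y == t) (l2 (w j))))%N by rewrite /blk !count_cat.
    rewrite -[X in (S1 + X * _)%N](card_ord L) -sum_nat_const -big_split.
    have E j : count (fun y => cT y == t) (traject f (x (w j)) n) =
        (\sum_(i < n) ((w j i).1.2 == t : nat))%N.
      rewrite count_traject; apply: eq_bigr => i _.
      have [_ c1 _ _ _] := hrep _ n0 (Dpos _ j (DcD _ wDc)).
      by have := congr1 (fun u : W n => u i) c1; rewrite ffunE /cc => <-.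
    apply/andP; split; apply: leq_sum => j _; rewrite cblk -E.
      by rewrite addnCA leq_addr.
    have [_ _ [s1 s2] _ _] := hrep _ n0 (Dpos _ j (DcD _ wDc)).
    rewrite addnCA leq_add2l.
    apply: leq_trans (leq_add (count_size _ _) (count_size _ _)) _.
    by rewrite /= addSn add1n ltnS mul2n -addnn leq_add.
  have : (S1%:R : R) <= (count (fun y => cT y == t) (F w))%:R <= S1%:R + L%:R * B.
    by rewrite /B -natrM -natrD !ler_nat.
  move=> /andP[]; set cnt := _%:R; set s1 := S1%:R in hS * => c1 c2.
  have law0 := law_ge0 P cT t; have law1 := law_le1 P t mT.
  move: hS; rewrite ler_norml => /andP[b1 b2].
  have lw1 : L%:R * (n%:R * law P cT t) <= l%:R * law P cT t.
    by rewrite mulrA ler_wpM2r.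
  have lw2 : l%:R * law P cT t <= L%:R * (n%:R * law P cT t) + L%:R * B.
    apply: (le_trans (ler_wpM2r law0 lB2)); rewrite mulrDr mulrDl -mulrA lerD2l.
    by rewrite ler_piMr// mulr_ge0.
  have : L%:R * (1 + B) <= th * l%:R.
    apply: (@le_trans _ _ (L%:R * (n%:R * th))); first by rewrite ler_pM2l.
    by rewrite mulrA mulrC ler_pM2l.
  rewrite ler_norml mulrDr mulr1 => h1.
  move: lw1 lw2 b1 b2 c1 c2 h1.
  set u := l%:R * _; set v := L%:R * (n%:R * _); set v' := L%:R * B; set v'' := th * _ => *.
  by apply/andP; split; lra.
Qed.

End Superblock.

(** * Chains in the support of an ergodic measure *)

Section Support.
Context {R : realType} {d : measure_display} {X : measurableType d}.
Context (dist : X -> X -> R) (Hm : is_metric dist) (Hb : borel_for_dist dist).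
Context (Hc : dcompact dist) (f : X -> X) (Hf : dcontinuous_map dist f).
Context (mu : probability X R).

Let mf := measurable_dcontinuous_map Hb Hf.

Let mball x (r : R) : measurable (dball dist x r).
Proof. exact/(measurable_dopen Hb)/dopen_ball. Qed.

Lemma dclosed_supp : dclosed dist (supp dist mu).
Proof.
apply/(dclosedP Hm) => x h r r0; have r2 : 0 < r / 2 by lra.
have [a /= /(_ _ r2) h1 ax] := h _ r2.
apply: (lt_le_trans h1); apply: le_measure; rewrite ?inE//.
move=> y; rewrite /dball/= => ay; apply: (le_lt_trans (dist_triangle Hm a _ _)).
by rewrite (distC Hm x a); lra.
Qed.

Lemma supp_stable : Defs.invariant f mu -> forall x, supp dist mu x -> supp dist mu (f x).
Proof.
move=> muf x Yx r r0; have [del d0 hd] := Hf x r0.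
rewrite -muf//; apply: (lt_le_trans (Yx del d0)); apply: le_measure; rewrite ?inE//.
exact: (measurable_preimage_iter mf 1).
Qed.

(* The limsup of the preimages of [B] is strictly invariant and at least as
   large as [B] in measure, hence of full measure. *)
Lemma ergodic_return A B : Defs.ergodic f mu -> measurable A -> measurable B ->
  (0 < mu A)%E -> (0 < mu B)%E ->
  exists k y, [/\ (0 < k)%N, A y & B (iter k f y)].
Proof.
move=> [muf erg] mA mB A0 B0.
pose F n := ~` \bigcup_(k in [set k | (n <= k)%N]) (iter k f @^-1` B).
have mF n : measurable (F n).
  by apply: measurableC; apply: bigcup_measurable => k _; exact: measurable_preimage_iter.
have ndF : nondecreasing_seq F.
  move=> m n mn; apply/subsetPset/subsetC => x [k /= nk Bk].
  by exists k => //=; exact: leq_trans nk.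
pose L := ~` \bigcup_n F n.
have LE x : L x <-> forall n, exists2 k, (n <= k)%N & B (iter k f x).
  split=> [h n|h]; last first.
    by move=> [n _]; apply; have [k nk Bk] := h n; exists k.
  apply: contrapT => hn; apply: h; exists n; first by [].
  by move=> [k /= nk Bk]; apply: hn; exists k.
have mL : measurable L by apply/measurableC/bigcupT_measurable.
have fL : f @^-1` L = L.
  apply/seteqP; split=> x /= /LE h; apply/LE => n.
    by have [k nk Bk] := h n; exists k.+1; [exact: leqW|rewrite iterSr].
  by have [[//|k] nk Bk] := h n.+1; exists k => //; rewrite -iterSr.
have [L0|L1] := erg L mL fL.
  suff : pr mu B <= 0.
    by move=> h; move: B0; rewrite prE// lte_fin ltNge h.
  have prL : pr mu (\bigcup_n F n) = 1.
    have := prC mu mL; rewrite setCK => ->.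
    by rewrite /pr L0 subr0.
  apply/ler_addgt0Pr => e e0; have [n] := pr_nondecreasing mu mF ndF e0.
  rewrite prL; have : pr mu (F n) <= pr mu (~` (iter n f @^-1` B)).
    apply: le_pr => //; first by apply/measurableC/measurable_preimage_iter.
    by apply: subsetC => x Bx; exists n => /=.
  rewrite prC; last exact: measurable_preimage_iter.
  rewrite pr_iter//; lra.
have [y [Ay Ly]] : exists y, A y /\ L y.
  apply: contrapT => hn; have : pr mu A <= pr mu (~` L).
    apply: le_pr => //; first exact: measurableC.
    by move=> y Ay Ly; apply: hn; exists y.
  rewrite prC// [pr mu L]/pr L1 subrr => h.
  by move: A0; rewrite prE// lte_fin ltNge h.
by have /LE/(_ 1%N)[k k1 Bk] := Ly; exists k, y.
Qed.

(** For any two charged balls of a finite net, some orbit goes from the first to the second. Entered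
    from [u] and left towards [v], it is the link; finitely many pairs of balls give a uniform
    length. *)
Lemma chain_link (del : R) : Defs.ergodic f mu -> 0 < del -> exists M, forall u v,
  supp dist mu u -> supp dist mu v ->
  exists l : seq X, (size l <= M)%N /\ path (pstep dist f del) u (rcons l v).
Proof.
move=> erg d0.
have d2 : 0 < del / 2 by lra.
have [eta eta0 heta] := uniform_continuity_map Hm Hc Hf d2.
pose r := Num.min (eta / 2) (del / 4).
have r0 : 0 < r by rewrite lt_min; apply/andP; split; lra.
have r1 : 2 * r <= eta.
  have : r <= eta / 2 by rewrite ge_min lexx.
  by lra.
have r2 : 4 * r <= del.
  have : r <= del / 4 by rewrite ge_min lexx orbT.
  by lra.
have [s hs] := finite_net Hm Hc r0.
have /choice[K hK] : forall ee : X * X, exists k,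
    (0 < mu (dball dist ee.1 r))%E -> (0 < mu (dball dist ee.2 r))%E ->
    exists y, dist ee.1 y < r /\ dist ee.2 (iter k.+1 f y) < r.
  move=> [e e'] /=; have [[h1 h2]|hn] := pselect ((0 < mu (dball dist e r))%E /\
    (0 < mu (dball dist e' r))%E); last by exists 0%N => h1 h2; exfalso; apply: hn.
  have [k [y [k0 y1 y2]]] := ergodic_return erg (mball _ _) (mball _ _) h1 h2.
  case: k k0 y2 => // k _ y2.
  by exists k => _ _; exists y.
exists (\sum_(e <- s) \sum_(e' <- s) K (e, e'))%N => u v Yu Yv.
have [e es eu] := hs u; have [e' es' ev] := hs v.
have pos w e1 : supp dist mu w -> dist e1 w < r -> (0 < mu (dball dist e1 r))%E.
  move=> Yw h; have h1 : 0 < r - dist e1 w by rewrite subr_gt0.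
  apply: (lt_le_trans (Yw _ h1)); apply: le_measure; rewrite ?inE//.
  move=> y; rewrite /dball/= => wy; apply: (le_lt_trans (dist_triangle Hm w _ _)).
  by rewrite addrC -ltrBrDr.
have [y [y1 y2]] := hK (e, e') (pos _ _ Yu eu) (pos _ _ Yv ev); rewrite /= in y1 y2.
exists (traject f (f y) (K (e, e'))); split.
  rewrite size_traject (big_rem e)//= (big_rem e')//= -addnA leq_addr//.
have fu : dist (f u) (f y) < del / 2.
  apply: heta; apply: (le_lt_trans (dist_triangle Hm e _ _)).
  by rewrite (distC Hm u e); lra.
have fv : dist (iter (K (e, e')).+1 f y) v < del / 2.
  apply: (le_lt_trans (dist_triangle Hm e' _ _)); rewrite (distC Hm _ e'); lra.
(* With an empty link, both errors [del / 2] fall on one jump; otherwise they fall on the first and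
   the last one. *)
case: (K (e, e')) fv => [|k] fv.
  rewrite /= andbT /pstep; apply: (le_trans (dist_triangle Hm (f y) _ _)).
  by move: fv => /=; lra.
rewrite rcons_path /= traject_path; last by move=> w; rewrite (distxx Hm) ltW.
rewrite andbT last_traject {1}/pstep; apply/andP; split; first by lra.
by rewrite /pstep -iterS -iterSr; lra.
Qed.

End Support.

(** * Averages of continuous functions from symbol frequencies *)

Section CodeAverage.
Context {R : realType} {d : measure_display} {X : measurableType d}.
Context (dist : X -> X -> R) (Hm : is_metric dist) (Hb : borel_for_dist dist).
Context (Hc : dcompact dist).

(** The code records which balls of a finite net contain the point: equal codes mean a common
    ball. *)
Lemma small_code (rho : R) : 0 < rho -> exists (T : finType) (c : X -> T),
  mfib c /\ forall x y, c x = c y -> dist x y < rho.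
Proof.
move=> r0; have r2 : 0 < rho / 2 by lra.
have [s hs] := finite_net Hm Hc r2.
exists {ffun 'I_(size s) -> bool}.
exists (fun x => [ffun i : 'I_(size s) => dist (nth point s i) x < rho / 2]); split.
  apply: mfib_ffun => i b.
  have mB : measurable (dball dist (nth point s i) (rho / 2)).
    exact/(measurable_dopen Hb)/dopen_ball.
  case: b; first exact: mB.
  have := measurableC mB; congr (measurable _); apply/seteqP; split=> x /=.
    by move/negP/negbTE.
  by rewrite /dball/= => ->.
move=> x y /ffunP h; have [e es ex] := hs x.
have [i ie] : exists i : 'I_(size s), e = nth point s i.
  by move: es => /(nthP point)[i ilt <-]; exists (Ordinal ilt).
have := h i; rewrite !ffunE -ie ex => /esym ey.
apply: (le_lt_trans (dist_triangle Hm e _ _)); rewrite (distC Hm x e); lra.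
Qed.

Context (P : probability X R) (T : finType) (c : X -> T) (mc : mfib c).

Lemma bmeas_code (v : T -> R) : bmeas (v \o c).
Proof.
have -> : v \o c = fun x => \sum_t v t * \1_(c @^-1` [set t]) x.
  apply/funext => x /=; rewrite (bigD1 (c x))//= indicE mem_set// mulr1.
  rewrite big1 ?addr0// => t tc; rewrite indicE memNset ?mulr0//= => h.
  by rewrite h eqxx in tc.
by apply: bmeas_sum => t; apply/bmeasZ/bmeas_indic.
Qed.

Lemma Pint_code (v : T -> R) : Pint P (v \o c) = \sum_t law P c t * v t.
Proof.
have -> : v \o c = fun x => \sum_t v t * \1_(c @^-1` [set t]) x.
  apply/funext => x /=; rewrite (bigD1 (c x))//= indicE mem_set// mulr1.
  rewrite big1 ?addr0// => t tc; rewrite indicE memNset ?mulr0//= => h.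
  by rewrite h eqxx in tc.
rewrite Pint_sum => [|t]; last exact/bmeasZ/bmeas_indic.
by apply: eq_bigr => t _; rewrite PintZ ?Pint_indic 1?mulrC//; exact: bmeas_indic.
Qed.

(** Replacing [g] by a function of the code costs [eta] in the sum and [eta] in the integral; the
    frequencies control the rest. *)
Lemma code_average (g : X -> R) (B eta th : R) (s : seq X) :
  dcontinuous_fun dist g -> (forall x, `|g x| <= B) ->
  (forall x y, c x = c y -> `|g x - g y| <= eta) ->
  (forall t, `|(count (fun y => c y == t) s)%:R - (size s)%:R * law P c t|
     <= th * (size s)%:R) ->
  `|\sum_(y <- s) (g y - Pint P g)| <= (size s)%:R * (2 * eta + B * th * #|T|%:R).
Proof.
move=> gc gB geta hs; have bg := bmeas_dcontinuous Hm Hb Hc gc.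
have [x0 _] : exists x : X, True by exists point.
have B0 : 0 <= B by exact: le_trans (gB x0).
have /choice[v hv] : forall t, exists v : R, `|v| <= B /\
    forall x, c x = t -> `|g x - v| <= eta.
  move=> t; have [[y cy]|hn] := pselect (exists y, c y = t).
    by exists (g y); split => // x cx; apply: geta; rewrite cx.
  exists 0; rewrite normr0; split => // x cx; exfalso; apply: hn; by exists x.
have h1 x : `|g x - v (c x)| <= eta by have [_] := hv (c x); apply.
have h2 : `|Pint P g - \sum_t law P c t * v t| <= eta.
  have bv := bmeas_code v.
  rewrite -Pint_code ler_norml; apply/andP; split.
    have : Pint P (v \o c) <= Pint P (fun x => g x + eta).
      apply: Pint_le => //; first by apply: bmeasD => //; exact: bmeas_cst.
      by move=> x /=; have := h1 x; rewrite ler_norml => /andP[]; lra.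
    rewrite PintD ?Pint_cst//; last exact: bmeas_cst.
    by lra.
  have : Pint P g <= Pint P (fun x => (v \o c) x + eta).
    apply: Pint_le => //; first by apply: bmeasD => //; exact: bmeas_cst.
    by move=> x /=; have := h1 x; rewrite ler_norml => /andP[]; lra.
  rewrite PintD ?Pint_cst//; last exact: bmeas_cst.
  by lra.
have E : \sum_(y <- s) v (c y) = \sum_t (count (fun y => c y == t) s)%:R * v t.
  elim: s {hs} => [|y s IH].
    by rewrite big_nil big1// => t _; rewrite mul0r.
  rewrite big_cons IH /= [RHS](eq_bigr (fun t => (c y == t)%:R * v t +
     (count (fun y0 => c y0 == t) s)%:R * v t)); last first.
    by move=> t _; rewrite natrD mulrDl.
  rewrite big_split/=; congr (_ + _); rewrite (bigD1 (c y))//= eqxx mul1r.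
  by rewrite big1 ?addr0// => t; rewrite eq_sym => /negbTE ->; rewrite mul0r.
have -> : \sum_(y <- s) (g y - Pint P g) =
    \sum_(y <- s) (g y - v (c y)) +
    \sum_t ((count (fun y => c y == t) s)%:R - (size s)%:R * law P c t) * v t +
    (size s)%:R * (\sum_t law P c t * v t - Pint P g).
  have e2 : \sum_t ((count (fun y => c y == t) s)%:R - (size s)%:R * law P c t) * v t =
      \sum_t (count (fun y => c y == t) s)%:R * v t - (size s)%:R * \sum_t law P c t * v t.
    under eq_bigr do rewrite mulrBl -mulrA.
    by rewrite sumrB -mulr_sumr.
  rewrite e2 !sumrB E big_const_seq count_predT iter_addr_0 -[Pint P g *+ _]mulr_natl.
  by rewrite mulrBr; lra.
rewrite (le_trans (ler_normD _ _))//.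
have -> : (size s)%:R * (2 * eta + B * th * #|T|%:R) =
   ((size s)%:R * eta + (\sum_(t : T) th * (size s)%:R * B)) + (size s)%:R * eta.
  by rewrite sumr_const -[_ *+ #|T|]mulr_natl; ring.
rewrite lerD//.
  rewrite (le_trans (ler_normD _ _))// lerD//.
    apply: (le_trans (ler_norm_sum _ _ _)).
    rewrite mulr_natl -(count_predT s) -iter_addr_0 -big_const_seq.
    by apply: ler_sum => y _.
  apply: (le_trans (ler_norm_sum _ _ _)); apply: ler_sum => t _.
  rewrite normrM; apply: ler_pM => //; by have [] := hv t.
by rewrite normrM ger0_norm// ler_wpM2l// distrC.
Qed.

End CodeAverage.

(** * Tracing finite chains *)

Lemma sum_blocks {R : nmodType} (a : nat -> R) m q :
  \sum_(t < m * q) a t = \sum_(j < m) \sum_(t < q) a (j * q + t)%N.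
Proof.
elim: m => [|m IH]; first by rewrite mul0n !big_ord0.
rewrite mulSnr big_split_ord big_ord_recr/= -IH; congr (_ + _).
Qed.

Lemma periodic_average {R : realType} (a : nat -> R) (A ka : R) q : (0 < q)%N ->
  0 <= ka -> (forall t, `|a t| <= A) ->
  (forall j, `|\sum_(t < q) a (j * q + t)%N| <= q%:R * ka) ->
  forall n, `|\sum_(t < n) a t| <= n%:R * ka + q%:R * A.
Proof.
move=> q0 ka0 hA hq n; rewrite (divn_eq n q) big_split_ord/= sum_blocks.
rewrite (le_trans (ler_normD _ _))// lerD//.
  apply: (le_trans (ler_norm_sum _ _ _)).
  apply: (@le_trans _ _ (\sum_(j < n %/ q) q%:R * ka)); first exact: ler_sum.
  rewrite sumr_const card_ord -[leLHS]mulr_natl mulrA ler_wpM2r// -natrM ler_nat.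
  exact: leq_addr.
apply: (le_trans (ler_norm_sum _ _ _)).
apply: (@le_trans _ _ (\sum_(j < n %% q) A)); first exact: ler_sum.
rewrite sumr_const card_ord -[leLHS]mulr_natl ler_wpM2r//.
  by apply: le_trans (hA 0%N).
by rewrite ler_nat ltnW// ltn_pmod.
Qed.

Lemma periodic_count {R : realType} (a : nat -> R) q i : (i < q)%N ->
  (forall t, 0 <= a t) -> (forall j, 1 <= a (j * q + i)%N) ->
  forall n, (n %/ q)%:R <= \sum_(t < n) a t.
Proof.
move=> iq a0 a1 n; have -> : \sum_(t < n) a t = \sum_(t < n %/ q * q + n %% q) a t by rewrite -divn_eq.
rewrite big_split_ord/= sum_blocks ler_wpDr ?sumr_ge0//.
rewrite -[X in X%:R <= _](card_ord (n %/ q)) -sumr_const; apply: ler_sum => j _.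
by rewrite (bigD1 (Ordinal iq))//= (le_trans (a1 j))// lerDl sumr_ge0.
Qed.

Lemma loop_step (X : Type) (e : rel X) (z : X) (s : seq X) : loop e z s ->
  forall t, e (nth z s (t %% size s)) (nth z s (t.+1 %% size s)).
Proof.
move=> [s' [-> hp]] t; set n := size (z :: s').
have n0 : (0 < n)%N by [].
have h i : (i < n)%N -> e (nth z (z :: s') i) (nth z (rcons s' z) i).
  move=> iln; have /(pathP z) := hp; rewrite size_rcons => /(_ i iln).
  by case: i iln => [|i] //= iln; rewrite nth_rcons; case: ifP => // /negbT; rewrite -leqNgt leqNgt -ltnS iln.
have := h (t %% n)%N (ltn_pmod t n0); congr (e _ _).
rewrite nth_rcons; have := ltn_pmod t n0; rewrite {1}/n /= ltnS leq_eqVlt => /predU1P[E|lt].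
  rewrite E ltnn eqxx; have -> : (t.+1 %% n = 0)%N; last by [].
  by rewrite -addn1 -modnDml E addn1 modnn.
rewrite lt; have -> : (t.+1 %% n = (t %% n).+1)%N; last by [].
by rewrite -addn1 -modnDml addn1 modn_small.
Qed.

Lemma mfib_cst d (X : measurableType d) (V : finType) (v : V) : mfib (fun _ : X => v).
Proof.
move=> w; have [->|vw] := eqVneq v w.
  by rewrite (_ : _ @^-1` _ = setT)//; apply/seteqP; split.
rewrite (_ : _ @^-1` _ = set0)// -subset0 => x /= /eqP; by rewrite (negbTE vw).
Qed.

Section ChainProperties.
Context {R : realType} {d : measure_display} {X : measurableType d}.
Context (dist : X -> X -> R) (f : X -> X) (Y : set X).

(* The linking chains may leave [Y]; only their end points lie in it. *)
Definition chain_linked := forall del : R, 0 < del -> exists M, forall u v, Y u -> Y v ->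
  exists l : seq X, (size l <= M)%N /\ path (pstep dist f del) u (rcons l v).

(** The tracing point is required in [Y]: as [f] preserves [Y], its orbit can then be linked
    again. *)
Definition chain_traced := forall eps : R, 0 < eps -> exists2 del : R, 0 < del &
  forall u s, path (pstep dist f del) u s -> Y u -> Y (last u s) ->
  exists2 y, Y y & forall i, (i <= size s)%N ->
    dist (iter i f y) (nth u (u :: s) i) < eps.

End ChainProperties.

Section Tracing.
Context {R : realType} {d : measure_display} {X : measurableType d}.
Context (dist : X -> X -> R) (Hm : is_metric dist) (Hb : borel_for_dist dist).
Context (Hc : dcompact dist) (f : X -> X) (Hf : dcontinuous_map dist f).
Context (Hp : POTP dist f).
Let mf := measurable_dcontinuous_map Hb Hf.
Context (Y : set X) (cY : dclosed dist Y) (fY : forall x, Y x -> Y (f x)).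
Context (hlink : chain_linked dist f Y).
Let mY := measurable_dclosed Hb cY.

Lemma common_radius k (gs : 'I_k -> X -> R) (e : R) : 0 < e ->
  (forall i, dcontinuous_fun dist (gs i)) -> exists rho B : R, [/\ 0 < rho, 0 < B,
    forall i x, `|gs i x| <= B &
    forall i x y, dist x y < rho -> `|gs i x - gs i y| <= e].
Proof.
move=> e0 gc.
have /choice[r hr] : forall i : 'I_k, exists r : R, 0 < r /\
    forall x y, dist x y < r -> `|gs i x - gs i y| < e.
  by move=> i; have [r r0 h] := uniform_continuity_fun Hm Hc (gc i) e0; exists r.
have /choice[b hb] : forall i : 'I_k, exists b : R, 0 < b /\ forall x, `|gs i x| <= b.
  by move=> i; have [b b0 h] := continuous_bounded Hm Hc (gc i); exists b.
exists (\big[Num.min/1]_i r i), (\sum_i b i + 1); split.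
- by elim/big_ind: _ => // [x y x0 y0|i _]; [rewrite lt_min x0|have [] := hr i].
- by rewrite ltr_wpDl// sumr_ge0// => i _; have [/ltW] := hb i.
- move=> i x; have [_ h] := hb i; apply: (le_trans (h x)).
  rewrite (bigD1 i)//= -addrA lerDl addr_ge0// sumr_ge0// => j _.
  by have [/ltW] := hb j.
- move=> i x y h; have [_ h2] := hr i; apply/ltW/h2/(lt_le_trans h).
  exact: bigmin_le_cond.
Qed.

(* Close the chain into a periodic pseudo-orbit that spends most of its time
   in a loop whose averages are close to [nu]. A point tracing it has a limit
   measure in the neighbourhood of [nu], hence carried by [Y]; this measure
   charges the set of points whose first iterates trace the chain. *)
Lemma finite_tracing (nu : probability X R) k (gs : 'I_k -> X -> R) (eps0 : R) :
  Defs.invariant f nu -> nu Y = 1%E -> basic_data dist gs eps0 ->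
  (forall nu', Defs.invariant f nu' -> wnbhd gs eps0 nu nu' -> nu' Y = 1%E) ->
  chain_traced dist f Y.
Proof.
move=> nuf nuY [gc e00] hU eps e0.
have e8 : 0 < eps0 / 8 by lra.
have [rho [B [rho0 B0 gB grho]]] := common_radius e8 gc.
pose e' := Num.min (eps / 2) rho.
have e'0 : 0 < e' by rewrite lt_min; apply/andP; split; lra.
have e'e : 2 * e' <= eps.
  have : e' <= eps / 2 by rewrite ge_min lexx.
  by lra.
have e'rho : e' <= rho by rewrite ge_min lexx orbT.
have [del d0 hdel] := Hp e'0.
exists del => // u s ps Yu Ys.
have hd y : dist y y <= del by rewrite (distxx Hm) ltW.
have [M hM] := hlink d0.
have [T [c [mc hc]]] := small_code Hm Hb Hc rho0.
pose th := eps0 / 8 / (B * (#|T|%:R + 1)).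
have BT0 : 0 < B * (#|T|%:R + 1) by rewrite mulr_gt0// ltr_wpDl.
have th0 : 0 < th by rewrite divr_gt0.
have thB : B * th * #|T|%:R <= eps0 / 8.
  have -> : eps0 / 8 = th * (B * (#|T|%:R + 1)) by rewrite /th divfK// gt_eqF.
  rewrite -mulrA mulrCA ler_pM2l// ler_pM2l//; lra.
(* [superblocks] is applied with a one-letter [S]-code, no bad points and the rate -2: all that is
   wanted is one loop with the right frequencies. *)
have mU (V : finType) (v : V) : mfib (fun _ : X => v) by exact: mfib_cst.
have hka (I : finType) (w : {ffun I -> unit}) K : K%:R <= (1 : R) * #|I|%:R ->
    #|[set v | (hdist w v <= K)%N]%SET|%:R <= expR (1 * #|I|%:R : R).
  move=> _; apply: (@le_trans _ _ 1); last by rewrite mul1r -[leLHS]expR0 ler_expR.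
  rewrite (ler_nat _ _ 1); apply: leq_trans (max_card _) _.
  by rewrite card_ffun card_unit exp1n.
have hbad : law nu (fun _ : X => true) false <= 1 / 4 :> R.
  rewrite /law (_ : _ @^-1` _ = set0) ?pr_set0 ?divr_ge0//.
  by rewrite -subset0 => x.
have hH n : (0 < n)%N -> 0 <= Hcode nu (cyl f (fun _ : X => tt) n) / n%:R :> R.
  by move=> n0; rewrite divr_ge0// Hcode_ge0//; exact: mfib_cyl.
have s2 : (- 2 + 2 * 1 : R) <= 0 by lra.
have [l [N [sg [l0 lN hsg _ hfreq]]]] := @superblocks _ _ _ dist f mf nu nuf Y mY nuY
  fY u Yu del hd M hM _ _ _ c _ (mU _ tt) mc (mU _ true) 1 1 ltr01 ltr01 hka 0 (- 2) th
  s2 hH hbad th0.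
have [a0 _] : exists a : 'I_N, true.
  have N0 : (0 < N)%N by rewrite -(ltr0n R); apply: lt_le_trans lN; exact: expR_gt0.
  by exists (Ordinal N0).
pose b := sg a0; have [szb lpb] : size b = l /\ loop (pstep dist f del) u b := hsg a0.
have [l1 [_ pl1]] := hM _ _ Ys Yu.
pose ex := u :: s ++ l1; pose q0 := size ex.
have lpex : loop (pstep dist f del) u ex.
  by exists (s ++ l1); split => //; rewrite rcons_cat cat_path ps.
have lr0 : (0 : R) < l%:R by rewrite ltr0n.
(* Enough turns of the loop [b] for the excursion [ex] to change averages by at most [eps0 / 8]. *)
pose r := (Num.truncn (2 * B * q0%:R / (eps0 / 8 * l%:R))).+1.
have hr : 2 * B * q0%:R <= eps0 / 8 * l%:R * r%:R.
  rewrite -ler_pdivrMl ?mulr_gt0// mulrC; exact: ltW (truncnS_gt _).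
pose b' := flatten [seq b | _ <- iota 0 r].
have szb' : size b' = (r * l)%N.
  rewrite /b' size_flatten /shape -map_comp sumnE big_map big_const_seq count_predT.
  by rewrite size_iota iter_addn_0 /= szb mulnC.
pose per := b' ++ ex; pose q := size per.
have qE : q = (r * l + q0)%N by rewrite /q size_cat szb'.
have lper : loop (pstep dist f del) u per.
  by apply: loop_cat => //; apply: loop_flatten => //; rewrite size_iota.
have qgt0 : (0 < q)%N by rewrite qE addn_gt0 orbT.
have qr0 : (0 : R) < q%:R by rewrite ltr0n.
have [x hx] := hdel (fun t => nth u per (t %% q)) (loop_step lper).
have hx' j t : (t < q)%N -> dist (iter (j * q + t) f x) (nth u per t) < e'.
  by move=> tq; have := hx (j * q + t)%N; rewrite modnMDl modn_small.
(* One eighth comes from tracing, three from the loop and one from the excursion. A further eighth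
   for the last incomplete period and one for the limit measure still stay below [eps0]. *)
have avg i n : `|\sum_(t < n) (gs i (iter t f x) - Pint nu (gs i))| <=
    n%:R * (5 / 8 * eps0) + q%:R * (2 * B).
  have bI : `|Pint nu (gs i)| <= B.
    by apply: Pint_norm_le => //; exact: (bmeas_dcontinuous Hm Hb Hc (gc i)).
  have bb y : `|gs i y - Pint nu (gs i)| <= 2 * B.
    by apply: (le_trans (ler_normB _ _)); have := gB i y; lra.
  apply: (periodic_average (a := fun t => gs i (iter t f x) - Pint nu (gs i))) => //.
    by lra.
  move=> j.
  have -> : \sum_(t < q) (gs i (iter (j * q + t) f x) - Pint nu (gs i)) =
      \sum_(t < q) (gs i (iter (j * q + t) f x) - gs i (nth u per t)) +
      \sum_(y <- per) (gs i y - Pint nu (gs i)).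
    rewrite (big_nth u) big_mkord -big_split/=; apply: eq_bigr => t _.
    by rewrite addrA subrK.
  have h1 : `|\sum_(t < q) (gs i (iter (j * q + t) f x) - gs i (nth u per t))| <=
      q%:R * (eps0 / 8).
    apply: (le_trans (ler_norm_sum _ _ _)).
    rewrite -[q in leRHS]card_ord mulr_natl -sumr_const; apply: ler_sum => t _.
    by apply: grho; apply: (lt_le_trans (hx' j t (ltn_ord t))).
  have h2 : `|\sum_(y <- b) (gs i y - Pint nu (gs i))| <= l%:R * (3 * (eps0 / 8)).
    rewrite -szb; apply: (le_trans (code_average Hm Hb Hc mc (gc i) (gB i) (th := th) _ _)).
    - by move=> y y' yy'; apply: grho; exact: hc.
    - by move=> t; rewrite szb; exact: hfreq.
    - by rewrite ler_wpM2l//; lra.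
  have h3 : `|\sum_(y <- ex) (gs i y - Pint nu (gs i))| <= q0%:R * (2 * B).
    apply: (le_trans (ler_norm_sum _ _ _)).
    apply: (@le_trans _ _ (\sum_(y <- ex) 2 * B)); first exact: ler_sum.
    by rewrite big_const_seq count_predT iter_addr_0 -[leLHS]mulr_natl.
  have h4 : `|\sum_(y <- b') (gs i y - Pint nu (gs i))| <= r%:R * (l%:R * (3 * (eps0 / 8))).
    rewrite /b' big_flatten big_map big_const_seq count_predT size_iota iter_addr_0.
    by rewrite normrMn -[leLHS]mulr_natl ler_wpM2l.
  rewrite big_cat/=; move: h1 h2 h3 h4 hr; rewrite qE natrD natrM.
  set u1 := \sum_(t < _) _; set u2 := \sum_(y <- b') _; set u3 := \sum_(y <- ex) _.
  move=> h1 _ h3 h4 hr'; apply: (le_trans (ler_normD _ _)).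
  apply: (le_trans (lerD h1 (le_trans (ler_normD _ _) (lerD h4 h3)))).
  have : 0 <= q0%:R * eps0 by rewrite mulr_ge0// ltW.
  by move: hr'; clear; set r' := r%:R; set l' := l%:R; set q' := q0%:R => *; lra.
have [nu' Vnu'] := Vlim_nonempty Hm Hb Hc f x.
have nu'f := Vlim_invariant Hm Hb Hc Hf Vnu'.
have nu'Y : nu' Y = 1%E.
  apply: hU => // i.
  have bd : basic_data dist gs (eps0 / 8) by [].
  have [n] := Vnu' k gs (eps0 / 8) bd (Num.truncn (q%:R * (2 * B) / (eps0 / 8))).+1.
  move=> Nn /(_ i).
  have n0 : (0 < n)%N by exact: leq_trans Nn.
  have nr0 : (0 : R) < n%:R by rewrite ltr0n.
  have hn : q%:R * (2 * B) <= n%:R * (eps0 / 8).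
    rewrite -ler_pdivrMr//; apply: (le_trans (ltW (truncnS_gt _))).
    by rewrite ler_nat.
  have : `|emp_int f x n (gs i) - Pint nu (gs i)| <= 6 / 8 * eps0.
    have -> : emp_int f x n (gs i) - Pint nu (gs i) =
        n%:R^-1 * \sum_(t < n) (gs i (iter t f x) - Pint nu (gs i)).
      by rewrite sumrB mulrBr sumr_const card_ord -[Pint nu (gs i) *+ n]mulr_natl mulKf// gt_eqF.
    rewrite normrM gtr0_norm ?invr_gt0// ler_pdivrMl//.
    by apply: (le_trans (avg i n)); lra.
  rewrite ler_norml !ltr_norml => /andP[? ?] /andP[? ?]; apply/andP; split; lra.
have [eta eta0 heta] := uniform_iter Hm Hc (size s) Hf e'0.
pose D := [set y | forall i, (i <= size s)%N -> dist (iter i f y) (nth u (u :: s) i) < e'].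
have [g [gcont g01 gD gpos]] := urysohn Hm D eta0.
suff : exists2 y, Y y & 0 < g y.
  move=> [y Yy gy]; exists y => // i il; have [a Da ay] := gpos y gy.
  have h1 := Da i il; have h2 := heta _ _ ay i il.
  apply: (lt_le_trans _ e'e); apply: (le_lt_trans (dist_triangle Hm (iter i f a) _ _)).
  by rewrite (distC Hm _ (iter i f a)); lra.
apply: contrapT => hn.
have g0 y : Y y -> g y = 0.
  move=> Yy; have /andP[gy _] := g01 y; apply/eqP; rewrite eq_le gy andbT leNgt.
  by apply/negP => gy'; apply: hn; exists y.
have bg := bmeas_dcontinuous Hm Hb Hc gcont.
have P0 : Pint nu' g <= 0.
  have : Pint nu' g <= Pint nu' (\1_(~` Y)).
    apply: Pint_le => //; first exact/bmeas_indic/measurableC.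
    move=> y; rewrite indicE; case: (boolP (y \in ~` Y)) => h.
      by have /andP[] := g01 y.
    rewrite g0//; apply: contrapT => nY; by rewrite mem_set in h.
  by rewrite Pint_indic ?prC ?[pr _ Y]/pr ?nu'Y ?subrr//; exact: measurableC.
(* The orbit of [x] meets [D] at the start of each excursion, at the times [j * q + r * l]. The
   averages of [g] thus stay above [(2 * q)^-1], so [g] cannot have integral 0. *)
have cnt n : (n %/ q)%:R <= \sum_(t < n) g (iter t f x).
  apply: (@periodic_count _ (fun t => g (iter t f x)) q (r * l)%N).
  - by rewrite qE -[ltnLHS]addn0 ltn_add2l.
  - by move=> t; have /andP[] := g01 (iter t f x).
  - move=> j; rewrite gD// => i il; rewrite -iterD addnC -addnA.
    have iq : (r * l + i < q)%N.
      by rewrite qE ltn_add2l /q0 /= size_cat ltnS (leq_trans il)// leq_addr.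
    have := hx' j _ iq; rewrite /per nth_cat szb' ltnNge leq_addr/= addKn /ex.
    by rewrite -cat_cons nth_cat /= ltnS il.
have e1 : 0 < (2 * q%:R)^-1 :> R by rewrite invr_gt0 mulr_gt0.
have bd : basic_data dist (fun _ : 'I_1 => g) (2 * q%:R)^-1 by [].
have [n nN /(_ ord0)] := Vnu' _ _ _ bd (2 * q)%N.
have n0 : (0 < n)%N by apply: leq_trans nN; rewrite muln_gt0.
have nr0 : (0 : R) < n%:R by rewrite ltr0n.
have : (2 * q%:R)^-1 <= emp_int f x n g.
  rewrite /emp_int ler_pdivlMl// ler_pdivrMr ?mulr_gt0// [leRHS]mulrC.
  apply: (@le_trans _ _ (2 * q%:R * (n %/ q)%:R)); last by rewrite ler_pM2l// mulr_gt0.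
  rewrite -natrM -natrM ler_nat {1}(divn_eq n q) -mulnA mul2n -addnn [(q * _)%N]mulnC leq_add2l.
  apply: (@leq_trans q); first by rewrite ltnW// ltn_pmod.
  by rewrite -[leqLHS]mul1n leq_mul2r divn_gt0// (leq_trans _ nN) ?orbT// leq_pmull.
rewrite ltr_norml => h1 /andP[_]; rewrite ltrBlDr ltNge => /negP; apply.
by apply: le_trans h1; rewrite gerDl.
Qed.

End Tracing.

(** * Bowen entropy *)

Section BowenEntropy.
Context {R : realType} {d : measure_display} {X : measurableType d}.
Context (dist : X -> X -> R) (Hm : is_metric dist) (f : X -> X).
Implicit Types (Z : set X) (s eps : R) (N : nat).

Local Open Scope ereal_scope.

Lemma dn_lt n x y eps : (0 < eps)%R ->
  ((dn dist f n x y < eps)%R <-> forall i, (i < n)%N -> (dist (iter i f x) (iter i f y) < eps)%R).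
Proof.
move=> e0; rewrite /dn; split.
  move=> h i il; apply: le_lt_trans h.
  exact: (@le_bigmax_cond _ _ _ 0%R (Ordinal il) xpredT (fun i : 'I_n => dist (iter i f x) (iter i f y))).
move=> h; apply/bigmax_ltP; split => // i _; exact: h.
Qed.

Lemma bowen_ball_dist n x eps y z : (0 < eps)%R -> bowen_ball dist f n x eps y ->
  bowen_ball dist f n x eps z ->
  forall i, (i < n)%N -> (dist (iter i f y) (iter i f z) < 2 * eps)%R.
Proof.
move=> e0 /(dn_lt _ _ _ e0) hy /(dn_lt _ _ _ e0) hz i il.
have := hy i il; have := hz i il; rewrite (distC Hm _ (iter i f y)).
by have := dist_triangle Hm (iter i f x) (iter i f y) (iter i f z); lra.
Qed.

Lemma mB_ge0 Z s N eps : 0 <= mB dist f Z s N eps.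
Proof.
apply: le_ereal_inf_tmp => _ [J [c [_ ->]]].
by apply: esum_ge0 => j _; rewrite lee_fin expR_ge0.
Qed.

Lemma mB_le Z s N eps J c : bcover dist f Z N eps J c ->
  mB dist f Z s N eps <= \esum_(j in J) (expR (- ((c j).2%:R * s)))%:E.
Proof. by move=> h; apply: ereal_inf_lbound; exists J, c. Qed.

Lemma mB_sub Z Z' s N eps : Z `<=` Z' -> mB dist f Z s N eps <= mB dist f Z' s N eps.
Proof.
move=> ZZ; apply: le_ereal_inf_tmp => _ [J [c [[hN hc] ->]]]; apply: mB_le; split => //.
exact: subset_trans hc.
Qed.

Lemma mB_eps Z s N eps eps' : (eps <= eps')%R ->
  mB dist f Z s N eps' <= mB dist f Z s N eps.
Proof.
move=> ee; apply: le_ereal_inf_tmp => _ [J [c [[hN hc] ->]]]; apply: mB_le; split => //.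
apply: (subset_trans hc); apply: subset_bigcup => j _ y; rewrite /bowen_ball/=.
by move=> h; exact: lt_le_trans h ee.
Qed.

Lemma mB_nondecreasing Z s eps : nondecreasing_seq (fun N => mB dist f Z s N eps).
Proof.
move=> N N' NN; apply: le_ereal_inf_tmp => _ [J [c [[hN hc] ->]]]; apply: mB_le; split => //.
by move=> j Jj; exact: leq_trans NN (hN j Jj).
Qed.

Lemma mB_limE Z s eps :
  mB_lim dist f Z s eps = ereal_sup (range (fun N => mB dist f Z s N eps)).
Proof. by apply/cvg_lim => //; exact/ereal_nondecreasing_cvgn/mB_nondecreasing. Qed.

Lemma mB_lim_eq0 Z s eps :
  mB_lim dist f Z s eps = 0 <-> forall N, mB dist f Z s N eps = 0.
Proof.
rewrite mB_limE; split=> [h N|h].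
  by apply/eqP; rewrite eq_le mB_ge0 andbT -h; apply: ereal_sup_ubound; exists N.
by apply/eqP; rewrite eq_le; apply/andP; split;
  [apply: ge_ereal_sup => _ [N _ <-]|rewrite -(h 0%N); apply: ereal_sup_ubound; exists 0%N];
  rewrite ?h.
Qed.

Lemma htop_eps_sub Z Z' eps : Z `<=` Z' -> htop_eps dist f Z eps <= htop_eps dist f Z' eps.
Proof.
move=> ZZ; apply: le_ereal_inf_tmp => _ [s /= /mB_lim_eq0 h <-].
apply: ereal_inf_lbound; exists s => //=; apply/mB_lim_eq0 => N.
by apply/eqP; rewrite eq_le mB_ge0 andbT -(h N) mB_sub.
Qed.

Lemma htop_eps_nonincreasing Z eps eps' : (eps <= eps')%R ->
  htop_eps dist f Z eps' <= htop_eps dist f Z eps.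
Proof.
move=> ee; apply: le_ereal_inf_tmp => _ [s /= /mB_lim_eq0 h <-].
apply: ereal_inf_lbound; exists s => //=; apply/mB_lim_eq0 => N.
by apply/eqP; rewrite eq_le mB_ge0 andbT -(h N) mB_eps.
Qed.

Lemma hBowenE Z :
  hBowen dist f Z = ereal_sup [set htop_eps dist f Z eps | eps in [set eps | (0 < eps)%R]].
Proof.
apply/cvg_lim => //.
have h := @nonincreasing_at_right_cvge _ (htop_eps dist f Z) 0%R (BInfty _ false)
  isT (fun x y _ _ => @htop_eps_nonincreasing Z x y).
have E : [set eps | (0 < eps)%R] = [set` Interval (BRight (0 : R)%R) (BInfty _ false)].
  by apply/seteqP; split => x /=; rewrite in_itv/= andbT.
by rewrite E.
Qed.

Lemma hBowen_sub Z Z' : Z `<=` Z' -> hBowen dist f Z <= hBowen dist f Z'.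
Proof.
move=> ZZ; rewrite !hBowenE; apply: ge_ereal_sup => _ [e e0 <-].
by apply: le_trans (htop_eps_sub e ZZ) _; apply: ereal_sup_ubound; exists e.
Qed.

Lemma hBowen_ge Z s eps : (0 < eps)%R ->
  (forall s', mB_lim dist f Z s' eps = 0 -> (s <= s')%R) -> s%:E <= hBowen dist f Z.
Proof.
move=> e0 h; rewrite hBowenE; apply: (@le_trans _ _ (htop_eps dist f Z eps)).
  by apply: le_ereal_inf_tmp => _ [s' /= /h ss <-]; rewrite lee_fin.
by apply: ereal_sup_ubound; exists eps.
Qed.

Lemma hBowen_le Z (t : R) :
  (forall eps s, (0 < eps)%R -> (t < s)%R -> forall N, mB dist f Z s N eps = 0) ->
  hBowen dist f Z <= t%:E.
Proof.
move=> h; rewrite hBowenE; apply: ge_ereal_sup => _ [eps e0 <-].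
apply/lee_addgt0Pr => e epos; apply: ereal_inf_lbound; exists (t + e)%R => //=.
by apply/mB_lim_eq0; apply: h => //; rewrite ltrDl.
Qed.

Lemma mB_set0 s N eps : mB dist f set0 s N eps = 0.
Proof.
apply/eqP; rewrite eq_le mB_ge0 andbT.
have h : bcover dist f set0 N eps set0 (fun=> (point : X, N)) by split.
by apply: le_trans (mB_le s h) _; rewrite esum_set0.
Qed.

Lemma mB_bigcup (Zn : nat -> set X) s N eps (b : nat -> \bar R) :
  (forall n, mB dist f (Zn n) s N eps <= b n) -> (forall n, b n < +oo) ->
  mB dist f (\bigcup_n Zn n) s N eps <= \sum_(n <oo) b n.
Proof.
move=> hb bfin; apply/lee_addgt0Pr => e e0.
have b0 n : 0 <= b n by exact: le_trans (mB_ge0 _ _ _ _) (hb n).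
have e4 n : (0 < e / (2 ^ n.+1)%:R)%R by rewrite divr_gt0// ltr0n expn_gt0.
have /choice[Jc hJc] : forall n, exists Jc : set nat * (nat -> X * nat),
    bcover dist f (Zn n) N eps Jc.1 Jc.2 /\
    \esum_(j in Jc.1) (expR (- ((Jc.2 j).2%:R * s)))%:E <= b n + (e / (2 ^ n.+1)%:R)%:E.
  move=> n; have fin : mB dist f (Zn n) s N eps \is a fin_num.
    by rewrite ge0_fin_numE ?mB_ge0// (le_lt_trans (hb n)).
  have [_ [J [c [hc ->]]] h] := lb_ereal_inf_adherent (e4 n) fin.
  by exists (J, c); split => //; apply: (le_trans (ltW h)); exact: leeD2r (hb n).
pose J n := (Jc n).1; pose c n := (Jc n).2.
pose JJ := (pickle : nat * nat -> nat) @` ([set: nat] `*`` J).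
pose cc m := let nj := odflt (0%N, 0%N) (unpickle m) in c nj.1 nj.2.
have ccE nj : cc (pickle nj) = c nj.1 nj.2 by rewrite /cc pickleK.
apply: (@le_trans _ _ (\esum_(m in JJ) (expR (- ((cc m).2%:R * s)))%:E)).
  apply: mB_le; split.
    move=> _ [[n j] [_ /= Jj] <-]; rewrite ccE /=.
    by have [[h _] _] := hJc n; exact: h.
  move=> x [n _ Zx]; have [[_ h] _] := hJc n; have [j Jj hx] := h x Zx.
  by exists (pickle (n, j)); [exists (n, j)|rewrite ccE].
rewrite esum_image; last by move=> x y _ _; exact: (pcan_inj pickleK).
under eq_esum do rewrite ccE.
rewrite -(esum_esum (a := fun n j => (expR (- ((c n j).2%:R * s)))%:E)); last first.
  by move=> *; rewrite lee_fin expR_ge0.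
apply: le_trans (epsilon_trick xpredT b0 (ltW e0)).
rewrite nneseries_esumT; last by move=> n; rewrite adde_ge0// lee_fin ltW.
by apply: le_esum => n _; have [] := hJc n.
Qed.

Lemma mB_bigcup0 (I : countType) (Zi : I -> set X) s N eps :
  (forall i, mB dist f (Zi i) s N eps = 0) ->
  mB dist f (\bigcup_i Zi i) s N eps = 0.
Proof.
move=> h; apply/eqP; rewrite eq_le mB_ge0 andbT.
pose Zn n := if unpickle n is Some i then Zi i else set0.
apply: (@le_trans _ _ (mB dist f (\bigcup_n Zn n) s N eps)).
  by apply: mB_sub => x [i _ Zx]; exists (pickle i) => //; rewrite /Zn pickleK.
apply: le_trans (@mB_bigcup Zn s N eps (fun=> 0) _ _) _ => //.
  by move=> n; rewrite /Zn; case: unpickle => [i|]; rewrite ?h ?mB_set0.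
by rewrite eseries0.
Qed.

Lemma mB_finite_cover (I : finType) Z s N eps n (x : I -> X) : (N <= n)%N ->
  Z `<=` \bigcup_i bowen_ball dist f n (x i) eps ->
  mB dist f Z s N eps <= (#|I|%:R * expR (- (n%:R * s)))%:E.
Proof.
move=> Nn hZ.
pose c (j : nat) := (nth point [seq x i | i <- enum I] j, n).
apply: (@le_trans _ _ (\esum_(j in [set j | (j < #|I|)%N]) (expR (- ((c j).2%:R * s)))%:E)).
  apply: mB_le; split => // y /hZ[i _ hy].
  exists (index i (enum I)); first by rewrite /= cardE index_mem mem_enum.
  by rewrite /c /= (nth_map i) ?index_mem ?mem_enum// nth_index ?mem_enum.
rewrite -/(`I_#|I|) esum_fset//=; last exact: finite_II.
rewrite -fsbig_ord/= sumEFin lee_fin sumr_const card_ord.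
by rewrite -[leLHS]mulr_natl.
Qed.

End BowenEntropy.

(** * The upper bound *)

Section Costs.
Context {R : realType} (W : finType).

(** The products of the weights [expR (- (la w / D))] sum to at most 1 over all tuples, and each
    counted tuple has at least [expR (- B)]. *)
Lemma cost_word_count (la : W -> nat) (D B : R) k : 0 < D ->
  \sum_w expR (- ((la w)%:R / D)) <= 1 ->
  #|[set u : {ffun 'I_k -> W} | (\sum_j la (u j))%:R <= D * B]%SET|%:R <= expR B.
Proof.
move=> D0 kr; set U := [set u | _]%SET.
pose p w := expR (- ((la w)%:R / D)) : R.
have h1 : \sum_(u : {ffun 'I_k -> W}) \prod_j p (u j) <= 1.
  rewrite -(bigA_distr_bigA (fun=> p))/= prodr_const card_ord exprn_ile1//.
  by apply: sumr_ge0 => w _; exact: expR_ge0.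
have h2 u : u \in U -> expR (- B) <= \prod_j p (u j).
  rewrite inE => hu; rewrite -expR_sum ler_expR sumrN lerN2 -mulr_suml -natr_sum.
  by rewrite ler_pdivrMr// mulrC.
have : #|U|%:R * expR (- B) <= 1.
  apply: le_trans h1; rewrite mulr_natl -sumr_const.
  rewrite [leRHS](bigID (fun u => u \in U))/= ler_wpDr ?ler_sum//.
  by apply: sumr_ge0 => u _; apply: prodr_ge0 => j _; exact: expR_ge0.
by rewrite expRN ler_pdivrMr ?expR_gt0// mul1r.
Qed.

(** A Shannon code: [la] is [D] times [- ln p'], rounded up to an integer, hence the final 1. Mixing
    [p] with the uniform law into [p'] gives words of probability 0 a finite cost and changes
    logarithms by at most [de]. *)
Lemma cost_of_law (p : W -> R) (D de : R) : 0 < D -> 0 < de ->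
  (forall w, 0 <= p w) -> \sum_w p w = 1 -> exists la : W -> nat,
  \sum_w expR (- ((la w)%:R / D)) <= 1 /\
  \sum_w p w * (la w)%:R <= D * (\sum_w phi_ent (p w) + de) + 1.
Proof.
move=> D0 de0 p0 p1.
have W0 : (0 < #|W|)%N.
  rewrite lt0n; apply/eqP => W0.
  have : \sum_w p w = 0 by rewrite big1// => w _; have := fintype0 w; rewrite W0 => /(_ erefl).
  by rewrite p1 => /eqP; rewrite oner_eq0.
have Wr : (0 : R) < #|W|%:R by rewrite ltr0n.
pose tau := 1 - expR (- de).
have e1 : expR (- de) < 1 by rewrite -[ltRHS]expR0 ltr_expR oppr_lt0.
have e2 : 0 < expR (- de) by exact: expR_gt0.
have tau0 : 0 < tau by rewrite subr_gt0.
pose p' w := expR (- de) * p w + tau / #|W|%:R.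
have p'0 w : 0 < p' w.
  by rewrite ltr_wpDl ?mulr_ge0 ?expR_ge0// divr_gt0.
have p'1 : \sum_w p' w = 1.
  rewrite big_split/= -mulr_sumr p1 mulr1 sumr_const.
  by rewrite -[_ *+ #|W|]mulr_natl mulrCA mulfV ?gt_eqF// mulr1 addrC subrK.
have p'le1 w : p' w <= 1.
  by rewrite -[leRHS]p'1 (bigD1 w)//= lerDl sumr_ge0// => i _; exact: ltW.
pose la w := (Num.truncn (D * - ln (p' w))).+1.
have l0 w : 0 <= D * - ln (p' w).
  by apply: mulr_ge0; [exact: ltW|rewrite oppr_ge0 ln_le0].
exists la; split.
  rewrite -[leRHS]p'1; apply: ler_sum => w _.
  rewrite -[leRHS]lnK ?posrE// ler_expR lerNl ler_pdivlMr// mulrC.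
  by rewrite /la; exact: ltW (truncnS_gt _).
have h w : p w * (la w)%:R <= D * (phi_ent (p w) + p w * de) + p w.
  have := p0 w; rewrite le_eqVlt => /predU1P[<-|pw].
    by rewrite !mul0r phi_ent0 !addr0 mulr0.
  have l1 : (la w)%:R <= D * - ln (p' w) + 1.
    by have /andP[h _] := truncn_itv (l0 w); rewrite /la -natr1 lerD2r.
  have l2 : - ln (p' w) <= de - ln (p w).
    rewrite lerNl opprB addrC -{1}[- de]expRK -lnM ?posrE// ler_ln ?posrE//.
      by rewrite lerDl divr_ge0// ltW.
    by rewrite mulr_gt0.
  apply: (le_trans (ler_wpM2l (ltW pw) l1)).
  rewrite mulrDr mulr1 lerD2r mulrCA ler_pM2l// /phi_ent.
  apply: (le_trans (ler_wpM2l (ltW pw) l2)); rewrite mulrBr; lra.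
apply: (@le_trans _ _ (\sum_w (D * (phi_ent (p w) + p w * de) + p w))); first exact: ler_sum.
by rewrite big_split/= p1 -mulr_sumr big_split/= -mulr_suml p1 mul1r.
Qed.

End Costs.

Section BowenUpper.
Context {R : realType} {d : measure_display} {X : measurableType d}.
Context (dist : X -> X -> R) (Hm : is_metric dist) (Hb : borel_for_dist dist).
Context (Hc : dcompact dist) (f : X -> X) (Hf : dcontinuous_map dist f).
Let mf := measurable_dcontinuous_map Hb Hf.
Context (T : finType) (cen : T -> X) (eps : R) (eps0 : 0 < eps).

(* [named w y]: the word [w] names the orbit segment of [y] of length [M] up to
   the scale [eps / 2]; names are not unique. *)
Definition named M (w : {ffun 'I_M -> T}) (y : X) :=
  forall i : 'I_M, dist (iter i f y) (cen (w i)) < eps / 2.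

(* After a shift by some [q < M], the orbit of [x] splits into [k] blocks of
   length [M] having names of total cost [la] at most [D * k * M * E]; by the
   Kraft inequality in [Zcost] at most [expR (k * M * E)] names qualify. *)
Definition Zlevel (D E : R) M (la : {ffun 'I_M -> T} -> nat) k : set X :=
  [set x | exists (q : 'I_M) (u0 : {ffun 'I_M -> T})
     (u : {ffun 'I_k -> {ffun 'I_M -> T}}),
     [/\ named u0 x, forall j : 'I_k, named (u j) (iter (j * M + q) f x) &
       (\sum_j la (u j))%:R <= D * ((k * M)%:R * E)]].

Definition Zcost (D E : R) M (la : {ffun 'I_M -> T} -> nat) : set X :=
  [set x | [/\ (0 < M)%N, \sum_w expR (- ((la w)%:R / D)) <= 1 &
   forall k0, exists k, (k0 <= k)%N /\ Zlevel D E la k x]].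

Lemma geometric_tail (r C : R) k0 : 0 <= r < 1 -> 0 <= C ->
  (\sum_(k <oo) (if (k < k0)%N then 0 else C * r ^+ k)%:E <= (C * r ^+ k0 / (1 - r))%:E)%E.
Proof.
move=> /andP[rge0 r1] C0; apply: lime_le.
  by apply: is_cvg_nneseries => k _ _; rewrite lee_fin; case: ifP => // _; rewrite mulr_ge0 ?exprn_ge0.
have q0 : 0 < 1 - r by rewrite subr_gt0.
apply: nearW => n; rewrite sumEFin lee_fin ler_pdivlMr// big_mkord.
suff : (\sum_(k < n) (if (k < k0)%N then 0 else C * r ^+ k)) * (1 - r) <=
    C * r ^+ k0 - (if (n <= k0)%N then C * r ^+ k0 else C * r ^+ n).
  move=> h; apply: (le_trans h); rewrite gerBl.
  by case: ifP => _; rewrite mulr_ge0 ?exprn_ge0.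
elim: n => [|n IH]; first by rewrite big_ord0 mul0r subrr.
rewrite big_ord_recr/= mulrDl; case: (ltngtP n k0) IH => h IH.
- by rewrite mul0r addr0 (le_trans IH)// lerB.
- by move: IH; rewrite exprSr; set u := \sum_(_ < _) _; lra.
- by move: IH; rewrite h exprSr; set u := \sum_(_ < _) _; lra.
Qed.

(** Points sharing [q], [u0] and [u] stay [eps]-close for [k * M] steps: [u0] takes care of the
    first [q] steps, the blocks of [u] of the others. *)
Lemma Zcost_cover (D E s : R) M (la : {ffun 'I_M -> T} -> nat) N k :
  0 < D -> (0 < M)%N -> \sum_w expR (- ((la w)%:R / D)) <= 1 -> (N <= k * M)%N ->
  (mB dist f (Zlevel D E la k) s N eps <=
   (M%:R * #|{ffun 'I_M -> T}|%:R * expR (- (M%:R * (s - E))) ^+ k)%:E)%E.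
Proof.
move=> D0 M0 kr Nk.
pose ok (u : {ffun 'I_k -> {ffun 'I_M -> T}}) :=
  (\sum_j la (u j))%:R <= D * ((k * M)%:R * E).
pose I : finType := ('I_M * {ffun 'I_M -> T} * {u : {ffun 'I_k -> {ffun 'I_M -> T}} | ok u})%type.
pose good (i : I) x := named i.1.2 x /\
  forall j : 'I_k, named (val i.2 j) (iter (j * M + i.1.1) f x).
have /choice[ct hct] : forall i : I, exists x, forall y, good i y -> good i x.
  move=> i; have [[x gx]|hn] := pselect (exists x, good i x); first by exists x.
  by exists point => y gy; exfalso; apply: hn; exists y.
apply: (@le_trans _ _ (#|I|%:R * expR (- ((k * M)%:R * s)))%:E).
  apply: (@mB_finite_cover _ _ _ dist f I _ s N eps (k * M) ct) => // x [q [u0 [u [h0 hu hcost]]]].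
  pose i : I := (q, u0, exist _ u hcost).
  have gx : good i x by split.
  have [g0 gu] := hct i x gx.
  exists i => //; apply/(dn_lt _ _ _ _ _ eps0) => m mkM.
  have near (v : {ffun 'I_M -> T}) (y y' : X) (i' : 'I_M) : named v y -> named v y' ->
      dist (iter i' f y) (iter i' f y') < eps.
    move=> hy hy'; have := hy i'; have := hy' i'.
    have := dist_triangle Hm (cen (v i')) (iter i' f y) (iter i' f y').
    by rewrite (distC Hm (cen _)); lra.
  have [mq|qm] := ltnP m q.
    exact: (near u0 _ _ (Ordinal (ltn_trans mq (ltn_ord q)))).
  have jk : ((m - q) %/ M < k)%N.
    by rewrite ltn_divLR// (leq_ltn_trans (leq_subr _ _)).
  have E1 : m = ((m - q) %% M + ((m - q) %/ M * M + q))%N.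
    by rewrite addnA [(_ %% _ + _)%N]addnC -divn_eq subnK.
  rewrite E1 (iterD _ (_ + q) f (ct i)) (iterD _ (_ + q) f x).
  exact: (near _ _ _ (Ordinal (ltn_pmod (m - q) M0)) (gu (Ordinal jk)) (hu (Ordinal jk))).
have cI : #|I|%:R <= M%:R * #|{ffun 'I_M -> T}|%:R * expR ((k * M)%:R * E) :> R.
  rewrite /I card_prod card_prod card_ord !natrM ler_wpM2l//.
  have := @cost_word_count _ _ la D ((k * M)%:R * E) k D0 kr.
  by move=> h; rewrite -natrM; apply: le_trans h; rewrite card_sig cardsE.
rewrite lee_fin; apply: (le_trans (ler_wpM2r (expR_ge0 _) cI)).
rewrite -[leLHS]mulrA ler_wpM2l// -expRD -expRM_natr ler_expR natrM.
by rewrite le_eqVlt; apply/orP; left; apply/eqP; ring.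
Qed.

(** Each point lies in levels [k] as large as desired, and the covers of the levels beyond [k0] cost
    a geometric tail. *)
Lemma Zcost_null (D E s : R) M (la : {ffun 'I_M -> T} -> nat) N : 0 < D -> E < s ->
  mB dist f (Zcost D E la) s N eps = 0%E.
Proof.
move=> D0 Es.
have [M0|M0] := posnP M.
  rewrite (_ : Zcost D E la = set0) ?mB_set0//.
  by rewrite -subset0 => x [h _ _]; move: (h); rewrite lt0n => /eqP.
have [kr|kr] := pselect (\sum_w expR (- ((la w)%:R / D)) <= 1); last first.
  rewrite (_ : Zcost D E la = set0) ?mB_set0//.
  by rewrite -subset0 => x [].
apply/eqP; rewrite eq_le mB_ge0 andbT.
pose a := M%:R * (s - E).
have a0 : 0 < a by rewrite mulr_gt0 ?ltr0n// subr_gt0.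
pose r := expR (- a).
have r0 : 0 < r by exact: expR_gt0.
have r1 : r < 1 by rewrite -[ltRHS]expR0 ltr_expR oppr_lt0.
pose C : R := M%:R * #|{ffun 'I_M -> T}|%:R.
have C0 : 0 <= C by rewrite mulr_ge0.
pose C' := C / (1 - r).
have C'0 : 0 <= C' by rewrite divr_ge0// subr_ge0 ltW.
have bound k0 : (N <= k0)%N -> (mB dist f (Zcost D E la) s N eps <= (C' * r ^+ k0)%:E)%E.
  move=> Nk0.
  pose Zk k : set X := if (k < k0)%N then set0 else Zlevel D E la k.
  apply: (@le_trans _ _ (mB dist f (\bigcup_k Zk k) s N eps)).
    apply: mB_sub => x [_ _ /(_ k0)[k [kk hk]]]; exists k => //.
    by rewrite /Zk ltnNge kk.
  apply: (le_trans (@mB_bigcup _ _ _ _ _ _ _ _ _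
    (fun k => (if (k < k0)%N then 0 else C * r ^+ k)%:E) _ _)).
  - move=> k; rewrite /Zk; case: ltnP => kk; first by rewrite mB_set0.
    by apply: Zcost_cover => //; rewrite (leq_trans Nk0)// (leq_trans kk)// leq_pmulr.
  - by move=> k; exact: ltry.
  - apply: (le_trans (geometric_tail _ _ _)) => //; first by rewrite ltW.
    by rewrite lee_fin mulrAC.
apply/lee_addgt0Pr => e e0; rewrite add0e.
pose k1 := Num.truncn (C' / (e * a)).
apply: (le_trans (bound (maxn N k1.+1) (leq_maxl _ _))); rewrite lee_fin.
set k0 := maxn _ _.
have k0r : C' / (e * a) <= k0%:R.
  by apply: (le_trans (ltW (truncnS_gt _))); rewrite ler_nat leq_maxr.
have ea0 : 0 < e * a by exact: mulr_gt0.
rewrite ler_pdivrMr// in k0r.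
have : r ^+ k0 <= (1 + a * k0%:R)^-1.
  rewrite /r -expRM_natr mulNr expRN lef_pV2 ?posrE ?expR_gt0 ?expR_ge1Dx//.
  by rewrite ltr_wpDr// mulr_ge0// ltW.
have q0 : 0 < 1 + a * k0%:R by rewrite ltr_wpDr// mulr_ge0// ltW.
move=> /(ler_wpM2l C'0) h; apply: (le_trans h); rewrite ler_pdivrMr//.
move: k0r; set K := k0%:R; rewrite mulrDr mulr1 => h1.
apply: (le_trans h1); have -> : K * (e * a) = e * (a * K) by ring.
by rewrite lerDr ltW.
Qed.

End BowenUpper.

Section BowenUpper.
Context {R : realType} {d : measure_display} {X : measurableType d}.
Context (dist : X -> X -> R) (Hm : is_metric dist) (Hb : borel_for_dist dist).
Context (Hc : dcompact dist) (f : X -> X) (Hf : dcontinuous_map dist f).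
Let mf := measurable_dcontinuous_map Hb Hf.

(** Cylinder sets are not seen by weak* limits. Closed cores of them are, through Urysohn functions,
    and around each core the name is forced, at the price of the loss [ka] of frequency. *)
Lemma open_names (T : finType) (cen : T -> X) (c : X -> T) (eps : R) (P : probability X R)
    M (ka : R) x : 0 < eps -> mfib c -> (forall y, dist y (cen (c y)) < eps / 4) ->
  0 < ka -> Vlim dist f x P -> exists nm : X -> {ffun 'I_M -> T},
  (forall y, named dist f cen eps (nm y) y) /\
  forall N, exists2 n, (N <= n)%N & forall w,
    n%:R * (law P (cyl f c M) w - ka) <= \sum_(t < n) (nm (iter t f x) == w)%:R.
Proof.
move=> e0 mc hcen ka0 VP.
pose W := {ffun 'I_M -> T}.
have mC : mfib (cyl f c M) by exact: mfib_cyl.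
have ka2 : 0 < ka / 2 by lra.
have /choice[K hK] : forall w : W, exists K, [/\ dclosed dist K,
    K `<=` cyl f c M @^-1` [set w] & law P (cyl f c M) w - ka / 2 <= pr P K].
  move=> w; have [F [G [cF oG Fw wG h]]] := probability_regular Hm Hb P (mC w) ka2.
  exists F; split => //.
  have mF := measurable_dclosed Hb cF; have mG := measurable_dopen Hb oG.
  rewrite prD// in h; last exact: subset_trans wG.
  by have := le_pr P (mC w) mG wG; rewrite /law; lra.
have e4 : 0 < eps / 4 by lra.
have [eta0 eta00 heta0] := uniform_iter Hm Hc M Hf e4.
have /choice[rr hrr] : forall ww : W * W, exists r : R, 0 < r /\
    (ww.1 != ww.2 -> forall a b, K ww.1 a -> K ww.2 b -> r <= dist a b).
  move=> [w w'] /=; have [->|ww] := eqVneq w w'; first by exists 1.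
  have [r r0 hr] : exists2 r : R, 0 < r & forall a b, K w a -> K w' b -> r <= dist a b.
    have [c1 s1 _] := hK w; have [c2 s2 _] := hK w'.
    apply: (dclosed_separated Hm Hc c1 c2); rewrite -subset0 => y [/s1 /= E1 /s2 /= E2].
    by rewrite -E1 -E2 eqxx in ww.
  by exists r.
pose r := \big[Num.min/(1 : R)]_ww rr ww.
have r0 : 0 < r.
  by rewrite /r; elim/big_ind: _ => // [y z y0 z0|i _]; [rewrite lt_min y0|case: (hrr i)].
have hr w w' a b : w != w' -> K w a -> K w' b -> r <= dist a b.
  move=> ww Ka Kb; have [_ h] := hrr (w, w'); apply: le_trans (h ww a b Ka Kb).
  exact: bigmin_le_cond.
pose eta := Num.min eta0 (r / 2).
have etap : 0 < eta by rewrite lt_min eta00/= divr_gt0.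
have eta1 : eta <= eta0 by rewrite ge_min lexx.
have eta2 : eta <= r / 2 by rewrite ge_min lexx orbT.
have /choice[g hg] := fun w => urysohn Hm (K w) etap.
(* As [2 * eta <= r], at most one core comes within [eta] of [y]; away from all cores the own
   itinerary of [y] is used. *)
have /choice[nm hnm] : forall y, exists w : W, named dist f cen eps w y /\
    forall w', 0 < g w' y -> w = w'.
  move=> y; have [[w gw]|hn] := pselect (exists w, 0 < g w y).
    have [_ _ _ gp] := hg w; have [a Ka ay] := gp y gw.
    exists w; split.
      move=> i; have [_ sK _] := hK w; have /= <- := sK a Ka; rewrite ffunE.
      have h1 := hcen (iter i f a).
      have h2 := heta0 _ _ (lt_le_trans ay eta1) i (ltnW (ltn_ord i)).
      have := dist_triangle Hm (iter i f a) (iter i f y) (cen (c (iter i f a))).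
      by rewrite (distC Hm (iter i f y) (iter i f a)); lra.
    move=> w' gw'; have [_ _ _ gp'] := hg w'; have [b Kb yb] := gp' y gw'.
    apply/eqP; apply: contrapT => /negP ww.
    have := hr w w' a b ww Ka Kb; have := dist_triangle Hm y a b.
    by rewrite (distC Hm y b); lra.
  exists (cyl f c M y); split; last by move=> w' gw'; exfalso; apply: hn; exists w'.
  by move=> i; rewrite ffunE; have := hcen (iter i f y); lra.
exists nm; split; first by move=> y; case: (hnm y).
move=> N.
have bd : basic_data dist (fun i : 'I_#|W| => g (enum_val i)) (ka / 2).
  by split => // i; case: (hg (enum_val i)).
have [n Nn hn] := VP _ _ _ bd (maxn N 1).
have n0 : (0 < n)%N by apply: leq_trans Nn; rewrite leq_max orbT.
exists n; first by apply: leq_trans Nn; rewrite leq_maxl.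
move=> w.
have [gc g01 gK gp] := hg w; have [cK sK prK] := hK w.
have mK := measurable_dclosed Hb cK.
have h1 : pr P (K w) <= Pint P (g w).
  rewrite -Pint_indic//; apply: Pint_le; first exact: bmeas_indic.
    exact: (bmeas_dcontinuous Hm Hb Hc gc).
  move=> y; rewrite indicE; case: (boolP (y \in K w)); rewrite ?inE/=.
    by move=> /gK ->.
  by case/andP: (g01 y).
have h2 : emp_int f x n (g w) <= n%:R^-1 * \sum_(t < n) (nm (iter t f x) == w)%:R.
  rewrite /emp_int ler_wpM2l ?invr_ge0//; apply: ler_sum => t _.
  have [_ hw] := hnm (iter t f x); have /andP[ge0 le1] := g01 (iter t f x).
  by case: eqP => // nw; rewrite leNgt; apply/negP => /hw.
have := hn (enum_rank w); rewrite enum_rankK ltr_norml => /andP[h3 h4].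
rewrite -ler_pdivlMl ?ltr0n//; apply: le_trans h2; lra.
Qed.

Lemma min_le_average M (F : 'I_M -> R) (B : R) : (0 < M)%N ->
  \sum_i F i <= M%:R * B -> exists i, F i <= B.
Proof.
move=> M0 h; apply: contrapT => hn; move: h; apply/negP; rewrite -ltNge.
rewrite -[M in ltLHS]card_ord mulr_natl -sumr_const; apply: ltr_sum => [|i _].
  by apply/hasP; exists (Ordinal M0).
by rewrite ltNge; apply/negP => h; apply: hn; exists i.
Qed.

(** Along the times given by [open_names], the average cost of the names is close to their mean cost
    under [P], which is close to the entropy. *)
Lemma Zcost_member (T : finType) (cen : T -> X) (c : X -> T) (eps t de : R) D
    (P : probability X R) M x :
  0 < eps -> mfib c -> (forall y, dist y (cen (c y)) < eps / 4) ->
  0 <= t -> 0 < de -> (0 < D)%N -> 1 <= D%:R * de -> (0 < M)%N -> Vlim dist f x P ->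
  Hcode P (cyl f c M) <= M%:R * (t + de) ->
  exists la : {ffun {ffun 'I_M -> T} -> nat},
    Zcost dist f cen eps D%:R (t + 7 / 2 * de) la x.
Proof.
move=> e0 mc hcen t0 de0 D0 Dde M0 VP HP.
have D0r : (0 : R) < D%:R by rewrite ltr0n.
have D1 : (1 : R) <= D%:R by rewrite ler1n.
have M1 : (1 : R) <= M%:R by rewrite ler1n.
have mC : mfib (cyl f c M) by exact: mfib_cyl.
pose W := {ffun 'I_M -> T}; pose p (w : W) := law P (cyl f c M) w.
have [la0 [kr hla]] := cost_of_law D0r de0 (fun w => law_ge0 P (cyl f c M) w) (law_sum P mC).
pose la : {ffun W -> nat} := [ffun w => la0 w].
exists la.
have laE w : la w = la0 w by rewrite ffunE.
(* One [de] for the entropy at length [M], one for the mixing in [cost_of_law], one for the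
   rounding. The frequency errors below add [de / 4], the last incomplete block another [de / 4]. *)
have cost1 : \sum_w p w * (la w)%:R <= D%:R * M%:R * (t + 3 * de).
  under eq_bigr do rewrite laE.
  apply: (le_trans hla).
  apply: (@le_trans _ _ (D%:R * (M%:R * (t + de) + de) + D%:R * de)).
    by rewrite lerD// ler_pM2l// lerD2r.
  rewrite -mulrDr -mulrA ler_pM2l//.
  have : de <= M%:R * de by rewrite ler_peMl// ltW.
  by rewrite !mulrDr; lra.
pose La := (\sum_w la w)%N.
pose ka := de / (4 * (#|W|%:R * La%:R + 1)).
have q0 : (0 : R) < 4 * (#|W|%:R * La%:R + 1) by rewrite mulr_gt0// ltr_wpDl// mulr_ge0.
have ka0 : 0 < ka by rewrite divr_gt0.
have hka : #|W|%:R * ka * La%:R <= de / 4.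
  have : ka * (4 * (#|W|%:R * La%:R + 1)) = de by rewrite /ka divfK// gt_eqF.
  move: ka0; set w := #|W|%:R; set l := La%:R => h h2; nra.
have [nm [hname hfreq]] := open_names M e0 mc hcen ka0 VP.
pose G (s : nat) : R := (la (nm (iter s f x)))%:R.
have avg n : (forall w, n%:R * (p w - ka) <= \sum_(s < n) (nm (iter s f x) == w)%:R) ->
    \sum_(s < n) G s <= n%:R * (D%:R * M%:R * (t + 13 / 4 * de)).
  move=> hn.
  pose cnt w : R := \sum_(s < n) (nm (iter s f x) == w)%:R.
  have cntsum : \sum_w cnt w = n%:R.
    rewrite exchange_big/= -[X in _ = X%:R]card_ord -sumr_const; apply: eq_bigr => s _.
    rewrite (bigD1 (nm (iter s f x)))//= eqxx big1 ?addr0// => w; rewrite eq_sym.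
    by move/negbTE => ->.
  (* The counts sum to [n], so lower bounds for the other words give an upper bound for this one. *)
  have cntle w : cnt w <= n%:R * (p w + #|W|%:R * ka).
    have : \sum_(w' | w' != w) n%:R * (p w' - ka) <= \sum_(w' | w' != w) cnt w'.
      by apply: ler_sum => w' _; exact: hn.
    have E1 : \sum_(w' | w' != w) cnt w' = n%:R - cnt w.
      by rewrite -cntsum [in RHS](bigD1 w)//= addrAC subrr add0r.
    have E2 : \sum_(w' | w' != w) p w' = 1 - p w.
      by rewrite -(law_sum P mC) [in RHS](bigD1 w)//= addrAC /p subrr add0r.
    rewrite E1 -mulr_sumr sumrB E2 => h.
    have h2 : \sum_(w' | w' != w) ka <= #|W|%:R * ka.
      rewrite mulr_natl -sumr_const [leRHS](bigD1 w)//= lerDr; exact: ltW.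
    have : n%:R * \sum_(w' | w' != w) ka <= n%:R * (#|W|%:R * ka) by rewrite ler_wpM2l.
    move: h; rewrite !mulrBr !mulrDr mulr1; lra.
  have -> : \sum_(s < n) G s = \sum_w (la w)%:R * cnt w.
    under [RHS]eq_bigr do rewrite mulr_sumr.
    rewrite exchange_big/=; apply: eq_bigr => s _.
    rewrite (bigD1 (nm (iter s f x)))//= eqxx mulr1 big1 ?addr0// => w; rewrite eq_sym.
    by move/negbTE => ->; rewrite mulr0.
  apply: (@le_trans _ _ (\sum_w (n%:R * (p w * (la w)%:R) + n%:R * (#|W|%:R * ka) * (la w)%:R))).
    apply: ler_sum => w _; rewrite mulrC.
    apply: (le_trans (ler_wpM2r _ (cntle w))) => //.
    by rewrite mulrDr mulrDl !mulrA.
  rewrite big_split/= -mulr_sumr -mulr_sumr -natr_sum -/La -mulrA -mulrDr ler_wpM2l//.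
  apply: (le_trans (lerD cost1 hka)).
  have : de / 4 <= D%:R * M%:R * (de / 4).
    by rewrite ler_peMl ?mulr_ege1// divr_ge0// ltW.
  by set v := D%:R * M%:R; lra.
split => //.
  by under eq_bigr do rewrite laE.
move=> k0.
pose k1 := (maxn k0 (Num.truncn (4 * (t + 13 / 4 * de) / de)).+1).
have [n nN hn] := hfreq (k1 * M)%N.
pose k := (n %/ M)%N; exists k; split.
  by rewrite /k leq_divRL// (leq_trans _ nN)// leq_mul2r leq_maxl orbT.
have kbig : 4 * (t + 13 / 4 * de) / de <= k%:R.
  apply: (le_trans (ltW (truncnS_gt _))); rewrite ler_nat /k leq_divRL//.
  by rewrite (leq_trans _ nN)// leq_mul2r leq_maxr orbT.
have tot : \sum_(s < k * M) G s <= M%:R * (D%:R * ((k * M)%:R * (t + 7 / 2 * de))).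
  apply: (@le_trans _ _ (\sum_(s < n) G s)).
    have -> : \sum_(s < n) G s = \sum_(s < k * M + n %% M) G s by rewrite /k -divn_eq.
    by rewrite big_split_ord/= lerDl sumr_ge0.
  apply: (le_trans (avg n hn)).
  have nle : n%:R <= (k%:R + 1) * M%:R :> R.
    rewrite natr1 -natrM ler_nat (leq_trans (ltnW (ltn_ceil n M0)))//.
  have a0 : 0 <= D%:R * M%:R * (t + 13 / 4 * de).
    by rewrite !mulr_ge0//; lra.
  apply: (le_trans (ler_wpM2r a0 nle)).
  have -> : M%:R * (D%:R * ((k * M)%:R * (t + 7 / 2 * de))) =
      M%:R * (D%:R * M%:R) * (k%:R * (t + 7 / 2 * de)) by rewrite natrM; ring.
  have -> : (k%:R + 1) * M%:R * (D%:R * M%:R * (t + 13 / 4 * de)) =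
      M%:R * (D%:R * M%:R) * ((k%:R + 1) * (t + 13 / 4 * de)) by ring.
  rewrite ler_wpM2l ?mulr_ge0//.
  move: kbig; rewrite ler_pdivrMr//; set K := k%:R => hk.
  rewrite mulrDl mul1r; lra.
(* The starting times are sorted by their residue modulo [M]; the cheapest residue costs at most the
   mean. *)
have [q hq] : exists q : 'I_M, \sum_(j < k) G (j * M + q)%N <=
    D%:R * ((k * M)%:R * (t + 7 / 2 * de)).
  apply: min_le_average => //; rewrite exchange_big/= -sum_blocks.
  exact: tot.
exists q, (nm x), [ffun j : 'I_k => nm (iter (j * M + q) f x)]; split.
- exact: hname.
- by move=> j; rewrite ffunE; exact: hname.
- apply: le_trans hq; rewrite natr_sum; apply: ler_sum => j _.
  by rewrite [X in la X]ffunE.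
Qed.

(** At each scale one partition of small mesh serves all the limit measures, so only the block
    length and the cost function vary with the point. *)
Lemma bowen_upper (t : R) : 0 <= t ->
  (hBowen dist f [set x | exists nu, Vlim dist f x nu /\ (ks_entropy f nu <= t%:E)%E]
   <= t%:E)%E.
Proof.
move=> t0; apply: hBowen_le => eps s e0 ts N.
(* Makes the cost rate [t + 7 / 2 * de] smaller than [s]. *)
pose de := (s - t) / 4.
have de0 : 0 < de by rewrite /de; lra.
have e4 : 0 < eps / 4 by lra.
have [T [c0 [mc0 hc0]]] := small_code Hm Hb Hc e4.
pose Q := [seq c0 @^-1` [set v] | v <- enum T].
have szQ : size Q = #|T| by rewrite size_map -cardE.
have nthQ v : nth set0 Q (enum_rank v) = c0 @^-1` [set v].
  by rewrite (nth_map v) ?nth_enum_rank// -cardE ltn_ord.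
have QP i : (i < size Q)%N -> exists v : T, i = enum_rank v.
  by rewrite szQ => iT; exists (enum_val (Ordinal iT)); rewrite enum_valK.
have fQ : fpartition Q.
  split; [|split].
  - by move=> i /QP[v ->]; rewrite nthQ.
  - move=> i j /QP[v ->] /QP[v' ->] vv; rewrite !nthQ -subset0 => x [/= E1 E2].
    by apply: vv; rewrite -E1 -E2.
  - by move=> x; exists (enum_rank (c0 x)); rewrite ?nthQ// szQ ltn_ord.
have [c [mc cE]] := fpartition_code fQ.
have hc x y : c x = c y -> dist x y < eps / 4.
  move=> cxy; apply: hc0; have [v hv] := QP _ (ltn_ord (c x)).
  have h1 : nth set0 Q (c x) x by apply/cE.
  have h2 : nth set0 Q (c x) y by rewrite cxy; apply/cE.
  by move: h1 h2; rewrite hv nthQ /= => -> ->.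
have /choice[cen hcen] : forall v, exists z, forall y, c y = v -> dist y z < eps / 4.
  move=> v; have [[z cz]|hn] := pselect (exists z, c z = v).
    by exists z => y cy; apply: hc; rewrite cy.
  by exists point => y cy; exfalso; apply: hn; exists y.
pose D := (Num.truncn de^-1).+1.
have Dde : 1 <= D%:R * de.
  by rewrite -ler_pdivrMr// mul1r; exact: ltW (truncnS_gt _).
(* Costs are integers precisely to make this index type countable. *)
pose I := {M : nat & {ffun {ffun 'I_M -> 'I_(size Q)} -> nat}}.
pose Zi (i : I) := Zcost dist f cen eps D%:R (t + 7 / 2 * de) (tagged i).
apply/eqP; rewrite eq_le mB_ge0 andbT.
apply: (@le_trans _ _ (mB dist f (\bigcup_i Zi i) s N eps)); last first.
  rewrite mB_bigcup0// => i; apply: Zcost_null => //; rewrite ?ltr0n//.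
  by rewrite /de; lra.
apply: mB_sub => x [nu [Vnu ks]].
have nuf := Vlim_invariant Hm Hb Hc Hf Vnu.
have [c' [_ cE' _ hM]] := h_part_code mf nuf fQ.
have cc : c' = c by apply/funext => y; apply/cE'/cE.
have hQt : h_part f nu Q <= t.
  rewrite -lee_fin; apply: le_trans ks; apply: ereal_sup_ubound; by exists Q.
have [M M0 HM] := hM de de0.
have HM' : Hcode nu (cyl f c M) <= M%:R * (t + de).
  rewrite -ler_pdivrMl ?ltr0n// mulrC -cc; apply: ltW; apply: (lt_le_trans HM); lra.
have [la hla] := @Zcost_member _ cen c eps t de D nu M x e0 mc
  (fun y => hcen _ y erefl) t0 de0 isT Dde M0 Vnu HM'.
by exists (existT _ M la).
Qed.

End BowenUpper.

(** * Points with a prescribed limit measure *)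

Section Stage.
Context {R : realType} {d : measure_display} {X : measurableType d}.
Context (dist : X -> X -> R) (Hm : is_metric dist) (Hb : borel_for_dist dist).
Context (Hc : dcompact dist) (f : X -> X) (Hf : dcontinuous_map dist f).
Let mf := measurable_dcontinuous_map Hb Hf.
Context (Y : set X) (cY : dclosed dist Y) (fY : forall x, Y x -> Y (f x)).
Context (z : X) (Yz : Y z).
Context (hlink : chain_linked dist f Y) (htr : chain_traced dist f Y).
Context (P : probability X R) (Pf : Defs.invariant f P) (PY : P Y = 1%E).
Let mY := measurable_dclosed Hb cY.

(* Data of a construction stage: chains are [st_del]-chains, [st_link] joins a
   point of Y to z in at most [st_M] steps, the [st_N] loops [st_sg] at z have
   length [st_l], and [st_tr] gives a point of Y tracing a chain. *)
Record stage := Stage {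
  st_del : R; st_M : nat; st_l : nat; st_N : nat;
  st_sg : nat -> seq X; st_link : X -> seq X; st_tr : seq X -> X }.

(** As in [loop], the final [z] is omitted, so that a loop can be appended directly. *)
Definition chain (del : R) (s : seq X) := exists u s',
  [/\ s = u :: s', Y u & path (pstep dist f del) u (rcons s' z)].

(** Two precisions vary with the stage, [eps] for tracing and [k.+1%:R^-1] for averages; the
    separation [sp] and the rate [s] do not. In the tracing clause the index [size c] is allowed and
    reads the default [z], the omitted end of the chain. *)
Definition stage_ok (sp eps s : R) k (S : stage) :=
  [/\ (0 < st_l S)%N /\ (0 < st_N S)%N, expR ((st_l S)%:R * s) <= (st_N S)%:R,
   forall u, Y u -> (size (st_link S u) <= st_M S)%N /\
     path (pstep dist f (st_del S)) u (rcons (st_link S u) z),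
   forall c, chain (st_del S) c -> Y (st_tr S (rcons c z)) /\
     forall i, (i <= size c)%N -> dist (iter i f (st_tr S (rcons c z))) (nth z c i) < eps &
   [/\ forall y : X, dist y y <= st_del S,
    forall a, size (st_sg S a) = st_l S /\ loop (pstep dist f (st_del S)) z (st_sg S a),
    forall a b, (a < st_N S)%N -> (b < st_N S)%N -> a <> b -> exists t,
      (t < st_l S)%N /\ sp <= dist (nth z (st_sg S a) t) (nth z (st_sg S b) t) &
    forall a g B eta, dcontinuous_fun dist g -> (forall x, `|g x| <= B) ->
      (forall x y, dist x y < k.+1%:R^-1 -> `|g x - g y| <= eta) ->
      `|\sum_(y <- st_sg S a) (g y - Pint P g)| <= (st_l S)%:R * (2 * eta + B * k.+1%:R^-1)]].

(** The separation [sp] is the distance between closed cores of the atoms of [Q], so it is fixed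
    before the precisions are chosen. *)
Lemma stage_exists (Q : seq (set X)) (s : R) : fpartition Q -> s < h_part f P Q ->
  exists sp : R, 0 < sp /\ forall (eps : R) k, 0 < eps -> exists S, stage_ok sp eps s k S.
Proof.
move=> fQ sh; have [c [mc cE hc _]] := h_part_code mf Pf fQ.
set h := h_part f P Q in sh hc.
pose rho := (h - s) / 2.
have r0 : 0 < rho by rewrite /rho; lra.
have [ka ka0 hka] := hamming_ball_expR 'I_(size Q) r0.
pose m : R := (size Q)%:R.
have m0 : 0 <= m by [].
(* With at most [k1] lost per atom, the set outside the cores has measure at most [ka / 4], as
   [superblocks] requires. *)
pose k1 := ka / 4 / (m + 1).
have k10 : 0 < k1 by rewrite !divr_gt0// ltr_wpDl.
have /choice[F hF] : forall v, exists F, [/\ dclosed dist F, F `<=` c @^-1` [set v] &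
    pr P (c @^-1` [set v] `\` F) <= k1].
  move=> v; have [F [G [cF oG Fw wG h1]]] := probability_regular Hm Hb P (mc v) k10.
  exists F; split => //; apply: le_trans (ltW h1).
  have mF := measurable_dclosed Hb cF; have mG := measurable_dopen Hb oG.
  by apply: le_pr; [exact: measurableD|exact: measurableD|exact: setSD].
have mF v : measurable (F v) by have [cF _ _] := hF v; exact: (measurable_dclosed Hb cF).
have /choice[rr hrr] : forall vv : 'I_(size Q) * 'I_(size Q), exists r : R, 0 < r /\
    (vv.1 != vv.2 -> forall a b, F vv.1 a -> F vv.2 b -> r <= dist a b).
  move=> [v v'] /=; have [->|vv] := eqVneq v v'; first by exists 1.
  have [r r1 hr] : exists2 r : R, 0 < r & forall a b, F v a -> F v' b -> r <= dist a b.
    have [c1 s1 _] := hF v; have [c2 s2 _] := hF v'.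
    apply: (dclosed_separated Hm Hc c1 c2); rewrite -subset0 => y [/s1 /= E1 /s2 /= E2].
    by rewrite -E1 -E2 eqxx in vv.
  by exists r.
pose sp := \big[Num.min/(1 : R)]_vv rr vv.
have sp0 : 0 < sp.
  by rewrite /sp; elim/big_ind: _ => // [y y' y0 y0'|i _]; [rewrite lt_min y0|case: (hrr i)].
have hsp v v' a b : v != v' -> F v a -> F v' b -> sp <= dist a b.
  move=> vv Fa Fb; have [_ h1] := hrr (v, v'); apply: le_trans (h1 vv a b Fa Fb).
  exact: bigmin_le_cond.
pose cG x := `[< F (c x) x >].
have cGE : [set x | cG x] = \bigcup_v F v.
  apply/seteqP; split=> x /=; first by move=> /asboolP Fx; exists (c x).
  by move=> [v _ Fv]; apply/asboolP; have [_ /(_ x Fv) /= -> _] := hF v.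
have mGt : measurable [set x | cG x] by rewrite cGE; exact: fin_bigcup_measurable.
have mG : mfib cG.
  case; first by congr (measurable _): mGt; apply/seteqP; split.
  have := measurableC mGt; congr (measurable _); apply/seteqP; split=> x /=.
    by move/negP/negbTE.
  by move=> ->.
have bad : law P cG false <= ka / 4.
  have -> : law P cG false = pr P (\big[setU/set0]_(v <- enum 'I_(size Q))
      (c @^-1` [set v] `\` F v)).
    congr pr; rewrite -bigcup_seq; apply/seteqP; split=> x /=.
      move=> /asboolPn nF; exists (c x); first by rewrite /= mem_enum.
      by split.
    move=> [v _ [/= cv nF]]; apply/asboolPn; by rewrite cv.
  apply: le_trans (le_pr_bigU _ _ _) _; first by move=> v; exact: measurableD.
  apply: (@le_trans _ _ (\sum_(v <- enum 'I_(size Q)) k1)).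
    by apply: ler_sum => v _; have [] := hF v.
  rewrite big_enum/= sumr_const card_ord -[leLHS]mulr_natl -/m /k1 mulrA.
  rewrite ler_pdivrMr ?ltr_wpDl// mulrC ler_wpM2l ?divr_ge0 ?ltW//; lra.
exists sp; split => // eps k eps0.
have [del del0 hdel] := htr eps0.
have hd y : dist y y <= del by rewrite (distxx Hm) ltW.
have [M hM] := hlink del0.
have kr0 : (0 : R) < k.+1%:R^-1 by rewrite invr_gt0.
have [T [cT [mT hT]]] := small_code Hm Hb Hc kr0.
pose th : R := k.+1%:R^-1 / (#|T|%:R + 1).
have T0 : (0 : R) < #|T|%:R + 1 by rewrite ltr_wpDl.
have th0 : 0 < th by rewrite divr_gt0.
have s2 : s + 2 * rho <= h by rewrite /rho; lra.
have [l [N [sg [l0 lN hsg hsep hfreq]]]] := @superblocks _ _ _ dist f mf P Pf Y mY PY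
  fY z Yz del hd M hM _ _ c cT cG mc mT mG rho ka r0 ka0 hka h s th s2 hc bad th0.
have N0 : (0 < N)%N by rewrite -(ltr0n R); apply: lt_le_trans lN; exact: expR_gt0.
pose sgn a := sg (insubd (Ordinal N0) a).
have /choice[link hl] : forall u, exists l, Y u -> (size l <= M)%N /\
    path (pstep dist f del) u (rcons l z).
  move=> u; have [Yu|nY] := pselect (Y u); last by exists [::].
  by have [l' h'] := hM u z Yu Yz; exists l'.
have /choice[tr ht] : forall c', exists y, forall c, c' = rcons c z -> chain del c -> Y y /\
    forall i, (i <= size c)%N -> dist (iter i f y) (nth z c i) < eps.
  move=> c'; have [[c2 [E [u [s' [E2 Yu ps]]]]]|hn] :=
    pselect (exists c2, c' = rcons c2 z /\ chain del c2); last first.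
    by exists z => c2 E ch; exfalso; apply: hn; exists c2.
  have [y Yy hy] := hdel u (rcons s' z) ps Yu ltac:(by rewrite last_rcons).
  exists y => c3 E3 _; split => // i il.
  have c23 : c3 = c2 by move: E; rewrite E3 => /rcons_inj[].
  rewrite c23 E2 in il *; have := hy i; rewrite size_rcons => /(_ il).
  rewrite -rcons_cons nth_rcons; case: ltnP => il2; first by rewrite (set_nth_default z).
  have -> : (i == size (u :: s'))%N by rewrite eqn_leq il il2.
  by rewrite (@nth_default _ z)// ; move: il2.
exists (Stage del M l N sgn link tr); split => //=.
  by move=> c' ch; exact: ht.
split => //.
- by move=> a; exact: hsg.
- move=> a b aN bN ab.
  have sab : insubd (Ordinal N0) a != insubd (Ordinal N0) b.
    by apply/eqP => /(congr1 val); rewrite !val_insubd aN bN.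
  have [t [t1 t2 /and3P[/asboolP F1 /asboolP F2 cc]]] := hsep _ _ sab; exists t.
  have [sz _] := hsg (insubd (Ordinal N0) a); rewrite -sz; split => //.
  exact: hsp cc F1 F2.
- move=> a g B eta gc gB geta; have [sz _] := hsg (insubd (Ordinal N0) a).
  have B0 : 0 <= B by exact: le_trans (gB z).
  have gT x y : cT x = cT y -> `|g x - g y| <= eta by move=> xy; apply: geta; exact: hT.
  have hfr t : `|(count (fun y => cT y == t) (sgn a))%:R - (size (sgn a))%:R * law P cT t|
      <= th * (size (sgn a))%:R by rewrite sz; exact: hfreq.
  apply: le_trans (code_average Hm Hb Hc mT gc gB gT hfr) _.
  rewrite sz ler_wpM2l// lerD2l -mulrA ler_wpM2l// /th mulrAC ler_pdivrMr//.
  by rewrite ler_pM2l// lerDl.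
Qed.

End Stage.

(** * Timing of the changes of stage *)

Section LevelSchedule.
Variables (D : nat -> nat).

Definition level_cost k := (\sum_(j < k.+1) D j)%N.

(* Move to stage [k.+1] only once the step number dwarfs its length. *)
Fixpoint level i := if i is i'.+1 then
  let k := level i' in if (k.+1 * level_cost k.+1 <= i'.+1)%N then k.+1 else k else 0%N.

Lemma level_step i : level i.+1 = level i \/ level i.+1 = (level i).+1.
Proof. by rewrite /=; case: ifP; [right|left]. Qed.

Lemma level_homo : {homo level : i j / (i <= j)%N}.
Proof.
apply: homo_leq => // [j i k|i]; first exact: leq_trans.
by case: (level_step i) => ->.
Qed.

Lemma level_cost_homo : {homo level_cost : i j / (i <= j)%N}.
Proof.
apply: homo_leq => // [j i k|i]; first exact: leq_trans.
by rewrite /level_cost [leqRHS]big_ord_recr leq_addr.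
Qed.

Lemma level_mul_cost i : (level i * level_cost (level i) <= i)%N.
Proof.
elim: i => //= i IH; case: ifP => // _; exact: leq_trans IH _.
Qed.

Lemma level_unbounded k : exists i, (k <= level i)%N.
Proof.
elim: k => [|k [i ki]]; first by exists 0%N.
set j := maxn i (k.+1 * level_cost k.+1).
have kj : (k <= level j)%N by apply: leq_trans ki (level_homo _); rewrite leq_maxl.
move: kj; rewrite leq_eqVlt => /predU1P[kj|]; last by exists j.
exists j.+1; rewrite /= -kj ifT//; apply: leq_trans (leqnSn _); exact: leq_maxr.
Qed.

(** From level [K >= eta^-1] on, the cost is at most [i / K]; the lower levels go into the
    constant. *)
Lemma level_cost_sublinear {R : realType} (eta : R) : 0 < eta ->
  exists2 C : R, 0 <= C & forall i, (level_cost (level i))%:R <= eta * i%:R + C.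
Proof.
move=> eta0; have [K hK] : exists K : nat, eta^-1 <= K%:R.
  by exists (Num.truncn eta^-1).+1; rewrite ltW// truncnS_gt.
exists (level_cost K)%:R => // i; have [Ki|iK] := leqP K (level i); last first.
  apply: (@le_trans _ _ (level_cost K)%:R); first by rewrite ler_nat level_cost_homo// ltnW.
  by rewrite lerDr mulr_ge0// ltW.
apply: (@le_trans _ _ (eta * i%:R)); last by rewrite lerDl.
rewrite -ler_pdivrMl//; apply: (@le_trans _ _ (K%:R * (level_cost (level i))%:R)).
  by rewrite ler_wpM2r.
rewrite -natrM ler_nat; apply: leq_trans (level_mul_cost i); exact: leq_mul.
Qed.

End LevelSchedule.

(** * The tree of orbits: entropy and averages *)

Section Saturation.
Context {R : realType} {d : measure_display} {X : measurableType d}.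
Context (dist : X -> X -> R) (Hm : is_metric dist) (Hb : borel_for_dist dist).
Context (Hc : dcompact dist) (f : X -> X) (Hf : dcontinuous_map dist f).
Context (Y : set X) (z : X) (Yz : Y z) (fY : forall x, Y x -> Y (f x)).
Context (P : probability X R).
Context (e0 sp s : R) (e00 : 0 < e0) (spE : sp = 4 * e0).
Let err k : R := e0 / 2 ^+ k.
Context (St : nat -> @stage R d X).
Context (hSt : forall k, stage_ok dist f Y z P sp (err k - err k.+1) s k (St k)).

Let D k := (st_M (St k) + 1 + st_l (St k))%N.
Let lv := level D.
Let len i := st_l (St (lv i)).

Definition seg (a : nat -> nat) i := st_sg (St (lv i)) (a i).

(* A code [a] selects loops; while the stage is constant they are concatenated,
   and at a change of stage the chain built so far is replaced by the true orbit
   of a point tracing it, which is a chain for every [del]. *)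
Fixpoint pre (a : nat -> nat) i : seq X := if i is i'.+1 then
  let c := pre a i' ++ seg a i' in
  if lv i'.+1 == lv i' then c else
  let y := st_tr (St (lv i')) (rcons c z) in
  traject f y (size c).+1 ++ st_link (St (lv i'.+1)) (iter (size c) f y)
else [::].

Definition porb a i := pre a i ++ seg a i.
Definition tr a i := st_tr (St (lv i)) (rcons (porb a i) z).

Lemma preS a i : pre a i.+1 = if lv i.+1 == lv i then porb a i else
  traject f (tr a i) (size (porb a i)).+1 ++
    st_link (St (lv i.+1)) (iter (size (porb a i)) f (tr a i)).
Proof. by []. Qed.

Lemma pre_eq a b i : (forall j, (j < i)%N -> a j = b j) -> pre a i = pre b i.
Proof.
elim: i => // i IH ab; rewrite !preS /tr /porb IH; last by move=> j ji; exact: ab (leqW ji).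
by rewrite /seg ab.
Qed.

Lemma chain_loop del t : loop (pstep dist f del) z t -> chain dist f Y z del t.
Proof. by move=> [t' [-> p]]; exists z, t'. Qed.

Lemma chain_cat del c t : chain dist f Y z del c -> loop (pstep dist f del) z t ->
  chain dist f Y z del (c ++ t).
Proof.
move=> [u [c' [-> Yu p1]]] [t' [-> p2]]; exists u, (c' ++ z :: t'); split => //.
by rewrite rcons_cat rcons_cons -cat_rcons cat_path p1 last_rcons.
Qed.

Lemma iter_closed n y : Y y -> Y (iter n f y).
Proof. by move=> Yy; elim: n => //= n; exact: fY. Qed.

Lemma chain_orbit_link del y n l : (forall y : X, dist y y <= del) -> Y y ->
  path (pstep dist f del) (iter n f y) (rcons l z) ->
  chain dist f Y z del (traject f y n.+1 ++ l).
Proof.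
move=> hd Yy p; exists y, (traject f (f y) n ++ l); split => //.
by rewrite rcons_cat cat_path traject_path//= last_traject.
Qed.

Lemma porb_chain a i : chain dist f Y z (st_del (St (lv i))) (porb a i).
Proof.
have hl j : loop (pstep dist f (st_del (St (lv j)))) z (seg a j).
  by have [_ _ _ _ [_ h _ _]] := hSt (lv j); have [] := h (a j).
elim: i => [|i IH]; first exact: chain_loop (hl 0%N).
apply: chain_cat (hl _); rewrite preS; case: eqP => [->//|_].
have [_ _ _ htr _] := hSt (lv i); have [Yt _] := htr _ IH.
have [_ _ hlk _ [hd _ _ _]] := hSt (lv i.+1).
apply: (chain_orbit_link hd Yt).
by have [] := hlk _ (iter_closed (size (porb a i)) Yt).
Qed.

Lemma tr_spec a i : Y (tr a i) /\ forall t, (t <= size (porb a i))%N ->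
  dist (iter t f (tr a i)) (nth z (porb a i) t) < err (lv i) - err (lv i).+1.
Proof. by have [_ _ _ htr _] := hSt (lv i); exact: htr (porb_chain a i). Qed.

Lemma size_seg a i : size (seg a i) = len i.
Proof. by have [_ _ _ _ [_ h _ _]] := hSt (lv i); have [] := h (a i). Qed.

Lemma size_porb a i : size (porb a i) = (size (pre a i) + len i)%N.
Proof. by rewrite size_cat size_seg. Qed.

(** A change of stage adds the end point of the re-traced orbit and a link, at most [st_M.+1]
    points. Partial sums stand on both sides so that the estimate telescopes. *)
Lemma size_preS a i : (size (porb a i) <= size (pre a i.+1))%N /\
  (size (pre a i.+1) + \sum_(k < (lv i).+1) (st_M (St k)).+1 <=
   size (porb a i) + \sum_(k < (lv i.+1).+1) (st_M (St k)).+1)%N.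
Proof.
rewrite preS; case: eqP => [->//|/eqP ne].
have lvE : lv i.+1 = (lv i).+1.
  by case: (level_step D i) => // E; move: ne; rewrite /lv E eqxx.
rewrite size_cat size_traject; split; first by rewrite addSn ltnW// ltnS leq_addr.
rewrite lvE [in leqRHS]big_ord_recr /= addSn -addnS -addnA leq_add2l addnC leq_add2l ltnS.
have [_ _ hlk _ _] := hSt (lv i).+1; have [Yt _] := tr_spec a i.
by have [] := hlk _ (iter_closed (size (porb a i)) Yt).
Qed.

Definition total_len i := (\sum_(j < i) len j)%N.

Lemma total_lenS i : total_len i.+1 = (total_len i + len i)%N.
Proof. by rewrite /total_len big_ord_recr. Qed.

Lemma len_gt0 i : (0 < len i)%N.
Proof. by have [[]] := hSt (lv i). Qed.

Lemma total_len_ge i : (i <= total_len i)%N.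
Proof.
elim: i => // i IH; rewrite total_lenS -addn1; exact: leq_add IH (len_gt0 i).
Qed.

Lemma size_pre_bounds a i : (total_len i <= size (pre a i) <=
  total_len i + \sum_(k < (lv i).+1) (st_M (St k)).+1)%N.
Proof.
elim: i => [|i IH]; first by rewrite /total_len big_ord0.
have [h1 h2] := size_preS a i; move: h1 h2 IH; rewrite size_porb total_lenS.
set u := size (pre a i.+1); set v := size (pre a i).
set S1 := (\sum_(k < (lv i).+1) _)%N; set S2 := (\sum_(k < (lv i.+1).+1) _)%N.
by clear; lia.
Qed.

Lemma level_cost_split k : level_cost D k =
  ((\sum_(j < k.+1) (st_M (St j)).+1) + \sum_(j < k.+1) st_l (St j))%N.
Proof.
by rewrite /level_cost -big_split /=; apply: eq_bigr => j _; rewrite /D addn1.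
Qed.

Lemma size_porb_le a i : (size (porb a i) <= total_len i + level_cost D (lv i))%N.
Proof.
have /andP[_ h] := size_pre_bounds a i; rewrite size_porb level_cost_split.
rewrite [X in (_ + (_ + X))%N]big_ord_recr /= -/(len i).
by move: h; set S1 := (\sum_(k < _) _)%N; set S2 := (\sum_(k < _) _)%N; clear; lia.
Qed.

Lemma size_porb_ge a i : (total_len i.+1 <= size (porb a i))%N.
Proof.
by have /andP[h _] := size_pre_bounds a i; rewrite size_porb total_lenS leq_add2r.
Qed.

Lemma size_porb_homo a : {homo (fun i => size (porb a i)) : i j / (i < j)%N}.
Proof.
apply: homo_ltn => [j i k|i]; first exact: ltn_trans.
have [h _] := size_preS a i; apply: leq_ltn_trans h _.
by rewrite size_porb -addn1 leq_add2l len_gt0.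
Qed.

Lemma size_porb_wlog a i j : (i <= j)%N -> (size (porb a i) <= size (porb a j))%N.
Proof. by rewrite leq_eqVlt => /predU1P[->//|/(size_porb_homo a)/ltnW]. Qed.

Lemma err_ge0 k : 0 <= err k.
Proof. by rewrite divr_ge0 ?exprn_ge0// ltW. Qed.

(** Leaving stage k moves the points built so far by at most [err k - err k.+1], which telescopes
    over the changes of stage. *)
Lemma porb_dist a i j t : (i <= j)%N -> (t < size (porb a i))%N ->
  dist (nth z (porb a j) t) (nth z (porb a i) t) <= err (lv i) - err (lv j).
Proof.
move=> ij ti; elim: j ij => [|j IH].
  by rewrite leqn0 => /eqP ->; rewrite (distxx Hm) subrr.
rewrite leq_eqVlt => /predU1P[<-|]; first by rewrite (distxx Hm) subrr.
rewrite ltnS => ij; have tj := leq_trans ti (size_porb_wlog a ij).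
have h1 := IH ij; have [h2 _] := size_preS a j.
rewrite /porb nth_cat (leq_trans tj h2) preS; case: eqP => [->//|/eqP ne].
have lvE : lv j.+1 = (lv j).+1.
  by case: (level_step D j) => // E; move: ne; rewrite /lv E eqxx.
rewrite nth_cat size_traject (leq_trans tj (leqnSn _)) nth_traject_default ?(leq_trans tj)// lvE.
have [_ /(_ t (ltnW tj)) h3] := tr_spec a j.
have := dist_triangle Hm (nth z (porb a j) t) (iter t f (tr a j)) (nth z (porb a i) t).
by move: h1 h3; rewrite /porb; lra.
Qed.

(** Any limit point of the tracing points [tr a j] works: the last tracing error is
    [err (lv j) - err (lv j).+1], which keeps the total below [err (lv i)]. *)
Lemma shadow_exists a : exists x, forall i t, (t < size (porb a i))%N ->
  dist (iter t f x) (nth z (porb a i) t) <= err (lv i).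
Proof.
have [x [phi [hphi cv]]] := Hc (tr a).
exists x => i t ti; apply/ler_addgt0Pr => eta eta0.
have [del d0 hdel] := dcontinuous_iter t Hf x eta0.
have [N hN] := cv del d0; set j := phi (maxn N i).
have ij : (i <= j)%N.
  exact: leq_trans (leq_maxr N i) (extraction_ge hphi _).
have h1 := hN _ (leq_maxl N i); rewrite (distC Hm) in h1.
have h2 := hdel _ h1; have h3 := porb_dist ij ti.
have tj := leq_trans ti (size_porb_wlog a ij).
have [_ /(_ t (ltnW tj)) h4] := tr_spec a j.
have h5 := err_ge0 (lv j).+1.
have := dist_triangle Hm (iter t f (tr a j)) (iter t f x) (nth z (porb a i) t).
have := dist_triangle Hm (nth z (porb a j) t) (iter t f (tr a j)) (nth z (porb a i) t).
by move: h2 h3 h4 h5; rewrite -/j; lra.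
Qed.

(** Equal earlier digits put the two loops [i] at the same times. There [x] and [y] are within [e0]
    of their loops and less than [2 * e0] apart, so the loops are less than [4 * e0 = sp] apart. *)
Lemma code_separation a b i n p x y :
  (forall j t, (t < size (porb a j))%N -> dist (iter t f x) (nth z (porb a j) t) <= err (lv j)) ->
  (forall j t, (t < size (porb b j))%N -> dist (iter t f y) (nth z (porb b j) t) <= err (lv j)) ->
  (forall j, (j < i)%N -> a j = b j) -> (a i < st_N (St (lv i)))%N -> (b i < st_N (St (lv i)))%N ->
  (size (porb a i) <= n)%N -> bowen_ball dist f n p e0 x -> bowen_ball dist f n p e0 y ->
  a i = b i.
Proof.
move=> hx hy ab aN bN an px py; apply: contrapT => ne.
have [_ _ _ _ [_ _ hsep _]] := hSt (lv i); have [t [tl st]] := hsep _ _ aN bN ne.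
have pab := pre_eq ab.
have errle : err (lv i) <= e0.
  rewrite /err ler_pdivrMr ?exprn_gt0// ler_peMr ?(ltW e00)// exprn_ege1//; lra.
set u := (size (pre a i) + t)%N.
have uN v : a i = v \/ b i = v -> nth z (pre a i ++ st_sg (St (lv i)) v) u = nth z (st_sg (St (lv i)) v) t.
  by move=> _; rewrite nth_cat /u ltnNge leq_addr/= addKn.
have ua : (u < size (porb a i))%N by rewrite size_porb ltn_add2l.
have ub : (u < size (porb b i))%N by rewrite size_porb -pab ltn_add2l.
have := hx _ _ ua; have := hy _ _ ub; rewrite /porb -pab /seg uN ?uN; [|by left|by right].
have h3 := bowen_ball_dist Hm e00 px py (leq_trans ua an).
set A := nth _ _ _ in st *; set B := nth _ _ _ in st * => h2 h1.
have := dist_triangle Hm (iter u f x) A B.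
have := dist_triangle Hm (iter u f y) (iter u f x) B.
by rewrite (distC Hm A (iter u f x)); move: h1 h2 h3 st errle; rewrite spE; lra.
Qed.

(** The weight decays at rate [s] in the time spent in loops; [n] exceeds that time by links and the
    unfinished loop, an overhead of slope [eta] paid for by [s - s']. *)
Lemma weight_bound (s' : R) : s' < s -> exists2 C : R, 0 < C & forall a i n,
  (n < size (porb a i))%N ->
  \prod_(j < i) (st_N (St (lv j)))%:R^-1 <= C * expR (- (n%:R * s')).
Proof.
move=> ss; have N0 j : (0 : R) < (st_N (St (lv j)))%:R by have [[_]] := hSt (lv j); rewrite ltr0n.
have [s0|s0] := ltP s' 0.
  exists 1 => // a i n _; rewrite mul1r; apply: (@le_trans _ _ 1).
    apply: prodr_ile1 => j _; rewrite invr_ge0 ltW//= invf_le1//.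
    by have := N0 j; rewrite ltr0n ler1n.
  by rewrite -[leLHS]expR0 ler_expR oppr_ge0 mulr_ge0_le0// ltW.
pose eta := (s - s') / (s' + 1).
have s1 : 0 < s' + 1 by rewrite ltr_wpDl.
have eta0 : 0 < eta by rewrite divr_gt0// subr_gt0.
have etas : eta * s' <= s - s'.
  by rewrite /eta mulrAC ler_pdivrMr// ler_wpM2l ?subr_ge0 ?ltW// ltrDl.
have [C C0 hC] := level_cost_sublinear D eta0.
exists (expR (C * s')); first exact: expR_gt0.
move=> a i n ni; rewrite -expRD; set T : R := (total_len i)%:R.
apply: (@le_trans _ _ (expR (- (T * s)))).
  rewrite /T /total_len natr_sum mulr_suml -sumrN expR_sum; apply: ler_prod => j _.
  have [_ h _ _ _] := hSt (lv j).
  by rewrite invr_ge0 ltW//= expRN lef_pV2 ?posrE ?expR_gt0.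
rewrite ler_expR.
have nT : n%:R <= T + (eta * T + C) :> R.
  have : (n <= total_len i + level_cost D (lv i))%N.
    exact: leq_trans (ltnW ni) (size_porb_le a i).
  rewrite -(ler_nat R) natrD => /le_trans; apply; rewrite lerD2l.
  apply: le_trans (hC i) _; rewrite lerD2r ler_wpM2l ?(ltW eta0)// /T ler_nat.
  exact: total_len_ge.
have T0 : 0 <= T by [].
have h1 : n%:R * s' <= (T + (eta * T + C)) * s' by rewrite ler_wpM2r.
have h2 : T * (eta * s') <= T * (s - s') by rewrite ler_wpM2l.
by move: h1 h2; lra.
Qed.

Lemma esum_scale_le (J J' : set nat) (C : R) (b : nat -> R) : 0 <= C -> (forall j, 0 <= b j) ->
  J' `<=` J -> (\esum_(j in J') (C * b j)%:E <= C%:E * \esum_(j in J) (b j)%:E)%E.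
Proof.
move=> C0 b0 JJ; apply: ge_ereal_sup => _ [F [Ff FJ] <-].
under eq_fsbigr do rewrite EFinM.
rewrite -ge0_mule_fsumr; last by move=> j; rewrite lee_fin.
rewrite lee_wpmul2l ?lee_fin//; apply: esum_ge; exists F => //.
by split => //; exact: subset_trans JJ.
Qed.

(** A Bowen ball determines the digits of the loops completed within its length. A cheap cover by
    balls would thus give a family of words covering all codes with total weight below 1, against
    [kraft_cover]. *)
Lemma mB_lim_saturated (Z : set X) (x : (nat -> nat) -> X) (s' : R) :
  (forall a, Z (x a)) ->
  (forall a j t, (t < size (porb a j))%N ->
     dist (iter t f (x a)) (nth z (porb a j) t) <= err (lv j)) ->
  s' < s -> mB_lim dist f Z s' e0 <> 0%E.
Proof.
move=> Zx hx ss; have [C C0 hC] := weight_bound ss.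
move=> /(mB_lim_eq0 _ _ _ _ _)/(_ 0%N) h0.
have : (mB dist f Z s' 0 e0 < (C^-1)%:E)%E by rewrite h0 lte_fin invr_gt0.
move=> /ereal_inf_lt[_ [J [c [[_ cov] ->]]] small].
pose valid a := forall i, (a i < st_N (St (lv i)))%N.
pose good j a := valid a /\ bowen_ball dist f (c j).2 (c j).1 e0 (x a).
have /choice[aa haa] : forall j, exists a, (exists a', good j a') -> good j a.
  move=> j; have [[a' ga]|nb] := pselect (exists a', good j a'); first by exists a'.
  by exists (fun=> 0%N) => /nb.
(* [ln j] is the first loop of the representative code [aa j] that ends after the length of ball
   [j]. *)
have /choice[ln hln] : forall j, exists m, ((c j).2 < size (porb (aa j) m))%N /\
    forall i, (i < m)%N -> (size (porb (aa j) i) <= (c j).2)%N.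
  move=> j; have ex : exists m, ((c j).2 < size (porb (aa j) m))%N.
    exists (c j).2; apply: leq_trans (size_porb_ge _ _); exact: total_len_ge.
  exists (ex_minn ex); case: ex_minnP => m h1 h2; split => // i im.
  by rewrite leqNgt; apply/negP => /h2; rewrite leqNgt im.
have N0 j : (0 < st_N (St (lv j)))%N by have [[]] := hSt (lv j).
pose J' := J `&` [set j | exists a', good j a'].
have := @kraft_cover R (fun i => st_N (St (lv i))) N0 J' ln aa.
have covJ om : valid om -> exists2 j, J' j & forall i, (i < ln j)%N -> om i = aa j i.
  move=> vom; have [j Jj xj] := cov _ (Zx om).
  have gj : exists a', good j a' by exists om.
  exists j => //; have [va ba] := haa j gj; have [_ hl] := hln j.
  elim/ltn_ind => i IH il; apply/esym.
  have agree k : (k < i)%N -> aa j k = om k by move=> ki; rewrite IH// (ltn_trans ki).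
  exact: (code_separation (hx (aa j)) (hx om) agree (va i) (vom i) (hl i il) ba xj).
move=> /(_ covJ); apply/negP; rewrite -ltNge.
apply: (@le_lt_trans _ _ (\esum_(j in J') (C * expR (- ((c j).2%:R * s')))%:E)).
  by apply: le_esum => j _; rewrite lee_fin; exact: (hC (aa j) _ _ (proj1 (hln j))).
apply: le_lt_trans (@esum_scale_le J J' C _ (ltW C0) _ _) _.
- by move=> j; exact: expR_ge0.
- by move=> j [].
- by rewrite -[X in (_ < X%:E)%E](@mulfV _ C) ?gt_eqF// EFinM lte_pmul2l.
Qed.

Definition dev (g : X -> R) x n := \sum_(t < n) (g (iter t f x) - Pint P g).

Lemma devD g x n m : dev g x (n + m) =
  dev g x n + \sum_(t < m) (g (iter (n + t) f x) - Pint P g).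
Proof. by rewrite /dev big_split_ord. Qed.

Lemma dev_add_le g x B n m : (forall y, `|g y - Pint P g| <= B) ->
  `|dev g x (n + m)| <= `|dev g x n| + m%:R * B.
Proof.
move=> hB; rewrite devD; apply: le_trans (ler_normD _ _) _; rewrite lerD2l.
apply: le_trans (ler_norm_sum _ _ _) _.
apply: le_trans (ler_sum _ (fun t _ => hB _)) _.
by rewrite sumr_const card_ord mulr_natl.
Qed.

Lemma dev_mono_le g x B n m : (forall y, `|g y - Pint P g| <= B) -> (n <= m)%N ->
  `|dev g x m| <= `|dev g x n| + (m - n)%:R * B.
Proof. by move=> hB nm; have := dev_add_le x n (m - n) hB; rewrite subnKC. Qed.

Context (a : nat -> nat) (x : X) (hx : forall i t, (t < size (porb a i))%N ->
  dist (iter t f x) (nth z (porb a i) t) <= err (lv i)).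

Lemma dev_block g i w : (forall u v, dist u v <= err (lv i) -> `|g u - g v| <= w) ->
  `|dev g x (size (porb a i))| <= `|dev g x (size (pre a i))| +
    `|\sum_(y <- seg a i) (g y - Pint P g)| + (len i)%:R * w.
Proof.
move=> hw; rewrite size_porb devD -addrA; apply: le_trans (ler_normD _ _) _; rewrite lerD2l.
have -> : \sum_(t < len i) (g (iter (size (pre a i) + t) f x) - Pint P g) =
    \sum_(y <- seg a i) (g y - Pint P g) + \sum_(t < len i)
      (g (iter (size (pre a i) + t) f x) - g (nth z (seg a i) t)).
  rewrite (big_nth z) size_seg big_mkord -big_split/=; apply: eq_bigr => t _; ring.
apply: le_trans (ler_normD _ _) _; rewrite lerD2l.
apply: le_trans (ler_norm_sum _ _ _) _.
apply: (@le_trans _ _ (\sum_(t < len i) w)); last by rewrite sumr_const card_ord mulr_natl.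
apply: ler_sum => t _; apply: hw.
have tl : (size (pre a i) + t < size (porb a i))%N by rewrite size_porb ltn_add2l.
have := hx tl; rewrite /porb nth_cat ifF ?addKn//.
by apply/negbTE; rewrite -leqNgt leq_addr.
Qed.

(** [dev] follows the orbit of [x] itself, so re-tracing only counts through the points it adds, at
    most [B] each; loops of early stages go into the constant. *)
Lemma dev_stage_le g B eta : (forall y, `|g y - Pint P g| <= B) ->
  0 <= eta -> (exists K, forall i, (K <= lv i)%N ->
    `|dev g x (size (porb a i))| <= `|dev g x (size (pre a i))| + (len i)%:R * eta) ->
  exists2 C : R, 0 <= C & forall i, `|dev g x (size (porb a i))| <=
    C + eta * (total_len i.+1)%:R + B * (\sum_(k < (lv i).+1) (st_M (St k)).+1)%:R.
Proof.
move=> hB eta0 [K hK]; have [i0 hi0] := level_unbounded D K.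
have B0 : 0 <= B by exact: le_trans (hB x).
pose S i := (\sum_(k < (lv i).+1) (st_M (St k)).+1)%N.
(* Time spent in loops before [i0], where only the trivial bound [B] per step is available. *)
pose m i := total_len (minn i i0).
have step i : `|dev g x (size (porb a i))| + B * (m i)%:R <=
    `|dev g x (size (pre a i))| + (len i)%:R * eta + B * (m i.+1)%:R.
  have [ii0|ii0] := leqP i0 i.
    rewrite /m !(minn_idPr _) ?(leqW ii0)// lerD2r; apply: hK.
    exact: leq_trans hi0 (level_homo D ii0).
  rewrite /m !(minn_idPl _) ?(ltnW ii0)// total_lenS natrD size_porb.
  have := dev_add_le x (size (pre a i)) (len i) hB.
  have : 0 <= (len i)%:R * eta by rewrite mulr_ge0.
  by lra.
have claim i : `|dev g x (size (pre a i))| <=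
    B * (m i)%:R + eta * (total_len i)%:R + B * (S i)%:R.
  elim: i => [|i IH].
    by rewrite /dev big_ord0 normr0 !addr_ge0// mulr_ge0.
  have [h1 h2] := size_preS a i; rewrite -/(S i) -/(S i.+1) in h2.
  have h3 := dev_mono_le x hB h1.
  have h4 : (size (pre a i.+1) - size (porb a i))%:R * B <= ((S i.+1)%:R - (S i)%:R) * B.
    rewrite ler_wpM2r// lerBrDr -natrD ler_nat.
    by move: h1 h2; clear; set u := size _; set v := size _; lia.
  by have := step i; rewrite total_lenS natrD; lra.
exists (B * (total_len i0)%:R); first by rewrite mulr_ge0.
move=> i; have h1 := claim i; have h2 := step i; rewrite total_lenS natrD -/(S i).
have h3 : B * (m i.+1)%:R <= B * (total_len i0)%:R.
  rewrite ler_wpM2l// ler_nat /m; apply: (@homo_leq _ _ leq _ leq_trans) => // [k|]; last exact: geq_minr.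
  by rewrite total_lenS leq_addr.
lra.
Qed.

Lemma err_le_inv k : err k <= e0 * k.+1%:R^-1.
Proof.
rewrite /err ler_pM2l// lef_pV2 ?posrE ?exprn_gt0// -natrX ler_nat; exact: ltn_expl.
Qed.

Lemma stage_deviation g : dcontinuous_fun dist g -> forall eta : R, 0 < eta ->
  exists K, forall i, (K <= lv i)%N ->
    `|dev g x (size (porb a i))| <= `|dev g x (size (pre a i))| + (len i)%:R * eta.
Proof.
move=> gc eta eta0; have [G /ltW G0 hG] := continuous_bounded Hm Hc gc.
have e8 : 0 < eta / 8 by lra.
have [del d0 hdel] := uniform_continuity_fun Hm Hc gc e8.
have r1 : 0 < Num.min del (Num.min (del / e0) (eta / 4 / (G + 1))).
  by rewrite !lt_min d0 !divr_gt0 ?ltr_wpDl.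
have [K hK] := exists_small r1; exists K => i Ki.
set k := lv i in Ki *; set r : R := k.+1%:R^-1.
have /and3P[rd re rG] : [&& r < del, r < del / e0 & r < eta / 4 / (G + 1)].
  by have := hK _ Ki; rewrite !lt_min.
have r0 : 0 < r by rewrite invr_gt0.
have hw u v : dist u v <= err (lv i) -> `|g u - g v| <= eta / 8.
  move=> uv; apply/ltW/hdel; apply: le_lt_trans uv _; apply: le_lt_trans (err_le_inv k) _.
  by rewrite -ltr_pdivlMl// mulrC.
apply: le_trans (dev_block hw) _; rewrite -addrA lerD2l.
have [_ _ _ _ [_ _ _ havg]] := hSt k.
have osc u v : dist u v < k.+1%:R^-1 -> `|g u - g v| <= eta / 8.
  by move=> uv; apply/ltW/hdel; exact: lt_trans uv rd.
have h1 := havg (a i) g G _ gc hG osc.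
have h2 : G * r <= eta / 4.
  move: rG; rewrite ltr_pdivlMr ?ltr_wpDl// => rG; apply: le_trans (ltW rG).
  by rewrite mulrDr mulr1 mulrC lerDl ltW.
apply: (@le_trans _ _ ((len i)%:R * (2 * (eta / 8) + G * r) + (len i)%:R * (eta / 8))).
  by rewrite lerD2r.
rewrite -mulrDr ler_wpM2l//; lra.
Qed.

(** A time [n] past the first loop lies between the ends of two consecutive loops, whose gap is
    sublinear by the schedule. *)
Lemma dev_sublinear g : dcontinuous_fun dist g -> forall eta : R, 0 < eta ->
  exists2 C : R, 0 <= C & forall n, `|dev g x n| <= C + eta * n%:R.
Proof.
move=> gc eta eta0; have [G _ hG] := continuous_bounded Hm Hc gc.
pose B := G + `|Pint P g|.
have hB y : `|g y - Pint P g| <= B.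
  by apply: le_trans (ler_normB _ _) _; rewrite lerD2r.
have B0 : 0 <= B by exact: le_trans (hB z).
have e2 : 0 < eta / 2 by lra.
have [C1 C10 h1] := dev_stage_le hB (ltW e2) (stage_deviation gc e2).
(* The cost [B * level_cost] is paid twice, once for all links so far and once for the unfinished
   loop. *)
pose eta2 := eta / 2 / (2 * (B + 1)).
have eta20 : 0 < eta2 by rewrite !divr_gt0// mulr_gt0// ltr_wpDl.
have eB : 2 * B * eta2 <= eta / 2.
  have -> : eta / 2 = eta2 * (2 * (B + 1)) by rewrite divfK// gt_eqF// mulr_gt0// ltr_wpDl.
  rewrite mulrC ler_pM2l//; lra.
have [C2 C20 h2] := level_cost_sublinear D eta20.
exists (C1 + 2 * B * C2 + B * (len 0)%:R).
  by rewrite !addr_ge0// !mulr_ge0.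
move=> n; have en : 0 <= eta * n%:R by rewrite mulr_ge0// ltW.
have BC : 0 <= 2 * B * C2 by rewrite !mulr_ge0.
have ex : exists i, (n < size (porb a i))%N.
  exists n; apply: leq_trans (size_porb_ge _ _); exact: total_len_ge.
case: (ex_minnP ex) => -[|i] ni imin.
  have h3 := dev_mono_le x hB (leq0n n); rewrite {2}/dev big_ord0 normr0 add0r subn0 in h3.
  apply: le_trans h3 _.
  have : n%:R * B <= B * (len 0)%:R.
    by rewrite mulrC ler_wpM2l// ler_nat; move: ni; rewrite size_porb/= => /ltnW.
  by lra.
have ni' : (size (porb a i) <= n)%N.
  by rewrite leqNgt; apply/negP => /imin; rewrite ltnn.
have [h3 h4] := size_preS a i.
have gap : (n - size (porb a i) <= level_cost D (lv i.+1))%N.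
  have L : (len i.+1 <= \sum_(j < (lv i.+1).+1) st_l (St j))%N by rewrite big_ord_recr leq_addl.
  move: ni h3 h4 L; rewrite [in X in X -> _]size_porb level_cost_split.
  set S1 := (\sum_(k < _) _)%N; set S2 := (\sum_(k < _) _)%N; set S3 := (\sum_(k < _) _)%N.
  by move: ni' S1 S2 S3; set u := size _; set v := size _; set l := len _; clear; lia.
have h5 := dev_mono_le x hB ni'.
have h6 : (n - size (porb a i))%:R * B <= (level_cost D (lv i.+1))%:R * B.
  by rewrite ler_wpM2r// ler_nat.
have h7 : B * (\sum_(k < (lv i).+1) (st_M (St k)).+1)%:R <= (level_cost D (lv i.+1))%:R * B.
  rewrite mulrC ler_wpM2r// ler_nat.
  apply: leq_trans (level_cost_homo D (level_homo D (leqnSn i))).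
  by rewrite level_cost_split leq_addr.
have tn : (total_len i.+1 <= n)%N := leq_trans (size_porb_ge a i) ni'.
have h8 : (level_cost D (lv i.+1))%:R * B <= (eta2 * n%:R + C2) * B.
  rewrite ler_wpM2r//; apply: le_trans (h2 _) _; rewrite lerD2r ler_wpM2l ?(ltW eta20)//.
  by rewrite ler_nat; apply: leq_trans tn; exact: total_len_ge.
have h9 : eta / 2 * (total_len i.+1)%:R <= eta / 2 * n%:R by rewrite ler_wpM2l ?(ltW e2)// ler_nat.
have h10 : 2 * B * eta2 * n%:R <= eta / 2 * n%:R by rewrite ler_wpM2r.
have h11 := h1 i; have h12 : 0 <= B * (len 0)%:R by rewrite mulr_ge0.
by move: h5 h6 h7 h8 h9 h10 h11 h12; lra.
Qed.

Lemma saturated_average g : dcontinuous_fun dist g -> forall eta : R, 0 < eta ->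
  exists N, forall n, (N <= n)%N -> `|emp_int f x n g - Pint P g| <= eta.
Proof.
move=> gc eta eta0; have e2 : 0 < eta / 2 by lra.
have [C C0 hC] := dev_sublinear gc e2.
have r0 : 0 < eta / 2 / (C + 1) by rewrite divr_gt0// ltr_wpDl.
have [N hN] := exists_small r0; exists N.+1 => -[//|n] Nn.
have -> : emp_int f x n.+1 g - Pint P g = n.+1%:R^-1 * dev g x n.+1.
  rewrite /emp_int /dev big_split/= mulrDr; congr (_ + _).
  by rewrite sumr_const card_ord -[X in _ * X]mulr_natr [RHS]mulrC mulfK// pnatr_eq0.
rewrite normrM ger0_norm ?invr_ge0// ler_pdivrMl//.
apply: le_trans (hC _) _.
have h1 := ltW (hN n Nn).
have h2 : C <= eta / 2 * n.+1%:R.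
  move: h1; rewrite ler_pdivlMr ?ltr_wpDl// -ler_pdivlMl ?invr_gt0// invrK => h1.
  by rewrite mulrC; lra.
lra.
Qed.

End Saturation.

(** * The lower bound *)

Section LowerBound.
Context {R : realType} {d : measure_display} {X : measurableType d}.
Context (dist : X -> X -> R) (Hm : is_metric dist) (Hb : borel_for_dist dist).
Context (Hc : dcompact dist) (f : X -> X) (Hf : dcontinuous_map dist f).
Let mf := measurable_dcontinuous_map Hb Hf.

(** The generic points of [P]. As [P] need not be ergodic, they need not carry [P]. *)
Definition saturated (P : probability X R) := [set x | forall g, dcontinuous_fun dist g ->
  forall e : R, 0 < e -> exists N, forall n, (N <= n)%N -> `|emp_int f x n g - Pint P g| <= e].

Lemma Vlim_saturated P x nu : saturated P x -> Vlim dist f x nu ->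
  forall g, dcontinuous_fun dist g -> Pint nu g = Pint P g.
Proof.
move=> sx Vn g gc; apply/eqP; rewrite -subr_eq0 -normr_le0; apply/ler_addgt0Pr => e epos.
have e2 : 0 < e / 2 by lra.
have [N hN] := sx g gc _ e2.
have [//|n Nn /(_ ord0) h] := Vn 1%N (fun=> g) (e / 2) _ N.
have := hN n Nn; rewrite distrC in h.
have := ler_normD (Pint nu g - emp_int f x n g) (emp_int f x n g - Pint P g).
by rewrite addrA subrK add0r; move: h; lra.
Qed.

(** Each partition is treated separately, which also covers infinite entropy. The loops grow at a
    rate [s] strictly between the target [s0] and [h_part]. *)
Lemma hBowen_saturated (Y : set X) (cY : dclosed dist Y) (fY : forall x, Y x -> Y (f x))
  (hlink : chain_linked dist f Y) (htr : chain_traced dist f Y)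
  (P : probability X R) : Defs.invariant f P -> P Y = 1%E ->
  (ks_entropy f P <= hBowen dist f (saturated P))%E.
Proof.
move=> Pf PY; have [z Yz] : Y !=set0.
  apply/set0P/eqP => Y0; move: PY; rewrite Y0 measure0 => /eqP.
  by rewrite eq_sym onee_eq0.
apply: ge_ereal_sup => _ [Q fQ <-].
suff H (s0 : R) : s0 < h_part f P Q -> (s0%:E <= hBowen dist f (saturated P))%E.
  apply/lee_subgt0Pr => e epos; rewrite -EFinB; apply: H; lra.
move=> s0h; pose s := (s0 + h_part f P Q) / 2.
have ss0 : s0 < s by rewrite /s; lra.
have sh : s < h_part f P Q by rewrite /s; lra.
have [sp [sp0 hsp]] := stage_exists Hm Hb Hc Hf cY fY Yz hlink htr Pf PY fQ sh.
have e00 : 0 < sp / 4 by lra.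
have spE : sp = 4 * (sp / 4) by lra.
have /choice[St hSt] : forall k, exists S, stage_ok dist f Y z P sp
    (sp / 4 / 2 ^+ k - sp / 4 / 2 ^+ k.+1) s k S.
  move=> k; apply: hsp; rewrite -mulrBr mulr_gt0// subr_gt0.
  by rewrite ltf_pV2 ?posrE ?exprn_gt0// exprS ltr_pMl ?exprn_gt0// ltr1n.
have /choice[x hx] := shadow_exists Hm Hc Hf Yz fY e00 hSt.
apply: (hBowen_ge e00) => s' h0; rewrite leNgt; apply/negP => s's.
have xZ a : saturated P (x a).
  by move=> g gc e epos; exact: (saturated_average Hm Hc Yz fY e00 hSt (hx a)).
exact: (mB_lim_saturated Hm Yz fY e00 spE hSt xZ hx (lt_trans s's ss0)) h0.
Qed.

Lemma ks_entropy_ge0 (P : probability X R) : Defs.invariant f P -> (0 <= ks_entropy f P)%E.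
Proof.
move=> Pf; have fQ : fpartition [:: [set: X]].
  split; first by move=> [|i] //= _; exact: measurableT.
  by split=> [[|i] [|j]//|x]; exists 0%N.
by apply: (@le_trans _ _ (h_part f P [:: setT])%:E);
  [rewrite lee_fin (h_part_ge0 mf Pf fQ)|apply: ereal_sup_ubound; exists [:: setT]].
Qed.

(** Common form of both statements. The last condition is there because a limit measure of a
    saturated point is known only through its integrals of continuous functions, not as the same
    term. *)
Lemma hBowen_Delta (mu nu0 : probability X R) (I : set (probability X R)) k
    (gs : 'I_k -> X -> R) eps : POTP dist f -> ergodic f mu ->
  I `<=` Minv_on f (supp dist mu) -> I nu0 -> basic_data dist gs eps ->
  (forall nu', Defs.invariant f nu' -> wnbhd gs eps nu0 nu' -> I nu') ->
  (forall nu nu', I nu -> Defs.invariant f nu' ->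
     (forall g, dcontinuous_fun dist g -> Pint nu' g = Pint nu g) -> I nu') ->
  hBowen dist f (Delta_sub dist f I) = ereal_sup [set ks_entropy f nu | nu in I] /\
  hBowen dist f (Delta_cap dist f I) = ereal_sup [set ks_entropy f nu | nu in I].
Proof.
move=> Hp emu IY I0 hgs hI Iext; pose Y := supp dist mu; pose h := ereal_sup [set ks_entropy f nu | nu in I].
have [muf _] := emu.
have cY : dclosed dist Y := dclosed_supp Hm Hb (mu := mu).
have fY x : Y x -> Y (f x) by exact: (supp_stable Hm Hb Hf muf).
have hlink : chain_linked dist f Y by move=> del; exact: chain_link.
have [nu0f nu0Y] := IY _ I0.
have htr := finite_tracing Hm Hb Hc Hf Hp cY fY hlink nu0f nu0Y hgs
  (fun nu' nuf' w => proj2 (IY _ (hI nu' nuf' w))).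
have lower : (h <= hBowen dist f (Delta_sub dist f I))%E.
  apply: ge_ereal_sup => _ [nu Inu <-]; have [nuf nuY] := IY _ Inu.
  apply: le_trans (hBowen_saturated cY fY hlink htr nuf nuY) _; apply: hBowen_sub => x sx nu' Vn.
  exact: Iext Inu (Vlim_invariant Hm Hb Hc Hf Vn) (Vlim_saturated sx Vn).
have mid : (hBowen dist f (Delta_sub dist f I) <= hBowen dist f (Delta_cap dist f I))%E.
  apply: hBowen_sub => x sx; have [nu Vn] := Vlim_nonempty Hm Hb Hc f x.
  by exists nu; split => //; exact: sx.
have upper : (hBowen dist f (Delta_cap dist f I) <= h)%E.
  have h0 : (0 <= h)%E.
    by apply: le_trans (ks_entropy_ge0 nu0f) _; apply: ereal_sup_ubound; exists nu0.
  (* Nonnegativity excludes minus infinity and supplies the condition on [t] in [bowen_upper]. *)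
  case E : h h0 => [t| |//] h0; last by rewrite leey.
  rewrite lee_fin in h0; apply: le_trans (bowen_upper Hm Hb Hc Hf h0); apply: hBowen_sub.
  move=> x [nu [Vn Inu]]; exists nu; split => //; rewrite -E.
  by apply: ereal_sup_ubound; exists nu.
split; apply/eqP; rewrite eq_le -/h.
  by rewrite (le_trans mid upper) lower.
by rewrite upper (le_trans lower mid).
Qed.

End LowerBound.

Theorem theorem2p4 (R : realType) (d : measure_display) (X : measurableType d)
  (dist : X -> X -> R) (f : X -> X) (mu : probability X R) :
  is_metric dist -> borel_for_dist dist -> dcompact dist ->
  dcontinuous_map dist f -> POTP dist f -> ergodic f mu ->
  (forall U : set (probability X R),
     U `<=` Minv_on f (supp dist mu) -> U !=set0 -> wopen_in_Minv dist f U ->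
     hBowen dist f (Delta_sub dist f U) = ereal_sup [set ks_entropy f nu | nu in U] /\
     hBowen dist f (Delta_cap dist f U) = ereal_sup [set ks_entropy f nu | nu in U]) /\
  (forall K : set (probability X R),
     K `<=` Minv_on f (supp dist mu) -> convex_set_meas K ->
     winterior_in_Minv dist f K !=set0 ->
     hBowen dist f (Delta_sub dist f K) = ereal_sup [set ks_entropy f nu | nu in K] /\
     hBowen dist f (Delta_cap dist f K) = ereal_sup [set ks_entropy f nu | nu in K]).
Proof.
move=> Hm Hb Hc Hf Hp emu; split=> [U UY [nu0 U0] oU|K KY cK [nu0 [nu0f [k [gs [eps [hgs hK]]]]]]].
  have [k [gs [eps [hgs hU]]]] := oU _ U0.
  apply: (hBowen_Delta Hm Hb Hc Hf Hp emu UY U0 hgs hU) => nu nu' Unu nuf' E.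
  have [k' [gs' [eps' [[gc e0] h]]]] := oU _ Unu.
  by apply: h => // i; rewrite E// subrr normr0.
have K0 : K nu0.
  by apply: hK => // i; rewrite subrr normr0; case: hgs.
apply: (hBowen_Delta Hm Hb Hc Hf Hp emu KY K0 hgs hK) => nu nu' Knu nuf' E.
(* A trivial convex combination: convexity makes membership in [K] depend only on the values of the
   measure. *)
apply: (cK nu nu nu' 1 Knu Knu); first by rewrite ler01 lexx.
move=> A mA; rewrite subrr mul0e adde0 mul1e !prE//; congr EFin.
apply: (eq_pr_Pint Hm Hb E Hc mA).
Qed.
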